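(* Suppose there is a deterministic algorithm $\mathcal{A}$ that on every $n$-vertex $m$-edge graph (with positive edge lengths) builds a $t$-spanner of size $s(n)$ in time $\tau(n,m,t)$. Then there is an algorithm that on any such graph builds an $f$-fault tolerant $t$-spanner of (1) size $O(f^3\cdot s(n/f))$ and time $O(f^3(\tau(n/f,m,t)+m))$, if $f\ge n^{1/c}$ for some constant $c\in\mathbb{N}$; (2) size $O(\log^5 n\cdot s(n/f))$ and time $O(\log^5 n\,(\tau(n/f,m,t)+m))$, if $f\le \log n$; (3) size $O((f\log n)^3\cdot s(n/f))$ and time $O((f\log n)^3(\tau(n/f,m,t)+m))$, if $f\in[\log n,n^{o(1)}]$.
   Context: For a graph $G=(V,E)$ with positive edge lengths, a subgraph $H\subseteq G$ is a $t$-spanner if $\mathrm{dist}(u,v,H)\le t\cdot \mathrm{dist}(u,v,G)$ for all $u,v\in V$. It is an $f$-fault tolerant $t$-spanner (with respect to vertex faults) if $\mathrm{dist}(u,v,H\setminus F)\le t\cdot\mathrm{dist}(u,v,G\setminus F)$ for every $u,v\in V$ and every $F\subseteq V$ with $|F|\le f$. The size of a spanner is its number of edges.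
   Formalization: Proved for 1 ≤ f < n with n/f rounded up (for f = n and s(1) = 0 the claim fails), and for τ(n,m,t) nondecreasing in m, since τ(n/f,m,t) is otherwise meaningless when m exceeds the possible number of edges on n/f vertices. *)

(* Defs.v *)
From mathcomp Require Import all_boot all_order all_algebra.
From mathcomp Require Import all_classical all_reals all_analysis.
From Stdlib Require PeanoNat.

Set Implicit Arguments.
Unset Strict Implicit.
Unset Printing Implicit Defensive.

Import Order.TTheory GRing.Theory Num.Theory.
Import numFieldNormedType.Exports.

Local Open Scope ring_scope.

(** * Weighted graphs, distances, spanners *)

(** A finite simple graph with vertex set ['I_n]; an edge is a two-element set
    of vertices. [len] is only meaningful on [edges]. *)
Record wgraph (R : realType) (n : nat) := WGraph {
  edges : {set {set 'I_n}};
  len : {set 'I_n} -> R;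
  edges_card2 : forall e, e \in edges -> #|e| = 2%N;
  len_gt0 : forall e, e \in edges -> 0 < len e }.

Section Graphs.
Variables (R : realType) (n : nat).
Implicit Types (w : {set 'I_n} -> R) (E H : {set {set 'I_n}}) (u v : 'I_n).

Definition adj E : rel 'I_n := [rel u v | [set u; v] \in E].

(** Total length of the walk [u :: p]. *)
Definition walk_len w u (p : seq 'I_n) : R :=
  \sum_(e <- pairmap (fun x y => [set x; y]) u p) w e.

(** The infimum over the empty set is [+oo], so [dist] is [+oo] between
    different components. *)
Definition dist w E u v : \bar R :=
  ereal_inf [set (walk_len w u p)%:E | p in
    [set p : seq 'I_n | path (adj E) u p /\ last u p = v]].

(** Vertex deletion. The deleted vertices stay behind as isolated vertices,
    which does not affect distances between the others. *)
Definition delete_vertices E (F : {set 'I_n}) : {set {set 'I_n}} :=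
  [set e in E | [disjoint e & F]].

Definition is_spanner (t : R) (G : wgraph R n) H : Prop :=
  H \subset edges G /\
  forall u v, (dist (len G) H u v <= t%:E * dist (len G) (edges G) u v)%E.

Definition is_ft_spanner (f : nat) (t : R) (G : wgraph R n) H : Prop :=
  H \subset edges G /\
  forall F : {set 'I_n}, (#|F| <= f)%N -> forall u v,
    (dist (len G) (delete_vertices H F) u v <=
       t%:E * dist (len G) (delete_vertices (edges G) F) u v)%E.

(** [es] lists every edge of [G] exactly once, in arbitrary order and with
    arbitrary orientation. *)
Definition edge_of (e : 'I_n * 'I_n) : {set 'I_n} := [set e.1; e.2].

Definition edge_list (G : wgraph R n) (es : seq ('I_n * 'I_n)) : Prop :=
  perm_eq [seq edge_of e | e <- es] (enum (edges G)).

End Graphs.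

(** * Machine model

    A word RAM with a separate real-valued memory for edge lengths. Each memory
    is a family of zero-initialised arrays (a program mentions only finitely
    many of them); cell [0] of an array serves as a scalar variable. Words are
    natural numbers smaller than a bound [W]; a program that produces a word
    [>= W] gets stuck. Reals can be added, subtracted, multiplied, divided and
    compared, but not rounded to words. Every operation and every memory access
    costs one unit of time. *)

Variant wop :=
  WAdd | WSub (* truncated *) | WMul | WDiv | WMod | WAnd | WOr | WXor.

Variant rop := RAdd | RSub | RMul | RDiv.

Inductive wexpr :=
  | WConst of nat
  | WGet of nat & wexpr                 (* array name, index *)
  | WOp of wop & wexpr & wexpr.

Inductive rexpr :=
  | ROfWord of wexpr
  | RGet of nat & wexpr
  | ROp of rop & rexpr & rexpr.

Inductive bexpr :=
  | BEqW of wexpr & wexpr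
  | BLeW of wexpr & wexpr
  | BLeR of rexpr & rexpr
  | BNot of bexpr
  | BAnd of bexpr & bexpr.

Inductive cmd :=
  | CSkip
  | CSetW of nat & wexpr & wexpr        (* array name, index, value *)
  | CSetR of nat & wexpr & rexpr
  | CSeq of cmd & cmd
  | CIf of bexpr & cmd & cmd
  | CWhile of bexpr & cmd.

Fixpoint wcost (e : wexpr) : nat :=
  match e with
  | WConst _ => 1
  | WGet _ i => (wcost i).+1
  | WOp _ e1 e2 => (wcost e1 + wcost e2).+1
  end.

Fixpoint rcost (e : rexpr) : nat :=
  match e with
  | ROfWord e => (wcost e).+1
  | RGet _ i => (wcost i).+1
  | ROp _ e1 e2 => (rcost e1 + rcost e2).+1
  end.

Fixpoint bcost (b : bexpr) : nat :=
  match b with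
  | BEqW e1 e2 | BLeW e1 e2 => (wcost e1 + wcost e2).+1
  | BLeR e1 e2 => (rcost e1 + rcost e2).+1
  | BNot b => (bcost b).+1
  | BAnd b1 b2 => (bcost b1 + bcost b2).+1
  end.

Definition wop_sem (o : wop) : nat -> nat -> nat :=
  match o with
  | WAdd => addn | WSub => subn | WMul => muln | WDiv => divn | WMod => modn
  | WAnd => PeanoNat.Nat.land | WOr => PeanoNat.Nat.lor
  | WXor => PeanoNat.Nat.lxor
  end.

Section Semantics.
Variables (R : realType) (W : nat).

Record state := State { wmem : nat -> nat -> nat; rmem : nat -> nat -> R }.

Definition update (T : Type) (m : nat -> nat -> T) (a i : nat) (x : T) :=
  fun b j => if (b == a) && (j == i) then x else m b j.

Definition setw (st : state) a i x := State (update (wmem st) a i x) (rmem st).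
Definition setr (st : state) a i x := State (wmem st) (update (rmem st) a i x).

Definition rop_sem (o : rop) (x y : R) : R :=
  match o with
  | RAdd => x + y | RSub => x - y | RMul => x * y | RDiv => x / y
  end.

Definition fits (x : nat) : option nat := if (x < W)%N then Some x else None.

Definition lift2 (A B : Type) (g : A -> A -> B) (x y : option A) : option B :=
  obind (fun a => omap (g a) y) x.

(** [None] is a word overflow. *)
Fixpoint weval (st : state) (e : wexpr) : option nat :=
  match e with
  | WConst k => fits k
  | WGet a i => obind (fun j => fits (wmem st a j)) (weval st i)
  | WOp o e1 e2 => obind fits (lift2 (wop_sem o) (weval st e1) (weval st e2))
  end.

Fixpoint reval (st : state) (e : rexpr) : option R :=
  match e with
  | ROfWord e => omap (fun k => k%:R) (weval st e)
  | RGet a i => omap (rmem st a) (weval st i)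
  | ROp o e1 e2 => lift2 (rop_sem o) (reval st e1) (reval st e2)
  end.

Fixpoint beval (st : state) (b : bexpr) : option bool :=
  match b with
  | BEqW e1 e2 => lift2 eqn (weval st e1) (weval st e2)
  | BLeW e1 e2 => lift2 leq (weval st e1) (weval st e2)
  | BLeR e1 e2 => lift2 (fun x y : R => x <= y) (reval st e1) (reval st e2)
  | BNot b => omap negb (beval st b)
  | BAnd b1 b2 => lift2 andb (beval st b1) (beval st b2)
  end.

(** [exec c st T st']: started in [st], the command [c] terminates in [st']
    after [T] time units. *)
Inductive exec : cmd -> state -> nat -> state -> Prop :=
  | exec_skip st : exec CSkip st 1 st
  | exec_setw a ei ev st i x :
      weval st ei = Some i -> weval st ev = Some x ->
      exec (CSetW a ei ev) st (wcost ei + wcost ev).+1 (setw st a i x)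
  | exec_setr a ei ev st i x :
      weval st ei = Some i -> reval st ev = Some x ->
      exec (CSetR a ei ev) st (wcost ei + rcost ev).+1 (setr st a i x)
  | exec_seq c1 c2 st T1 st1 T2 st2 :
      exec c1 st T1 st1 -> exec c2 st1 T2 st2 ->
      exec (CSeq c1 c2) st (T1 + T2)%N st2
  | exec_if b c1 c2 st x T st1 :
      beval st b = Some x -> exec (if x then c1 else c2) st T st1 ->
      exec (CIf b c1 c2) st (bcost b + T)%N st1
  | exec_while_false b c st :
      beval st b = Some false -> exec (CWhile b c) st (bcost b) st
  | exec_while_true b c st T1 st1 T2 st2 :
      beval st b = Some true ->
      exec c st T1 st1 -> exec (CWhile b c) st1 T2 st2 ->
      exec (CWhile b c) st (bcost b + T1 + T2)%N st2.

Lemma exec_deterministic c st T st1 T' st1' :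
  exec c st T st1 -> exec c st T' st1' -> T = T' /\ st1 = st1'.
Proof.
move=> H; elim: H T' st1' => {c st T st1}.
- by move=> st T' st' H; inversion H.
- move=> a ei ev st i x Hi Hx T' st' H; inversion H; subst.
  by split=> //; congruence.
- move=> a ei ev st i x Hi Hx T' st' H; inversion H; subst.
  by split=> //; congruence.
- move=> c1 c2 st T1 st1 T2 st2 _ IH1 _ IH2 T' st' H; inversion H; subst.
  have [? ?] := IH1 _ _ ltac:(eassumption); subst.
  by have [? ?] := IH2 _ _ ltac:(eassumption); subst.
- move=> b c1 c2 st x T st1 Hb _ IH T' st' H; inversion H; subst.
  match goal with Hy : beval st b = Some _ |- _ =>
    move: Hy; rewrite Hb => -[?]; subst end.
  by have [? ?] := IH _ _ ltac:(eassumption); subst.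
- by move=> b c st Hb T' st' H; inversion H; subst=> //; congruence.
- move=> b c st T1 st1 T2 st2 Hb _ IH1 _ IH2 T' st' H.
  inversion H; subst; first by congruence.
  have [? ?] := IH1 _ _ ltac:(eassumption); subst.
  by have [? ?] := IH2 _ _ ltac:(eassumption); subst.
Qed.

End Semantics.

(** * Algorithms on graphs *)

(** On a graph with [n] vertices and [m] edges an algorithm works with words
    below [(n + m + 2) ^ word_exp], i.e. of [O(log (n + m))] bits. *)
Record algorithm := Algorithm { code : cmd; word_exp : nat }.

Definition word_bound (A : algorithm) (n m : nat) : nat :=
  ((n + m + 2) ^ word_exp A)%N.

Section Algorithms.
Variables (R : realType) (n : nat).

(** Input: word array 0 holds the parameters [ps], word arrays 1 and 2 the
    endpoints of the edges, real array 0 their lengths, and cell 0 of real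
    array 1 the stretch [t]. *)
Definition input (ps : seq nat) (t : R) (G : wgraph R n)
    (es : seq ('I_n * 'I_n)) : state R :=
  State
    (fun a i => nth 0%N (nth [::] [:: ps; [seq nat_of_ord e.1 | e <- es];
                                      [seq nat_of_ord e.2 | e <- es]] a) i)
    (fun a i => nth 0 (nth [::] [:: [seq len G (edge_of e) | e <- es];
                                    [:: t]] a) i).

(** Output: the [i]-th edge is selected if cell [i] of word array 3 is
    nonzero. *)
Definition output (es : seq ('I_n * 'I_n)) (st : state R) : {set {set 'I_n}} :=
  [set edge_of (tnth (in_tuple es) i) | i : 'I_(size es) & wmem st 3 i != 0%N].

(** Given [G], presented by [es], the algorithm outputs [H] within exactly [T]
    time units. *)
Definition runs (A : algorithm) (ps : seq nat) (t : R) (G : wgraph R n)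
    (es : seq ('I_n * 'I_n)) (T : nat) (H : {set {set 'I_n}}) : Prop :=
  exists st, exec (word_bound A n (size es)) (code A) (input ps t G es) T st /\
             H = output es st.

End Algorithms.

Definition builds_spanners (R : realType) (A : algorithm) (t : R)
    (s : nat -> R) (tau : nat -> nat -> R -> R) : Prop :=
  forall (n : nat) (G : wgraph R n) (es : seq ('I_n * 'I_n)),
    edge_list G es ->
    exists (T : nat) (H : {set {set 'I_n}}),
      [/\ runs A [:: n; #|edges G|] t G es T H,
          is_spanner t G H,
          #|H|%:R <= s n
        & T%:R <= tau n #|edges G| t].

(** [n / f], rounded up. *)
Definition ceil_div (n f : nat) : nat := ((n + f).-1 %/ f)%N.

Definition log2 (R : realType) (n : nat) : R := ln n%:R / ln 2%:R.

(* Main.v *)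
(** Cover the vertices by few sets [V], each with at most [n / f] elements, so
    that for every fault set [F] with at most [f] elements and every edge [uv]
    avoiding [F] some [V] contains [u] and [v] and misses [F]. The union of
    spanners of the graphs induced on these sets is then fault tolerant: a
    surviving edge [uv] is spanned inside a [V] that no fault touches.

    The sets are the preimages of pairs of values of hash functions. Plain
    Reed-Solomon hashing evaluates, at each point of the field with [q]
    elements, the polynomial whose coefficients are the base-[q] digits of the
    vertex. Two such polynomials of degree less than [K] agree at few points,
    so a union bound over the [2 f] pairs to be separated works as soon as
    [q >= 4 f K]; this uses [q ^ 3] sets. With [q = O(f c)] resp.
    [q = O(f log n)] (Chebyshev: every [x, C x] contains a prime) this gives
    the first and third bounds. For the second one, [q = O(log ^ 2 n)] is
    hashed again to [Q = O(log n)] values by the [Q] lines over the field with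
    [Q] elements, which uses [q Q ^ 3 = O(log ^ 5 n)] sets. The program takes
    the cheaper of the two families, so one program serves all three regimes.

    The given algorithm is run on each induced subgraph with all its memory
    accesses shifted to a region of memory not used before, which is therefore
    zero and need not be cleared. *)

Require Import Defs.
From mathcomp Require Import all_boot all_order all_algebra.
From mathcomp Require Import boolp all_reals.
From mathcomp Require Import zify.

Set Implicit Arguments.
Unset Strict Implicit.
Unset Printing Implicit Defensive.

Import GRing.Theory.

(** * Primes in every interval [x, C x] *)

(** The bounds [s] and [tau] are used at exactly [ceil_div n f] vertices, and [s] is not known to be
    monotone. So it is not enough that a set [V] is small: its vertices need distinct names below
    [ceil_div n f], cheap to compute, and the induced graph is padded with isolated vertices.
    Reed-Solomon hashing supplies the names, because the hash value and the high digits of a vertex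
    determine its lowest digit. The factor 8 in [8 * f <= q] pays for the roundings in these names
    and for having two classes per set. No logarithm or root is ever computed. [K] is
    [q %/ (4 * f)], and [q] is the first prime from [8 * f] on with [n <= q ^ K]. This single test
    gives q = O(f log n) always and q = O(f c) as soon as [f ^ c] reaches [n]. All overhead has to
    be paid for by the runs. Searching primes by trial division costs O(q^2), which is affordable
    because either family has at least q^2 sets. *)

Lemma bin_double_le N : 'C(N.*2, N) <= 4 ^ N.
Proof.
have -> : 4 ^ N = 2 ^ N.*2 by rewrite -mul2n expnM.
rewrite (expnDn 1 1) (bigD1 (inord N)) //= !exp1n !muln1 inordK; last by lia.
exact: leq_addr.
Qed.

Lemma bin_double_ge N : 2 ^ N <= 'C(N.*2, N).
Proof.
elim: N => [|N IH] //; rewrite doubleS binS expnS.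
have le1 : 'C(N.*2, N) <= 'C(N.*2.+1, N.+1) by rewrite binS leq_addl.
have le2 : 'C(N.*2, N) <= 'C(N.*2.+1, N).
  by case: N {IH le1} => // N; rewrite [X in _ <= X]binS leq_addr.
by lia.
Qed.

Lemma sum_leq_bool n t : \sum_(1 <= k < n.+1) (k <= t) = minn n t.
Proof.
elim: n => [|n IH]; first by rewrite big_geq // min0n.
by rewrite big_nat_recr //= IH; lia.
Qed.

(** Legendre's formula: the exponent of [p] is the sum over [k] of [N.*2 %/ p ^ k] minus twice
    [N %/ p ^ k]. Each term is at most 1 and vanishes once [p ^ k] exceeds [N.*2], so the exponent
    is at most [trunc_log p N.*2]. *)
Lemma pow_logn_central_bin p N :
  prime p -> 0 < N -> p ^ logn p 'C(N.*2, N) <= N.*2.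
Proof.
move=> p_pr N0; have p1 := prime_gt1 p_pr.
set t := trunc_log p N.*2.
suff le_t : logn p 'C(N.*2, N) <= t.
  apply: leq_trans (trunc_logP p1 _); last by lia.
  by rewrite leq_exp2l.
have le_bin : N <= N.*2 by lia.
have /(congr1 (logn p)) := bin_fact le_bin.
have subN : N.*2 - N = N by lia.
rewrite subN !lognM ?muln_gt0 ?fact_gt0 ?bin_gt0 //.
rewrite !logn_fact //.
have ext : \sum_(1 <= k < N.+1) N %/ p ^ k = \sum_(1 <= k < N.*2.+1) N %/ p ^ k.
  rewrite (@big_cat_nat _ _ _ N.+1 1 N.*2.+1) //=.
  rewrite [X in _ = _ + X]big_nat [X in _ = _ + X]big1 ?addn0 // => k /andP[Nk _].
  by rewrite divn_small // (leq_trans Nk) // ltnW // ltn_expl.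
rewrite ext => eqS.
have : \sum_(1 <= k < N.*2.+1) N.*2 %/ p ^ k <=
       \sum_(1 <= k < N.*2.+1) (N %/ p ^ k + N %/ p ^ k + (k <= t)).
  apply: leq_sum => k _.
  have pk0 : 0 < p ^ k by rewrite expn_gt0; lia.
  have [kt|tk] := leqP k t.
    have lt := ltn_ceil N pk0.
    rewrite -ltnS ltn_divLR // -addnn; apply: leq_trans (_ : (N %/ p ^ k).+1 * p ^ k + (N %/ p ^ k).+1 * p ^ k <= _); first by lia.
    by rewrite -mulnDl leq_mul2r; lia.
  rewrite divn_small //.
  have := trunc_log_ltn N.*2 p1; rewrite -/t => lt.
  apply: leq_trans lt _; by rewrite leq_pexp2l //; lia.
rewrite !big_split /= sum_leq_bool; lia.
Qed.

Lemma prod_primes_dvd m a b :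
  (forall p, a <= p < b -> prime p -> p %| m) ->
  \prod_(a <= p < b | prime p) p %| m.
Proof.
elim: b => [|b IH] H; first by rewrite big_geq.
have [lt_ba|le_ab] := ltnP b a; first by rewrite big_geq.
rewrite big_mkcond big_nat_recr //= -big_mkcond /=.
have dv : \prod_(a <= p < b | prime p) p %| m.
  by apply: IH => p /andP[ap pb] pp; apply: H => //; rewrite ap ltnW.
case: ifP => [b_pr|_]; last by rewrite muln1.
rewrite Gauss_dvd ?dv ?H ?le_ab //=.
rewrite big_nat_cond; elim/big_ind: _ => [||p /andP[/andP[_ pb] pp]].
- by rewrite coprime1n.
- by move=> x y cx cy; rewrite coprimeMl cx.
- by rewrite prime_coprime // dvdn_prime2 // neq_ltn pb.
Qed.

Lemma dvdn_fact_prime p m : prime p -> (p %| m`!) = (p <= m).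
Proof.
move=> p_pr; apply/idP/idP => [|le_pm]; last by rewrite dvdn_fact // prime_gt0.
elim: m => [|m IH]; first by rewrite Euclid_dvd1.
rewrite factS Euclid_dvdM // => /orP[/dvdn_leq -> //|/IH]; lia.
Qed.

(** Erdos's argument: the primes above [2 ^ i] and up to [2 ^ i.+1] all divide the central binomial
    coefficient of row [2 ^ i.+1], so their product is at most [4 ^ 2 ^ i]. Restricting to powers of
    two makes the induction a plain doubling. *)
Lemma primorial_pow2_le i : \prod_(0 <= p < (2 ^ i).+1 | prime p) p <= 4 ^ 2 ^ i.
Proof.
elim: i => [|i IH]; first by rewrite unlock.
rewrite (@big_cat_nat _ _ _ (2 ^ i).+1) //=; last by rewrite ltnS leq_exp2l.
rewrite expnS mul2n -addnn expnD; apply: leq_mul => //.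
apply: leq_trans (bin_double_le _).
apply: dvdn_leq; first by rewrite bin_gt0; lia.
rewrite addnn; apply: prod_primes_dvd => p /andP[lt_p p_lt] p_pr.
have le_bin : 2 ^ i <= (2 ^ i).*2 by lia.
have : p %| ((2 ^ i).*2)`! by rewrite dvdn_fact // prime_gt0 //=; lia.
have subN : (2 ^ i).*2 - 2 ^ i = 2 ^ i by lia.
rewrite -(bin_fact le_bin) subN !Euclid_dvdM // => /orP[//|/orP] H.
have {}H : p %| (2 ^ i)`! by case: H.
exfalso; move: H; rewrite dvdn_fact_prime //; lia.
Qed.

(** Erdos's proof of Bertrand's postulate with a weaker constant. Without a prime in the interval,
    ['C(N.*2, N)] is made of primes up to [s], each contributing at most [N.*2], and of primes
    between [s] and [x], each at most to the first power; the product falls below [2 ^ N]. Powers of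
    4 make [s] the exact square root of [N.*2] and [x] a power of two, as the primorial bound
    wants. *)
Lemma exists_prime_pow4 j : 4 <= j ->
  exists2 p, prime p & 2 * 4 ^ j < p <= 16 * 4 ^ j.
Proof.
move=> j4; apply: contrapT.
set x := 2 * 4 ^ j; set N := 8 * 4 ^ j; set s := 4 * 2 ^ j.
have x2 : x = 2 ^ (j.*2).+1 by rewrite expnS -mul2n expnM.
have e4 : 4 ^ j = 2 ^ j * 2 ^ j by rewrite -expnMn.
have ss : N.*2 = s * s by rewrite /N /s e4; lia.
have N0 : 0 < N by rewrite muln_gt0 expn_gt0.
have NE : N.*2 = 16 * 4 ^ j by rewrite /N; lia.
rewrite -NE => noprime.
suff : 'C(N.*2, N) <= N.*2 ^ s * 4 ^ x.
  apply/negP; rewrite -ltnNge; apply: leq_trans (bin_double_ge N).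
  have -> : N.*2 = 2 ^ (j.*2 + 4) by rewrite NE expnD -mul2n expnM mulnC.
  have -> : 4 ^ x = 2 ^ (2 * x) by rewrite expnM.
  rewrite -expnM -expnD ltn_exp2l // /s /x /N.
  rewrite e4.
  (* The exponents of 2 to compare are [(j.*2 + 4) * 4 * 2 ^ j + 4 * 4 ^ j] and [8 * 4 ^ j]; this is
     what [4 <= j] is for. *)
  have : j.*2 + 4 < 2 ^ j.
    elim: j j4 {x N s x2 ss N0 NE noprime e4} => // j IH; rewrite leq_eqVlt => /orP[/eqP <- //|/IH].
    rewrite expnS; lia.
  nia.
set C := 'C(N.*2, N).
have C0 : 0 < C by rewrite bin_gt0; lia.
have -> : C = \prod_(0 <= p < N.*2.+1 | prime p) p ^ logn p C.
  pose m := maxn C N.*2.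
  rewrite -[LHS]partnT // (@widen_partn m) ?leq_maxl //.
  rewrite (@big_cat_nat _ _ _ N.*2.+1) //=; last by rewrite ltnS leq_maxr.
  rewrite [X in _ * X]big_nat_cond [X in _ * X]big1 ?muln1 => [|p /andP[/andP[lt _] _]].
    by rewrite [RHS]big_mkcond; apply: eq_bigr => p _; case: ifP => //; rewrite lognE => ->.
  case: (boolP (prime p)) => [p_pr|]; last by rewrite lognE => /negbTE ->.
  have := pow_logn_central_bin p_pr N0; rewrite -/C.
  case: (logn p C) => [//|l]; rewrite expnS.
  have : 0 < p ^ l by rewrite expn_gt0 prime_gt0.
  nia.
(* A prime up to [s] gets the factor [N.*2]. A larger one has a square above [N.*2], hence exponent
   at most 1, and contributes at most itself; by assumption none beyond [x] occurs. *)
apply: leq_trans (_ : \prod_(0 <= p < N.*2.+1 | prime p)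
  ((if p <= s then N.*2 else 1) * (if p <= x then p else 1)) <= _).
  rewrite big_nat_cond [X in _ <= X]big_nat_cond.
  apply: leq_prod => p /andP[/andP[_ pN] p_pr].
  have p0 := prime_gt0 p_pr.
  case: (leqP p s) => ps.
    by apply: leq_trans (pow_logn_central_bin p_pr N0) _; case: ifP => _; nia.
  rewrite mul1n; case: (leqP p x) => px; last first.
    have : logn p C = 0; last by move=> ->.
    exfalso; apply: noprime; exists p => //; rewrite px; lia.
  have := pow_logn_central_bin p_pr N0; rewrite -/C.
  case: (logn p C) => [|[|l]] //; rewrite !expnS => le.
  exfalso; have : 0 < p ^ l by rewrite expn_gt0 p0.
  nia.
rewrite big_split /=; apply: leq_mul.
  apply: leq_trans (_ : \prod_(0 <= p < N.*2.+1 | 0 < p < s.+1) N.*2 <= _).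
    rewrite [X in X <= _]big_mkcond [X in _ <= X]big_mkcond /=.
    apply: leq_prod => p _; case: ifP => [/prime_gt0 ->|_].
      by rewrite ltnS; case: (leqP p s).
    by case: ifP => //; lia.
  rewrite -(@big_nat_widen _ _ _ 0 s.+1 N.*2.+1 (fun p => 0 < p)); last by nia.
  have /= <- := @big_nat_widenl _ 1 muln 1 0 s.+1 xpredT (fun=> N.*2) isT.
  by rewrite prod_nat_const_nat subn1.
apply: leq_trans (_ : \prod_(0 <= p < x.+1 | prime p) p <= _); last first.
  by rewrite x2; apply: primorial_pow2_le.
rewrite (@big_cat_nat _ _ _ x.+1) //=; last by lia.
rewrite -[X in _ <= X]muln1; apply: leq_mul.
  rewrite big_nat_cond [X in _ <= X]big_nat_cond; apply: leq_prod => p.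
  by move=> /andP[/andP[_]]; rewrite ltnS => ->.
rewrite big_nat_cond big1 // => p /andP[/andP[xp _] _].
by rewrite leqNgt xp.
Qed.

(** For [x] up to [2 * 4 ^ 4] the prime found at [j = 4] serves, which fixes the constant. Beyond
    that, the least [j] with [x <= 2 * 4 ^ j] satisfies [2 * 4 ^ j.-1 < x], and the prime is at most
    [32 * x]. *)
Lemma exists_prime_within : exists2 C, 0 < C & forall x, 0 < x ->
  exists2 p, prime p & x <= p <= C * x.
Proof.
exists (16 * 4 ^ 4) => // x x0.
have ex : exists j, x <= 2 * 4 ^ j.
  by exists x; apply: leq_trans (_ : 4 ^ x <= _); [exact: ltnW (ltn_expl _ _)|lia].
case: (ex_minnP ex) => j xj minj.
have [j4|j4] := leqP j 4.
  have [p p_pr /andP[lt le]] := exists_prime_pow4 (leqnn 4).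
  exists p => //; apply/andP; split.
    apply: leq_trans (ltnW lt); apply: leq_trans xj _.
    by rewrite leq_mul2l leq_pexp2l.
  by apply: leq_trans le _; rewrite leq_pmulr.
have [p p_pr /andP[lt le]] := exists_prime_pow4 (ltnW j4).
exists p => //; apply/andP; split; first by lia.
apply: leq_trans le _.
case: j j4 xj minj {lt} => // j _ _ /(_ j); rewrite expnS.
have [|lt _] := leqP x (2 * 4 ^ j); first by move=> _ /(_ isT); rewrite ltnn.
have -> : 16 * (4 * 4 ^ j) = 32 * (2 * 4 ^ j) by lia.
apply: leq_mul; [by []|exact: ltnW].
Qed.

(** * Two-level Reed-Solomon hashing *)

Definition digit q k x := (x %/ q ^ k) %% q.

Definition poly_hash q K a x := (\sum_(k < K) digit q k x * a ^ k) %% q.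

(** A value [h] is read as the line with intercept [h %% Q] and slope [h %/ Q] over the field with
    [Q] elements; [b] is the point of evaluation. *)
Definition line_hash Q b h := (h %% Q + b * (h %/ Q)) %% Q.

Definition hash q K Q a b x := line_hash Q b (poly_hash q K a x).

Lemma digits_inj q K x y : 0 < q -> x < q ^ K -> y < q ^ K ->
  (forall k, k < K -> digit q k x = digit q k y) -> x = y.
Proof.
move=> q0; elim: K x y => [|K IH] x y; first by rewrite expn0; lia.
rewrite !expnSr -!ltn_divLR // => ltx lty eqd.
rewrite (divn_eq x q) (divn_eq y q).
have := eqd 0; rewrite /digit expn0 !divn1 => -> //.
rewrite (IH _ _ ltx lty) // => k ltk.
by have := eqd k.+1 ltk; rewrite /digit expnS !divnMA.
Qed.

Lemma Fp_natr_eq p m n : prime p ->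
  ((m%:R : 'F_p) == n%:R)%R = (m %% p == n %% p).
Proof.
move=> p_pr; rewrite -(val_Fp_nat p_pr m) -(val_Fp_nat p_pr n).
by apply/eqP/eqP => [->|/val_inj].
Qed.

(* A collision at [a] makes [a] a root of the difference of the two digit
   polynomials over the field with [q] elements. *)
Lemma poly_hash_collisions q K x y : prime q -> x < q ^ K -> y < q ^ K -> x != y ->
  #|[set a : 'I_q | poly_hash q K a x == poly_hash q K a y]| <= K.
Proof.
move=> q_pr ltx lty neq_xy; have q0 := prime_gt0 q_pr.
pose p : {poly 'F_q} :=
  (\poly_(k < K) ((digit q k x)%:R - (digit q k y)%:R))%R.
have p_neq0 : (p != 0)%R.
  apply: contra neq_xy => /eqP p0; apply/eqP.
  apply: (digits_inj q0 ltx lty) => k ltk.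
  have /eqP := congr1 (fun r : {poly 'F_q} => r`_k)%R p0.
  rewrite coef_poly ltk coef0 subr_eq0 Fp_natr_eq //.
  by rewrite /digit !modn_mod => /eqP.
pose s := [seq ((a : nat)%:R : 'F_q)%R |
           a : 'I_q <- enum [set a : 'I_q | poly_hash q K a x == poly_hash q K a y]].
have size_s : size s = #|[set a : 'I_q | poly_hash q K a x == poly_hash q K a y]|.
  by rewrite size_map -cardE.
rewrite -size_s -ltnS; apply: leq_trans (_ : size p < K.+1); last first.
  by rewrite ltnS size_poly.
rewrite ltnS; apply: ltnW; apply: max_poly_roots => //.
  apply/allP => z /mapP[a]; rewrite mem_enum inE => eqh ->.
  rewrite /root horner_poly; under eq_bigr do rewrite mulrBl.
  rewrite sumrB subr_eq0.
  under eq_bigr do rewrite -natrX -natrM.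
  rewrite -natr_sum.
  under [X in _ == X]eq_bigr do rewrite -natrX -natrM.
  by rewrite -natr_sum Fp_natr_eq.
rewrite map_inj_in_uniq ?enum_uniq // => a b _ _ /eqP.
by rewrite Fp_natr_eq // !modn_small // => /eqP/val_inj.
Qed.

(** Two lines over a field with different slopes meet at most once; with equal slopes a common point
    forces equal intercepts, hence [h = h']. The bound [Q * Q] keeps the slopes below [Q]. *)
Lemma line_hash_collisions Q h h' : prime Q -> h < Q * Q -> h' < Q * Q -> h != h' ->
  #|[set b : 'I_Q | line_hash Q b h == line_hash Q b h']| <= 1.
Proof.
move=> Q_pr lth lth' neq; have Q0 := prime_gt0 Q_pr.
apply/card_le1_eqP => b c; rewrite !inE /line_hash -!Fp_natr_eq // !natrD !natrM.
have key (d : 'I_Q) : ((h %% Q)%:R + d%:R * (h %/ Q)%:R == (h' %% Q)%:R + d%:R * (h' %/ Q)%:R :> 'F_Q)%R ->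
    (d%:R * ((h %/ Q)%:R - (h' %/ Q)%:R) = (h' %% Q)%:R - (h %% Q)%:R :> 'F_Q)%R.
  by move=> /eqP e; rewrite mulrBr; apply/eqP; rewrite subr_eq addrAC eq_sym subr_eq -e addrC.
move=> /key eb /key ec; rewrite -ec in eb.
have [e1|ne1] := eqVneq ((h %/ Q)%:R : 'F_Q)%R (h' %/ Q)%:R%R.
  exfalso; move: ec; rewrite e1 subrr mulr0 => /esym/eqP.
  rewrite subr_eq0 Fp_natr_eq // !modn_mod => /eqP e0.
  move/eqP: e1; rewrite Fp_natr_eq // !modn_small ?ltn_divLR // => /eqP e1.
  by move/eqP: neq; apply; rewrite (divn_eq h Q) e1 -e0 -divn_eq.
move: eb => /mulIf; rewrite subr_eq0 => /(_ ne1)/eqP.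
by rewrite Fp_natr_eq // !modn_small // => /eqP/val_inj.
Qed.

(** At most [K] points [a] collide on the first level, and there all [L] second-level choices are
    given up. At each of the other points, at most [q] in number, at most [c] choices collide. *)
Lemma card_hash_collisions q K L Q c x y :
  prime q -> x < q ^ K -> y < q ^ K -> x != y ->
  (forall h h', h < q -> h' < q -> h != h' ->
     #|[set b : 'I_L | line_hash Q b h == line_hash Q b h']| <= c) ->
  #|[set ab : 'I_q * 'I_L | hash q K Q ab.1 ab.2 x == hash q K Q ab.1 ab.2 y]| <=
    K * L + q * c.
Proof.
move=> q_pr ltx lty neq H; have q0 := prime_gt0 q_pr.
rewrite -sum1dep_card -(pair_big_dep xpredT (fun (a : 'I_q) (b : 'I_L) => hash q K Q a b x == hash q K Q a b y) (fun _ _ => 1)) /=.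
apply: leq_trans (_ : \sum_(a < q) ((poly_hash q K a x == poly_hash q K a y) * L + c) <= _).
  apply: leq_sum => a _; rewrite /hash.
  case: eqVneq => [e|ne].
    apply: leq_trans (leq_addr _ _); rewrite mul1n sum1_card.
    by apply: leq_trans (max_card _) _; rewrite card_ord.
  by rewrite sum1dep_card mul0n; apply: H; rewrite ?ltn_mod.
rewrite big_split /= sum_nat_const card_ord leq_add2r -big_distrl /= leq_mul2r.
have -> : \sum_(a < q) (poly_hash q K a x == poly_hash q K a y) =
    \sum_(a < q | poly_hash q K a x == poly_hash q K a y) 1.
  by rewrite [RHS]big_mkcond; apply: eq_bigr => a _; case: ifP.
by rewrite sum1dep_card poly_hash_collisions ?orbT.
Qed.

(* [L = 1, Q = q] is plain Reed-Solomon hashing; otherwise the Reed-Solomon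
   value is hashed again, to [Q] values, by one of [L = Q] lines. *)
Definition hash_mode f q L Q :=
  (L = 1 /\ Q = q) \/ [/\ L = Q, prime Q, q <= Q * Q & 8 * f <= Q].

Lemma card_bigcup_leq (I T : finType) (A : {set I}) (B : I -> {set T}) :
  #|\bigcup_(i in A) B i| <= \sum_(i in A) #|B i|.
Proof.
elim/big_ind2: _ => [|X a Y b leX leY|//]; first by rewrite cards0.
by apply: leq_trans (leq_card_setU a b).1 (leq_add leX leY).
Qed.

Lemma hash_separates f n q K L Q (F : {set 'I_n}) (u v : 'I_n) :
  0 < f -> prime q -> n <= q ^ K -> 4 * f * K <= q -> hash_mode f q L Q ->
  #|F| <= f -> u \notin F -> v \notin F ->
  exists a b, [/\ a < q, b < L &
    forall x, x \in F -> hash q K Q a b x != hash q K Q a b u /\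
                         hash q K Q a b x != hash q K Q a b v].
Proof.
move=> f0 q_pr nq fKq mode cardF uF vF; have q0 := prime_gt0 q_pr.
pose B (x y : 'I_n) := [set ab : 'I_q * 'I_L | hash q K Q ab.1 ab.2 x == hash q K Q ab.1 ab.2 y].
(* The union bound over at most [2 * f] pairs. By [4 * f * K <= q] the first level spoils at most
   half of the [q * L] functions. In the plain mode [line_hash] is the identity on hash values and
   [c = 0]; otherwise [c = 1], and by [8 * f <= Q] the second level spoils at most another
   quarter. *)
have [c cB ltc] : exists2 c, forall x y, x != y -> #|B x y| <= K * L + q * c &
    f * (2 * (K * L + q * c)) < q * L.
  case: mode => [[? ?]|[? Q_pr qQ fQ]]; subst L; first subst Q.
    exists 0; last by nia.
    move=> x y neq; apply: card_hash_collisions; rewrite ?(leq_trans (ltn_ord _)) //.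
    move=> h h' lth lth' ne; rewrite eq_card0 // => b; rewrite !inE /line_hash.
    by rewrite !divn_small // !muln0 !addn0 !modn_mod !modn_small // (negbTE ne).
  exists 1; last by nia.
  move=> x y neq; apply: card_hash_collisions; rewrite ?(leq_trans (ltn_ord _)) //.
  by move=> h h' lth lth' ne; apply: line_hash_collisions => //; lia.
pose bad := \bigcup_(x in F) (B x u :|: B x v).
have card_bad : #|bad| < q * L.
  apply: leq_ltn_trans ltc; apply: leq_trans (_ : \sum_(x in F) (2 * (K * L + q * c)) <= _).
    apply: leq_trans (card_bigcup_leq _ _) _; apply: leq_sum => x xF.
    rewrite mul2n -addnn; apply: leq_trans (leq_card_setU _ _).1 _.
    by apply: leq_add; apply: cB; [apply: contraNneq uF => <-|apply: contraNneq vF => <-].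
  by rewrite sum_nat_const leq_mul2r cardF orbT.
have : exists ab, ab \notin bad.
  apply/existsP; rewrite -negb_forall; apply: contraL card_bad => /forallP allb.
  rewrite -leqNgt; have -> : #|bad| = #|{: 'I_q * 'I_L}| by apply: eq_card => z; rewrite allb.
  by rewrite card_prod !card_ord.
move=> [[a b]] /bigcupP nbad; exists a, b; split=> // x xF.
by split; apply/negP => e; apply: nbad; exists x => //; rewrite !inE e ?orbT.
Qed.

Lemma poly_hash_small q K a x : 0 < K -> x < q -> poly_hash q K a x = x.
Proof.
case: K => // K _ ltx; rewrite /poly_hash big_ord_recl big1 ?addn0 /digit ?expn0 => [|i _].
  by rewrite divn1 muln1 modn_mod modn_small.
by rewrite divn_small ?mod0n // expnS (leq_trans ltx) // leq_pmulr // expn_gt0; lia.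
Qed.

(** * Short names for the vertices of one hash class *)

(** A pair of quotients in mixed radix; [B] will be [ceil_div n q], which exceeds [x %/ q]. Together
    with the hash value the two quotients determine the vertex. *)
Definition label q Q B h x := h %/ Q * B + x %/ q.

Definition label_range n q Q := ceil_div n q * ceil_div (minn n q) Q.

Lemma ltn_divn_ceil n q x : x < n -> 0 < q -> x %/ q < ceil_div n q.
Proof.
move=> lt q0; rewrite /ceil_div leq_divRL // mulSn.
have := leq_divM x q; lia.
Qed.

Lemma ceil_div_mul_lt n q : 0 < n -> 0 < q -> ceil_div n q * q < n + q.
Proof. by move=> n0 q0; have := leq_divM (n + q).-1 q; rewrite /ceil_div; lia. Qed.

Lemma ceil_div1 n q : 0 < n -> n <= q -> ceil_div n q = 1.
Proof.
move=> n0 le; rewrite /ceil_div.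
have -> : (n + q).-1 = n.-1 + q by lia.
by rewrite divnDr ?dvdnn // divnn divn_small; lia.
Qed.

(** The first-level value is below [q] and also below [n]: it is [x] itself when [x < q], and
    otherwise [q <= x < n]. This is why [label_range] has [minn n q], which matters when [q] exceeds
    [n]. *)
Lemma label_lt n q K Q a x : 0 < K -> 0 < q -> 0 < Q -> x < n ->
  label q Q (ceil_div n q) (poly_hash q K a x) x < label_range n q Q.
Proof.
move=> K0 q0 Q0 ltx; rewrite /label /label_range.
have lt1 := ltn_divn_ceil ltx q0.
have lt2 : poly_hash q K a x < minn n q.
  rewrite leq_min [X in _ && X]ltn_mod q0 andbT.
  have [ltxq|leqx] := ltnP x q; first by rewrite poly_hash_small.
  by apply: ltn_trans (leq_ltn_trans leqx ltx); rewrite ltn_mod.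
have := ltn_divn_ceil lt2 Q0; nia.
Qed.

(** Decoding: the label gives [h %/ Q] and [x %/ q]. The first one, with the hash value, yields
    [h %% Q] and so [h]. The second one contains all digits but the lowest; removing their
    contribution from [h] leaves the lowest digit, whose coefficient [a ^ 0] is 1. *)
Lemma label_inj n q K Q a b x y : 0 < q -> 0 < Q -> x < n -> y < n ->
  n <= q ^ K ->
  hash q K Q a b x = hash q K Q a b y ->
  label q Q (ceil_div n q) (poly_hash q K a x) x =
  label q Q (ceil_div n q) (poly_hash q K a y) y -> x = y.
Proof.
move=> q0 Q0 ltx lty nqK; rewrite /hash /line_hash /label.
set hx := poly_hash q K a x; set hy := poly_hash q K a y; set B := ceil_div n q.
have ltxB := ltn_divn_ceil ltx q0; have ltyB := ltn_divn_ceil lty q0.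
have B0 : 0 < B by apply: leq_ltn_trans ltxB.
move=> eqh eql.
have eq1 : hx %/ Q = hy %/ Q.
  have := congr1 (divn^~ B) eql.
  by rewrite !divnMDl // !(@divn_small _ B) // !addn0.
have eq2 : x %/ q = y %/ q by move: eql; rewrite eq1 => /addnI.
have eq3 : hx = hy.
  rewrite (divn_eq hx Q) (divn_eq hy Q) eq1; congr (_ + _).
  move/eqP: eqh; rewrite eq1 eqn_modDr => /eqP; rewrite !modn_mod //.
move: eq3; clear eqh eql eq1; rewrite {}/hx {}/hy /poly_hash.
case: K nqK => [|K] nqK; first by move=> _; rewrite expn0 in nqK; lia.
rewrite !big_ord_recl.
have -> : \sum_(i < K) digit q (lift ord0 i) x * a ^ lift ord0 i =
          \sum_(i < K) digit q (lift ord0 i) y * a ^ lift ord0 i.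
  by apply: eq_bigr => i _; rewrite /digit !lift0 !expnS !divnMA eq2.
rewrite /digit expn0 !muln1 !divn1 => /eqP; rewrite eqn_modDr !modn_mod => /eqP eq0.
by rewrite (divn_eq x q) (divn_eq y q) eq2 eq0.
Qed.

(** A ceiling is at most twice its quotient unless the quotient is below 1. In the case [Q < q < n]
    both roundings together give at most 4n/Q, which [8 * f <= Q] makes half of n/f; the other half
    is room for the second class. Ceilings equal to 1 are covered by [2 <= ceil_div n f], a
    consequence of [f < n]. *)
Lemma label_range_le n f q Q : 0 < f < n -> 8 * f <= q -> 8 * f <= Q ->
  2 * label_range n q Q <= ceil_div n f.
Proof.
move=> /andP[f0 fn] fq fQ; rewrite /label_range.
have two : 2 <= ceil_div n f by rewrite /ceil_div leq_divRL //; lia.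
suff H r : n <= q /\ r = ceil_div n Q \/ q < n /\ r = ceil_div n q * ceil_div q Q ->
    2 * r <= ceil_div n f.
  apply: H; case: (leqP n q) => nq; [left|right]; split=> //.
  by rewrite (ceil_div1 _ nq) ?mul1n //; lia.
have le_ceil : n %/ f <= ceil_div n f by apply: leq_div2r; lia.
have aux p : 8 * f <= p -> 2 * ceil_div n p <= ceil_div n f.
  move=> fp; have [np|pn] := leqP n p; first by rewrite ceil_div1 //; lia.
  apply: leq_trans le_ceil; rewrite leq_divRL //.
  have := @ceil_div_mul_lt n p; nia.
case=> -[nq ->]; first exact: aux.
have [qQ|Qq] := leqP q Q.
  by rewrite (ceil_div1 _ qQ) ?muln1 ?aux //; lia.
apply: leq_trans le_ceil; rewrite leq_divRL //.
have le1 : ceil_div n q * q <= 2 * n by have := @ceil_div_mul_lt n q; lia.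
have le2 : ceil_div q Q * Q <= 2 * q by have := @ceil_div_mul_lt q Q; lia.
move: le1 le2; move: (ceil_div n q) (ceil_div q Q) => A B le1 le2.
have le3 : A * B * Q * q <= 4 * n * q.
  by apply: leq_trans (_ : (A * q) * (B * Q) <= _); [nia|apply: leq_trans (leq_mul le1 le2) _; lia].
have {}le3 : A * B * Q <= 4 * n by move: le3; rewrite leq_pmul2r //; lia.
nia.
Qed.

(** * Program logic and simulation of a program in fresh memory *)

Section Hoare.
Variables (R : realType) (W : nat).
Implicit Types (st : state R) (c : cmd) (Q : state R -> Prop).

(** The value regardless of overflow; [wok] below is the condition that nothing overflows. With this
    split, values come out by simplification and overflow is left to arithmetic. *)
Fixpoint wden st (e : wexpr) : nat :=
  match e with
  | WConst k => k
  | WGet a i => wmem st a (wden st i)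
  | WOp o e1 e2 => wop_sem o (wden st e1) (wden st e2)
  end.

Fixpoint wok st (e : wexpr) : Prop :=
  match e with
  | WConst k => k < W
  | WGet a i => wok st i /\ wmem st a (wden st i) < W
  | WOp o e1 e2 =>
    [/\ wok st e1, wok st e2 & wop_sem o (wden st e1) (wden st e2) < W]
  end.

Lemma weval_ok st e : wok st e -> weval W st e = Some (wden st e).
Proof.
elim: e => [k|a e IH|o e1 IH1 e2 IH2] /=; rewrite /fits.
- by move=> ->.
- by move=> [/IH -> /= ->].
- by move=> [/IH1 -> /IH2 -> /= ->].
Qed.

Lemma wok_lt st e : wok st e -> wden st e < W.
Proof. by case: e => [k|a e|o e1 e2] //= []. Qed.

Definition hoare c st (k : nat) Q :=
  exists T st', [/\ exec W c st T st', T <= k & Q st'].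

Fixpoint wmods c : seq nat :=
  match c with
  | CSetW a _ _ => [:: a]
  | CSeq c1 c2 | CIf _ c1 c2 => wmods c1 ++ wmods c2
  | CWhile _ c => wmods c
  | _ => [::]
  end.

Fixpoint rmods c : seq nat :=
  match c with
  | CSetR a _ _ => [:: a]
  | CSeq c1 c2 | CIf _ c1 c2 => rmods c1 ++ rmods c2
  | CWhile _ c => rmods c
  | _ => [::]
  end.

(** Framing is per array, read off the syntax, and ignores indices. This is sharp enough because
    every scalar that the program writes has an array of its own. *)
Definition frame c st st' :=
  (forall a, a \notin wmods c -> forall i, wmem st' a i = wmem st a i) /\
  (forall a, a \notin rmods c -> forall i, rmem st' a i = rmem st a i).

Lemma exec_frame c st T st' : exec W c st T st' -> frame c st st'.
Proof.
rewrite /frame; elim=> {c st T st'} //=.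
- move=> a ei ev st i x _ _; split=> // b; rewrite inE /update => /negbTE nab j.
  by rewrite nab.
- move=> a ei ev st i x _ _; split=> // b; rewrite inE /update => /negbTE nab j.
  by rewrite nab.
- move=> c1 c2 st T1 st1 T2 st2 _ [w1 r1] _ [w2 r2].
  by split=> a; rewrite mem_cat negb_or => /andP[n1 n2] i; rewrite ?w2 ?r2 // ?w1 ?r1.
- move=> b c1 c2 st [] T st1 _ _ [w1 r1];
    by split=> a; rewrite mem_cat negb_or => /andP[n1 n2] i; rewrite ?w1 ?r1.
- move=> b c st T1 st1 T2 st2 _ _ [w1 r1] _ [w2 r2].
  by split=> a na i; rewrite ?w2 ?r2 // ?w1 ?r1.
Qed.

Lemma hoare_conseq c st k k' Q Q' :
  hoare c st k Q -> k <= k' -> (forall st', Q st' -> Q' st') -> hoare c st k' Q'.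
Proof.
by move=> [T [st' [ex le q]]] lek QQ'; exists T, st'; split=> //; [lia|exact: QQ'].
Qed.

Lemma hoare_le k c st k' Q : hoare c st k Q -> k <= k' -> hoare c st k' Q.
Proof. by move=> H le; apply: (hoare_conseq H). Qed.

Lemma hoare_frame c st k Q :
  hoare c st k Q -> hoare c st k (fun st' => Q st' /\ frame c st st').
Proof.
move=> [T [st' [ex le q]]]; exists T, st'; split=> //; split=> //.
exact: exec_frame ex.
Qed.

Lemma hoare_skip st Q : Q st -> hoare CSkip st 1 Q.
Proof. by move=> q; exists 1, st; split=> //; apply: exec_skip. Qed.

Lemma hoare_setw a ei ev st Q : wok st ei -> wok st ev ->
  Q (setw st a (wden st ei) (wden st ev)) ->
  hoare (CSetW a ei ev) st (wcost ei + wcost ev).+1 Q.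
Proof.
move=> oki okv q; eexists; eexists; split; last exact: q; last exact: leqnn.
by apply: exec_setw; apply: weval_ok.
Qed.

Lemma hoare_setr a ei ev st x Q : wok st ei -> reval W st ev = Some x ->
  Q (setr st a (wden st ei) x) ->
  hoare (CSetR a ei ev) st (wcost ei + rcost ev).+1 Q.
Proof.
move=> oki okv q; eexists; eexists; split; last exact: q; last exact: leqnn.
by apply: exec_setr => //; apply: weval_ok.
Qed.

Lemma hoare_seq c1 c2 st k1 k2 Q :
  hoare c1 st k1 (fun st1 => hoare c2 st1 k2 Q) ->
  hoare (CSeq c1 c2) st (k1 + k2) Q.
Proof.
move=> [T1 [st1 [ex1 le1 [T2 [st2 [ex2 le2 q]]]]]].
by exists (T1 + T2), st2; split=> //; [apply: exec_seq ex1 ex2|lia].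
Qed.

Lemma hoare_if b c1 c2 st x k Q :
  beval W st b = Some x -> hoare (if x then c1 else c2) st k Q ->
  hoare (CIf b c1 c2) st (bcost b + k) Q.
Proof.
move=> eb [T [st' [ex le q]]]; exists (bcost b + T), st'; split=> //.
  by apply: exec_if eb ex.
by lia.
Qed.

(** The invariant is indexed by the number of completed rounds. Every round may also use that arrays
    not assigned in the body are still as at the start, so invariants only mention what changes. *)
Lemma hoare_while b c N k (I : nat -> state R -> Prop) st :
  I 0 st ->
  (forall i st', i < N -> frame c st st' -> I i st' ->
     beval W st' b = Some true /\ hoare c st' k (I i.+1)) ->
  (forall st', frame c st st' -> I N st' -> beval W st' b = Some false) ->
  hoare (CWhile b c) st (N * (bcost b + k) + bcost b) (I N).
Proof.
move=> I0 step stop.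
suff H i st' : i <= N -> frame c st st' -> I i st' ->
    hoare (CWhile b c) st' ((N - i) * (bcost b + k) + bcost b) (I N).
  by have := H 0 st; rewrite subn0; apply.
move: {2}(N - i) (erefl (N - i)) => m; elim: m i st' => [|m IH] i st' eqm leN fr Ii.
  have eN : i = N by lia.
  subst i; exists (bcost b), st'; split=> //; last by lia.
  by apply: exec_while_false; apply: stop.
have ltN : i < N by lia.
have [bt [T1 [st1 [ex1 le1 I1]]]] := step _ _ ltN fr Ii.
have fr1 : frame c st st1.
  have [w1 r1] := exec_frame ex1; case: fr => w0 r0.
  by split=> a na j; rewrite ?w1 ?r1 // ?w0 ?r0.
have [|T2 [st2 [ex2 le2 I2]]] := IH i.+1 st1 _ ltN fr1 I1; first by lia.
exists (bcost b + T1 + T2), st2; split=> //.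
  exact: exec_while_true bt ex1 ex2.
have -> : N - i = (N - i.+1).+1 by lia.
rewrite mulSn; lia.
Qed.

Definition vget a := WGet a (WConst 0).
Definition vset a e := CSetW a (WConst 0) e.

Definition for_loop v e c :=
  CSeq (vset v (WConst 0))
    (CWhile (BNot (BLeW e (vget v)))
       (CSeq c (vset v (WOp WAdd (vget v) (WConst 1))))).

(** The bound [e] is evaluated anew at every test, at cost [wcost e + 4]; the increment costs 6 and
    the initialization 3. The body has to establish the invariant for the state after the
    increment. *)
Lemma hoare_for v e c N k (I : nat -> state R -> Prop) st :
  1 < W -> N < W ->
  I 0 (setw st v 0 0) ->
  (forall i st', i <= N -> frame (for_loop v e c) st st' ->
     wmem st' v 0 = i -> I i st' -> wok st' e /\ wden st' e = N) ->
  (forall i st', i < N -> frame (for_loop v e c) st st' ->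
     wmem st' v 0 = i -> I i st' ->
     hoare c st' k (fun st2 => wmem st2 v 0 = i /\ I i.+1 (setw st2 v 0 i.+1))) ->
  hoare (for_loop v e c) st (N * (k + wcost e + 10) + wcost e + 7) (I N).
Proof.
move=> W1 NW I0 bound step.
have fr0 st' : frame (for_loop v e c) (setw st v 0 0) st' -> frame (for_loop v e c) st st'.
  move=> [w r]; split=> a na i; last exact: r.
  rewrite w //= /update; move: na; rewrite inE negb_or => /andP[/negbTE -> _] //.
have sub st1 st2 : frame (CSeq c (vset v (WOp WAdd (vget v) (WConst 1)))) st1 st2 ->
    frame (for_loop v e c) st1 st2.
  case=> w r; split=> a na i; [apply: w|apply: r]; apply: contra na => /=; rewrite ?inE.
    by move=> ->; rewrite orbT.
  by [].
apply: (@hoare_le (3 + (N * (wcost e + 4 + (k + 6)) + (wcost e + 4)))); last by lia.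
apply: hoare_seq; apply: (@hoare_le 3) => //; apply: hoare_setw => //=; first by lia.
  by lia.
have evb st' i : i <= N -> frame (for_loop v e c) st st' -> wmem st' v 0 = i -> I i st' ->
    beval W st' (BNot (BLeW e (vget v))) = Some (i < N).
  move=> leN fr vi Ii; have [oke eN] := bound _ _ leN fr vi Ii.
  rewrite /= weval_ok // eN /fits (ltnW W1) /= vi /= (leq_ltn_trans leN NW) /=.
  by rewrite -ltnNge.
pose J i st' := wmem st' v 0 = i /\ I i st'.
have -> : wcost e + 4 = bcost (BNot (BLeW e (vget v))) by rewrite /=; lia.
set b := BNot _; suff H : hoare (CWhile b (CSeq c (vset v (WOp WAdd (vget v) (WConst 1)))))
    (setw st v 0 0) (N * (bcost b + (k + 6)) + bcost b) (J N).
  by apply: hoare_conseq H _ _ => // st' [].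
apply: hoare_while.
- by split=> //; rewrite /= /update !eqxx.
- move=> i st' ltN /sub/fr0 fr [vi Ii]; split.
    by rewrite /b (evb _ i) ?ltN // ltnW.
  apply: hoare_seq; apply: hoare_conseq (step _ _ ltN fr vi Ii) _ _ => //.
  move=> st2 [v2 I2]; apply: (@hoare_le 6) => //; apply: hoare_setw => //=.
  + by lia.
  + by rewrite v2; split=> //; try split; lia.
  + by rewrite v2 addn1; split=> //; rewrite /= /update !eqxx.
- move=> st' /sub/fr0 fr [vi Ii]; by rewrite /b (evb _ N) ?ltnn.
Qed.

End Hoare.

(** * Running a program in a shifted window of memory *)

Section Simulation.
Variables (R : realType) (off vb : nat).

(** Two shifts with different purposes: renaming [a] to [off + a] separates the given program from
    the one that calls it, and the index offset, read at run time from the variable [vb], separates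
    successive runs. *)
Fixpoint shiftw (e : wexpr) : wexpr :=
  match e with
  | WConst k => WConst k
  | WGet a i => WGet (off + a) (WOp WAdd (shiftw i) (vget vb))
  | WOp o e1 e2 => WOp o (shiftw e1) (shiftw e2)
  end.

Fixpoint shiftr (e : rexpr) : rexpr :=
  match e with
  | ROfWord e => ROfWord (shiftw e)
  | RGet a i => RGet (off + a) (WOp WAdd (shiftw i) (vget vb))
  | ROp o e1 e2 => ROp o (shiftr e1) (shiftr e2)
  end.

Fixpoint shiftb (b : bexpr) : bexpr :=
  match b with
  | BEqW e1 e2 => BEqW (shiftw e1) (shiftw e2)
  | BLeW e1 e2 => BLeW (shiftw e1) (shiftw e2)
  | BLeR e1 e2 => BLeR (shiftr e1) (shiftr e2)
  | BNot b => BNot (shiftb b)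
  | BAnd b1 b2 => BAnd (shiftb b1) (shiftb b2)
  end.

Fixpoint shiftc (c : cmd) : cmd :=
  match c with
  | CSkip => CSkip
  | CSetW a i e => CSetW (off + a) (WOp WAdd (shiftw i) (vget vb)) (shiftw e)
  | CSetR a i e => CSetR (off + a) (WOp WAdd (shiftw i) (vget vb)) (shiftr e)
  | CSeq c1 c2 => CSeq (shiftc c1) (shiftc c2)
  | CIf b c1 c2 => CIf (shiftb b) (shiftc c1) (shiftc c2)
  | CWhile b c => CWhile (shiftb b) (shiftc c)
  end.

Lemma wcost_shift e : wcost (shiftw e) <= 4 * wcost e.
Proof. by elim: e => [k|a i IH|o e1 IH1 e2 IH2] /=; lia. Qed.

Lemma rcost_shift e : rcost (shiftr e) <= 4 * rcost e.
Proof.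
elim: e => [e|a i|o e1 IH1 e2 IH2] /=; try lia.
  by have := wcost_shift e; lia.
by have := wcost_shift i; lia.
Qed.

Lemma bcost_shift b : bcost (shiftb b) <= 4 * bcost b.
Proof.
elim: b => [e1 e2|e1 e2|e1 e2|b IH|b1 IH1 b2 IH2] /=; try lia.
- by have := wcost_shift e1; have := wcost_shift e2; lia.
- by have := wcost_shift e1; have := wcost_shift e2; lia.
- by have := rcost_shift e1; have := rcost_shift e2; lia.
Qed.

Variables (W WA base S : nat).
Hypotheses (vb_lt : vb < off) (leWAS : WA <= S) (leSW : base + S <= W).

(** Agreement on indices below [S] is enough, since any index the simulated program computes is a
    word below [WA <= S]. One run thus lives in a window of [S] cells per array. *)
Definition simrel (st stA : state R) := wmem st vb 0 = base /\
  (forall a i, i < S -> wmem st (off + a) (base + i) = wmem stA a i /\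
                        rmem st (off + a) (base + i) = rmem stA a i).

Lemma weval_lt V (st : state R) e x : weval V st e = Some x -> x < V.
Proof.
have fitsP y : fits V y = Some x -> x < V by rewrite /fits; case: ifP => // lt [<-].
case: e => [k|a i|o e1 e2] /=; first exact: fitsP.
  by case: (weval _ _ i) => //= j /fitsP.
by case: (lift2 _ _ _) => //= j /fitsP.
Qed.

Lemma fits_widen x y : fits WA x = Some y -> fits W x = Some y.
Proof. by rewrite /fits; case: ifP => // lt [<-]; rewrite ifT //; lia. Qed.

Lemma weval_base st stA : 0 < S -> simrel st stA -> weval W st (vget vb) = Some base.
Proof. by move=> S0 [vbE _] /=; rewrite /fits ifT /= ?vbE ?ifT //; lia. Qed.

Lemma weval_shift st stA e x :
  simrel st stA -> weval WA stA e = Some x -> weval W st (shiftw e) = Some x.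
Proof.
move=> rel; elim: e x => [k|a i IH|o e1 IH1 e2 IH2] x.
- exact: fits_widen.
- rewrite [LHS]/=; case E: (weval WA stA i) => [j|] //= fx.
  have ltj := weval_lt E; have jS : j < S by lia.
  have S0 : 0 < S by lia.
  rewrite -[LHS]/(obind (fun j => fits W (wmem st (off + a) j))
    (obind (fits W) (lift2 addn (weval W st (shiftw i)) (weval W st (vget vb))))).
  rewrite (IH _ E) (weval_base S0 rel) /= {2}/fits ifT /=; last by lia.
  by rewrite (addnC j); have [-> _] := (rel.2 a j jS); apply: fits_widen.
- rewrite /=; case E1: (weval WA stA e1) => [x1|] //=.
  case E2: (weval WA stA e2) => [x2|] //= fx.
  by rewrite (IH1 _ E1) (IH2 _ E2) /=; apply: fits_widen.
Qed.

Lemma weval_index st stA e x :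
  simrel st stA -> weval WA stA e = Some x ->
  weval W st (WOp WAdd (shiftw e) (vget vb)) = Some (base + x) /\ x < S.
Proof.
move=> rel E; have ltx := weval_lt E; have xS : x < S by lia.
split=> //; have S0 : 0 < S by lia.
rewrite -[LHS]/(obind (fits W) (lift2 addn (weval W st (shiftw e)) (weval W st (vget vb)))).
by rewrite (weval_base S0 rel) (weval_shift rel E) /= /fits addnC ifT //; lia.
Qed.

Lemma reval_shift st stA e x :
  simrel st stA -> reval WA stA e = Some x -> reval W st (shiftr e) = Some x.
Proof.
move=> rel; elim: e x => [e|a i|o e1 IH1 e2 IH2] x.
- rewrite /=; case E: (weval WA stA e) => [j|] //=.
  by rewrite (weval_shift rel E).
- rewrite [LHS]/=; case E: (weval WA stA i) => [j|] //= <-.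
  have [/= -> jS] := weval_index rel E; rewrite /=.
  by have [_ ->] := rel.2 a j jS.
- rewrite /=; case E1: (reval WA stA e1) => [x1|] //=.
  case E2: (reval WA stA e2) => [x2|] //= fx.
  by rewrite (IH1 _ E1) (IH2 _ E2).
Qed.

Lemma beval_shift st stA b x :
  simrel st stA -> beval WA stA b = Some x -> beval W st (shiftb b) = Some x.
Proof.
move=> rel; elim: b x => [e1 e2|e1 e2|e1 e2|b IH|b1 IH1 b2 IH2] x /=.
- case E1: (weval WA stA e1) => [x1|] //=; case E2: (weval WA stA e2) => [x2|] //=.
  by rewrite (weval_shift rel E1) (weval_shift rel E2).
- case E1: (weval WA stA e1) => [x1|] //=; case E2: (weval WA stA e2) => [x2|] //=.
  by rewrite (weval_shift rel E1) (weval_shift rel E2).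
- case E1: (reval WA stA e1) => [x1|] //=; case E2: (reval WA stA e2) => [x2|] //=.
  by rewrite (reval_shift rel E1) (reval_shift rel E2).
- by case E: (beval WA stA b) => [y|] //=; rewrite (IH _ E).
- case E1: (beval WA stA b1) => [x1|] //=; case E2: (beval WA stA b2) => [x2|] //=.
  by rewrite (IH1 _ E1) (IH2 _ E2).
Qed.

(** Shifted arrays below [base] hold what earlier runs left and may stay unspecified; later runs
    rely only on the cells from [base + S] on. *)
Definition local_change (st st' : state R) := forall a i,
  (a < off) || (base + S <= i) ->
  wmem st' a i = wmem st a i /\ rmem st' a i = rmem st a i.

Lemma local_change_trans st1 st2 st3 :
  local_change st1 st2 -> local_change st2 st3 -> local_change st1 st3.
Proof. by move=> l1 l2 a i h; have [-> ->] := l2 a i h; apply: l1. Qed.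

Lemma simrel_setw st stA a i x : i < S -> simrel st stA ->
  simrel (setw st (off + a) (base + i) x) (setw stA a i x) /\
  local_change st (setw st (off + a) (base + i) x).
Proof.
move=> iS [vbE rel]; split; [split|].
- by rewrite /= /update ifF //; apply/negbTE/nandP; left; lia.
- move=> b j jS; rewrite /= /update eqn_add2l eqn_add2l; have [e1 e2] := rel b j jS.
  by split=> //; case: ifP.
- move=> b j h; split=> //=; rewrite /update ifF //.
  by apply/negbTE/nandP; case/orP: h => h; [left|right]; lia.
Qed.

Lemma simrel_setr st stA a i x : i < S -> simrel st stA ->
  simrel (setr st (off + a) (base + i) x) (setr stA a i x) /\
  local_change st (setr st (off + a) (base + i) x).
Proof.
move=> iS [vbE rel]; split; [split|] => //.
- move=> b j jS; rewrite /= /update eqn_add2l eqn_add2l; have [e1 e2] := rel b j jS.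
  by split=> //; case: ifP.
- move=> b j h; split=> //=; rewrite /update ifF //.
  by apply/negbTE/nandP; case/orP: h => h; [left|right]; lia.
Qed.

(** Each access pays 3 more units, for reading and adding the offset, hence the factor 4. The
    simulated run keeps its own word bound [WA], and [base + S <= W] makes the shifted indices
    fit. *)
Lemma exec_shift c stA T stA' : exec WA c stA T stA' ->
  forall st, simrel st stA ->
  hoare W (shiftc c) st (4 * T) (fun st' => simrel st' stA' /\ local_change st st').
Proof.
elim=> {c stA T stA'}.
- by move=> stA st rel; apply: (@hoare_le _ _ 1) => //; apply: hoare_skip.
- move=> a ei ev stA i x Ei Ex st rel.
  have [Ei' iS] := weval_index rel Ei; have Ex' := weval_shift rel Ex.
  eexists; eexists; split; [exact: exec_setw Ei' Ex'| |exact: simrel_setw].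
  by rewrite /=; have := wcost_shift ei; have := wcost_shift ev; lia.
- move=> a ei ev stA i x Ei Ex st rel.
  have [Ei' iS] := weval_index rel Ei; have Ex' := reval_shift rel Ex.
  eexists; eexists; split; [exact: exec_setr Ei' Ex'| |exact: simrel_setr].
  by rewrite /=; have := wcost_shift ei; have := rcost_shift ev; lia.
- move=> c1 c2 stA T1 st1 T2 st2 _ IH1 _ IH2 st rel.
  rewrite mulnDr; apply: hoare_seq; apply: hoare_conseq (IH1 _ rel) _ _ => //.
  move=> st' [rel' lc]; apply: hoare_conseq (IH2 _ rel') _ _ => // st'' [rel'' lc'].
  by split=> //; apply: local_change_trans lc lc'.
- move=> b c1 c2 stA x T st1 Eb _ IH st rel.
  apply: (@hoare_le _ _ (bcost (shiftb b) + 4 * T)); last by have := bcost_shift b; lia.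
  by apply: hoare_if (beval_shift rel Eb) _; case: x {Eb} IH => IH; apply: IH.
- move=> b c stA Eb st rel; exists (bcost (shiftb b)), st; split=> //.
    by apply: exec_while_false; apply: beval_shift Eb.
  exact: bcost_shift.
- move=> b c stA T1 st1 T2 st2 Eb _ IH1 _ IH2 st rel.
  have [T1' [st1' [ex1 le1 [rel1 lc1]]]] := IH1 _ rel.
  have [T2' [st2' [ex2 le2 [rel2 lc2]]]] := IH2 _ rel1.
  exists (bcost (shiftb b) + T1' + T2'), st2'; split.
  + by apply: exec_while_true (beval_shift rel Eb) ex1 ex2.
  + by have := bcost_shift b; lia.
  + by split=> //; apply: local_change_trans lc1 lc2.
Qed.

End Simulation.

Lemma exec_word_bounded (R : realType) W c (st : state R) T st' :
  exec W c st T st' ->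
  forall a i, wmem st' a i < W \/ wmem st' a i = wmem st a i.
Proof.
elim=> {c st T st'}; try by move=> *; right.
- move=> a ei ev st i x _ Ex b j; rewrite /= /update; case: ifP => _; last by right.
  by left; apply: weval_lt Ex.
- move=> c1 c2 st T1 st1 T2 st2 _ H1 _ H2 a i.
  by case: (H2 a i) => [|->]; [left|exact: H1].
- by move=> b c1 c2 st x T st1 _ _ H a i; exact: H.
- move=> b c st T1 st1 T2 st2 _ _ H1 _ H2 a i.
  by case: (H2 a i) => [|->]; [left|exact: H1].
Qed.

Lemma exec_cost_gt0 (R : realType) W c (st : state R) T st' :
  exec W c st T st' -> 0 < T.
Proof.
have b0 b : 0 < bcost b by case: b.
by elim=> {c st T st'} // *; rewrite ?addn_gt0 ?b0 //; lia.
Qed.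

(** * Prime search *)

Notation "a +w b" := (WOp WAdd a b) (at level 50, left associativity).
Notation "a -w b" := (WOp WSub a b) (at level 50, left associativity).
Notation "a *w b" := (WOp WMul a b) (at level 40, left associativity).
Notation "a /w b" := (WOp WDiv a b) (at level 40, left associativity).
Notation "a 'modw' b" := (WOp WMod a b) (at level 40, left associativity).
Notation "$ a" := (vget a) (at level 5, format "$ a").
Notation "# k" := (WConst k) (at level 5, format "# k").
Notation "c1 ;; c2" := (CSeq c1 c2) (at level 90, right associativity).
Notation "v ::= e" := (vset v e) (at level 80).

Notation vN := (WGet 0 (WConst 0)).
Notation vM := (WGet 0 (WConst 1)).
Notation vF := (WGet 0 (WConst 2)).

Notation a_cand := 4.
Notation a_flag := 5.
Notation a_div := 6.
Notation a_pow := 7.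
Notation a_k := 8.
Notation a_q := 9.

Ltac abs_state s E :=
  match goal with |- hoare _ _ ?x _ _ => remember x as s eqn:E end.

Ltac upd := rewrite ?/frame /= ?/update /=.

Section Search.
Variables (R : realType) (D W : nat).
Hypotheses (D16 : 16 <= D) (WD : W = D * D).
Implicit Types st : state R.

Lemma ltW_mul a b : a < D -> b < D -> a * b < W.
Proof. by move=> ltaD ltbD; rewrite WD; nia. Qed.

Lemma D_ltW : 16 * D <= W. Proof. by rewrite WD; nia. Qed.

Ltac wk := have := D_ltW; upd; rewrite -?/(vget _);
  repeat match goal with H : wmem _ _ _ = _ |- _ => rewrite ?H; clear H end;
  move=> ?; repeat split; first [done | lia | by apply: ltW_mul; lia | by rewrite WD; nia].

(** Trial division by every number from 2 up to the candidate, exclusive. As [-w] truncates,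
    [1 - (1 - z)] is the minimum of 1 and [z]: the flag stays 0 or 1 and drops to 0 for good at the
    first divisor. *)
Definition prime_test :=
  a_flag ::= #1 ;;
  for_loop a_div ($a_cand -w #2)
    (a_flag ::= #1 -w (#1 -w $a_flag *w ($a_cand modw ($a_div +w #2)))).

Definition no_div q i := all (fun d => q %% d.+2 != 0) (iota 0 i).
Arguments no_div : simpl never.

Lemma no_divS q i : no_div q i.+1 = no_div q i && (q %% i.+2 != 0).
Proof. by rewrite /no_div -[i.+1 in LHS]addn1 iotaD all_cat /= andbT. Qed.

Lemma prime_no_div q : 2 <= q -> prime q = no_div q (q - 2).
Proof.
move=> q2; apply/primeP/allP => [[_ H] d|H].
  rewrite mem_iota add0n => ltd; apply/negP => /H; rewrite /=; lia.
split=> // d dq; have d0 := dvdn_gt0 (ltnW q2) dq; have le := dvdn_leq (ltnW q2) dq.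
apply/norP => -[d1 dq']; have := H d.-2; rewrite mem_iota add0n /=.
have -> : d.-2 < q - 2 by move: d1 dq'; rewrite /=; lia.
have -> : d.-2.+2 = d by move: d1 dq'; rewrite /=; lia.
by move=> /(_ isT); rewrite -/(dvdn d q) dq.
Qed.

Lemma prime_test_ok st q : wmem st a_cand 0 = q -> 2 <= q -> q < D ->
  hoare W prime_test st (40 * q.+1) (fun st' => wmem st' a_flag 0 = prime q).
Proof.
move=> qE q2 qD; eapply hoare_le.
  eapply hoare_seq; apply: hoare_setw; [wk|wk|].
  apply: hoare_conseq (hoare_for (N := q - 2)
    (I := fun i st' => wmem st' a_flag 0 = no_div q i)
    _ _ _ _ _) _ _.
  - wk. - wk. - by upd.
  - move=> i st' _ [fw _] vi Ii.
    have q' : wmem st' a_cand 0 = q by rewrite fw.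
    split; wk.
  - move=> i st' lti [fw _] vi Ii.
    have q' : wmem st' a_cand 0 = q by rewrite fw.
    have ltm := ltn_mod q i.+2.
    apply: hoare_setw.
    + wk.
    + wk.
    + upd; split=> //.
      by rewrite Ii q' vi no_divS addn2; case: no_div => //=; case: (q %% _).
  - exact: leqnn.
  - by move=> st' ->; rewrite (prime_no_div q2).
by rewrite /=; lia.
Qed.

(** With truncation [n - (n - z)] is [minn n z]. The power of the candidate saturates at [n], which
    keeps all products small and does not affect the final comparison with [n]. *)
Definition degree_test :=
  a_pow ::= #1 ;;
  for_loop a_k ($a_cand /w (#4 *w vF)) (a_pow ::= vN -w (vN -w $a_pow *w $a_cand)) ;;
  a_flag ::= $a_flag *w (#1 -w (vN -w $a_pow)).

Definition square_test := a_flag ::= $a_flag *w (#1 -w ($a_q -w $a_cand *w $a_cand)).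

Definition search X :=
  a_cand ::= #8 *w vF ;;
  a_flag ::= #0 ;;
  CWhile (BEqW $a_flag #0)
    (prime_test ;; X ;; a_cand ::= $a_cand +w (#1 -w $a_flag)).

Variables (n f : nat).
Hypotheses (n0 : 0 < n) (nD : n < D) (f0 : 0 < f) (fD : 8 * f < D).

Lemma degree_test_ok st q (b : bool) :
  wmem st 0 0 = n -> wmem st 0 2 = f -> wmem st a_cand 0 = q -> wmem st a_flag 0 = b ->
  0 < q < D ->
  hoare W degree_test st (60 * q.+1)
    (fun st' => wmem st' a_flag 0 = b && (n <= q ^ (q %/ (4 * f)))).
Proof.
move=> nE fE qE bE /andP[q0 qD]; have lek := leq_div q (4 * f).
eapply hoare_le.
  eapply hoare_seq; apply: hoare_setw; [wk|wk|].
  eapply hoare_seq.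
  apply: hoare_conseq (hoare_frame (hoare_for (N := q %/ (4 * f))
    (I := fun i st' => wmem st' a_pow 0 = minn n (q ^ i))
    _ _ _ _ _)) _ _.
  - wk. - wk. - by upd; lia.
  - move=> i st' _ [fw _] vi Ii.
    have q' : wmem st' a_cand 0 = q by rewrite fw.
    have f' : wmem st' 0 2 = f by rewrite fw.
    split; wk.
  - move=> i st' lti [fw _] vi Ii.
    have q' : wmem st' a_cand 0 = q by rewrite fw.
    have n' : wmem st' 0 0 = n by rewrite fw.
    have lepow := geq_minl n (q ^ i).
    have : minn n (q ^ i) * q < W by apply: ltW_mul => //; lia.
    move=> ltm; apply: hoare_setw; [wk|wk|upd; split=> //].
    rewrite n' q' Ii expnSr; case: (leqP n (q ^ i)) => le; nia.
  - exact: leqnn.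
  - move=> st' [Ii [fw _]].
    have b' : wmem st' a_flag 0 = b by rewrite fw.
    have n' : wmem st' 0 0 = n by rewrite fw.
    have lepow := geq_minl n (q ^ (q %/ (4 * f))).
    apply: hoare_setw; [wk| |upd].
      case: b {bE} b' => b'; wk.
    rewrite n' b' Ii; case: b {bE b'} => //=.
    by rewrite mul1n; case: (leqP n (q ^ (q %/ (4 * f)))) => le; lia.
by rewrite /=; lia.
Qed.

Lemma square_test_ok st q1 q (b : bool) : wmem st a_q 0 = q1 -> q1 < D ->
  wmem st a_cand 0 = q -> wmem st a_flag 0 = b -> q < D ->
  hoare W square_test st 20 (fun st' => wmem st' a_flag 0 = b && (q1 <= q * q)).
Proof.
move=> q1E q1D qE bE qD.
have ltq : q * q < W by apply: ltW_mul.
eapply hoare_le; first apply: hoare_setw; [wk| |upd|by []].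
  case: b bE => bE; wk.
by rewrite q1E qE bE; case: b {bE} => //=; case: leqP => le; lia.
Qed.

Lemma search_ok (P : pred nat) X p kX st :
  wmem st 0 2 = f -> 8 * f <= p < D -> prime p -> P p ->
  (forall q, 8 * f <= q < p -> ~~ (prime q && P q)) ->
  a_cand \notin wmods X ++ rmods X -> 0 \notin wmods X ->
  (forall st' q (b : bool),
    (forall a i, a \notin [:: a_cand; a_flag; a_div] ++ wmods X -> wmem st' a i = wmem st a i) ->
    wmem st' a_cand 0 = q -> wmem st' a_flag 0 = b -> 8 * f <= q <= p ->
    hoare W X st' (kX * q.+1) (fun st2 => wmem st2 a_flag 0 = b && P q)) ->
  hoare W (search X) st ((100 + kX) * p.+1 * p.+1) (fun st' => wmem st' a_cand 0 = p).
Proof.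
move=> fE /andP[fp pD] p_pr Pp least cX zX okX.
rewrite mem_cat negb_or in cX; case/andP: cX => cX _.
(* One round for each candidate from [8 * f] to [p] inclusive. The last round succeeds and adds
   [1 - flag], that is 0, so at [i = M] the candidate is [p] and not [8 * f + M]. *)
pose M := (p - 8 * f).+1.
eapply hoare_le.
  eapply hoare_seq; apply: hoare_setw; [wk|wk|].
  eapply hoare_seq; apply: hoare_setw; [wk|wk|].
  set st0 := setw _ _ _ _.
  have fr0 a i : a \notin [:: a_cand; a_flag; a_div] ++ wmods X -> wmem st0 a i = wmem st a i.
    by rewrite /st0 mem_cat !inE /= /update !negb_or => /andP[/and3P[/negbTE -> /negbTE -> _] _].
  apply: hoare_conseq (hoare_while (N := M)
    (I := fun i st' => wmem st' a_flag 0 = (i == M) /\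
        wmem st' a_cand 0 = (if i == M then p else 8 * f + i)) (k := (50 + kX) * p.+1) _ _ _) _ _.
  - by rewrite /st0; upd; rewrite fE addn0.
  - move=> i st' lti [fw _] [gi ci].
    rewrite ltn_eqF // in gi ci.
    have W0 : 0 < W by have := D_ltW; lia.
    split; first by rewrite /= /fits W0 /= gi W0.
    have iM : 8 * f + i <= p by rewrite /M in lti; lia.
    have fw' a j : a \notin [:: a_cand; a_flag; a_div] ++ wmods X -> wmem st' a j = wmem st a j.
      move=> na; rewrite -fr0 // fw //; apply: contra na => /=.
      by rewrite !(inE, mem_cat) /=; case: (a == 4); case: (a == 5); case: (a == 6); case: (a \in wmods X).
    apply: (@hoare_le _ _ (40 * (8 * f + i).+1 + (kX * (8 * f + i).+1 + 10))); last first.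
      apply: leq_trans (_ : (50 + kX) * (8 * f + i).+1 <= _); first by nia.
      by rewrite leq_mul2l orbC; apply/orP; left.
    apply: hoare_seq.
    apply: hoare_conseq (hoare_frame (prime_test_ok ci _ _)) _ _ => //; try lia.
    move=> st1 [g1 [f1 _]].
    apply: hoare_seq.
    apply: hoare_conseq (hoare_frame (okX st1 (8 * f + i) (prime (8 * f + i)) _ _ _ _)) _ _ => //.
    + move=> a j na; rewrite f1 ?fw' //; apply: contra na => /=.
      by rewrite !(inE, mem_cat) /=; case: (a == 4); case: (a == 5); case: (a == 6); case: (a \in wmods X).
    + by rewrite f1.
    + by apply/andP; split; lia.
    move=> st2 [g2 [f2 _]].
    have c2 : wmem st2 a_cand 0 = 8 * f + i by rewrite f2 // f1.
    apply: (@hoare_le _ _ 9) => //.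
    case E: (prime (8 * f + i) && P (8 * f + i)) g2 => /= g2.
      have eqp : 8 * f + i = p.
        have := least (8 * f + i); rewrite E.
        by case: (ltnP (8 * f + i) p) => [lt /(_ _)/negP H|ge _]; [exfalso; apply: H => //; lia|lia].
      have eM : i.+1 = M by rewrite /M; lia.
      apply: hoare_setw; [wk|wk|upd].
      by rewrite g2 c2 eM eqxx; split=> //; lia.
    have neM : (i.+1 == M) = false.
      apply/negbTE/eqP => eM; move: E; rewrite (_ : 8 * f + i = p) ?p_pr ?Pp //.
      by rewrite /M in eM; lia.
    apply: hoare_setw; [wk|wk|upd].
    by rewrite g2 c2 neM; split=> //; lia.
  - move=> st' _ [gi ci]; have W1 : 1 < W by have := D_ltW; lia.
    by rewrite /= /fits (ltnW W1) /= gi eqxx W1.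
  - exact: leqnn.
  - by move=> st' [_ ->]; rewrite eqxx.
rewrite /=.
have : M <= p.+1 by rewrite /M; lia.
nia.
Qed.

End Search.

(** * Hashing the edge endpoints *)

Notation a_K := 10.
Notation a_L := 12.
Notation a_Q := 13.
Notation a_B := 14.
Notation a_S := 15.
Notation a_n' := 16.
Notation a_stride := 17.
Notation a_base := 18.
Notation a_c := 19.
Notation a_e := 20.
Notation a_al := 21.
Notation a_be := 22.
Notation a_y := 23.
Notation a_acc := 24.
Notation a_hu := 26.
Notation a_lu := 27.
Notation a_hv := 28.
Notation a_lv := 29.
Notation a_d := 30.
Notation a_i := 31.
Notation a_j := 32.
Notation a_cnt := 33.
Notation a_idx := 34.
Notation a_o := 35.
Notation off := 36.

Definition hash_core :=
  a_acc ::= #0 ;; a_pow ::= #1 ;;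
  for_loop a_k $a_K
    (a_acc ::= ($a_acc +w ($a_y modw $a_q) *w $a_pow) modw $a_q ;;
     a_pow ::= ($a_pow *w $a_al) modw $a_q ;;
     a_y ::= $a_y /w $a_q).

Definition hash_edge src dh dl :=
  a_y ::= WGet src $a_e ;;
  hash_core ;;
  CSetW dh $a_e (($a_acc modw $a_Q +w $a_be *w ($a_acc /w $a_Q)) modw $a_Q) ;;
  CSetW dl $a_e (($a_acc /w $a_Q) *w $a_B +w WGet src $a_e /w $a_q).

Definition hash_all :=
  for_loop a_e vM (hash_edge 1 a_hu a_lu ;; hash_edge 2 a_hv a_lv).

Section Main.
Variables (R : realType) (n m f q K L Q n' stride : nat).
Variables (us vs : nat -> nat) (ls : nat -> R) (t : R) (D W : nat).
Implicit Types st : state R.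

Let B := ceil_div n q.
Let S := label_range n q Q.
Let N := q * L * (Q * Q).

(** [D] bounds the quantities that occur, up to the end [N * stride] of the memory used by all runs.
    [W] is its square, so that a product of two such quantities cannot overflow. *)
Record params : Prop := Params {
  p_D16 : 16 <= D; p_W : W = D * D; p_q2 : 2 <= q; p_Q0 : 0 < Q; p_L0 : 0 < L;
  p_LQ : L <= Q; p_K0 : 0 < K; p_n : n < D; p_m : m < D; p_f : f < D; p_q : q < D;
  p_K : K < D; p_Q : Q < D; p_qq : q * q < D; p_QQ : Q * Q < D; p_qL : q * L < D; p_n' : n' < D;
  p_S : 2 * S <= n'; p_N : N * stride < D; p_stride : stride < D;
  p_us : forall e, e < m -> us e < n; p_vs : forall e, e < m -> vs e < n }.
Hypothesis ok : params.

Lemma DW : 16 * D <= W. Proof. by case: ok => D16 WD *; apply: D_ltW D16 WD. Qed.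

Ltac wk := have := DW; upd; rewrite -?/(vget _);
  repeat match goal with H : wmem _ _ _ = _ |- _ => rewrite ?H; clear H end;
  move=> ?; repeat split; first [done | lia].

Record env st : Prop := Env {
  env_n : wmem st 0 0 = n; env_m : wmem st 0 1 = m; env_f : wmem st 0 2 = f;
  env_q : wmem st a_q 0 = q; env_K : wmem st a_K 0 = K; env_L : wmem st a_L 0 = L;
  env_Q : wmem st a_Q 0 = Q; env_B : wmem st a_B 0 = B; env_S : wmem st a_S 0 = S;
  env_n' : wmem st a_n' 0 = n'; env_stride : wmem st a_stride 0 = stride;
  env_u : forall e, e < m -> wmem st 1 e = us e;
  env_v : forall e, e < m -> wmem st 2 e = vs e;
  env_l : forall e, e < m -> rmem st 0 e = ls e;
  env_t : rmem st 1 0 = t }.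

Definition env_arrays := [:: 0; 1; 2; a_q; a_K; a_L; a_Q; a_B; a_S; a_n'; a_stride].

Lemma env_frame c st st' : frame c st st' ->
  ~~ has (mem env_arrays) (wmods c) -> ~~ has (mem [:: 0; 1]) (rmods c) ->
  env st -> env st'.
Proof.
move=> [fw fr] /hasPn nw /hasPn nr [*].
have w a i : a \in env_arrays -> wmem st' a i = wmem st a i.
  by move=> ia; apply: fw; apply/negP => /nw; rewrite /= ia.
have r a i : a \in [:: 0; 1] -> rmem st' a i = rmem st a i.
  by move=> ia; apply: fr; apply/negP => /nr; rewrite /= ia.
by split; [..|move=> e le|move=> e le|move=> e le|]; rewrite ?w ?r //; auto.
Qed.

Lemma hash_core_ok st a x : env st -> wmem st a_al 0 = a -> a < q ->
  wmem st a_y 0 = x -> x < D ->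
  hoare W hash_core st (60 * K.+1) (fun st' => wmem st' a_acc 0 = poly_hash q K a x).
Proof.
move=> E aE aq yE xD.
have [D16 q2 qD KD qqD] := And5 (p_D16 ok) (p_q2 ok) (p_q ok) (p_K ok) (p_qq ok).
have qW : q < W by have := DW; lia.
have q0 : 0 < q by lia.
eapply hoare_le.
  eapply hoare_seq; apply: hoare_setw; [wk|wk|].
  eapply hoare_seq; apply: hoare_setw; [wk|wk|].
  apply: hoare_conseq (hoare_for (N := K)
    (I := fun i st' => [/\ wmem st' a_y 0 = x %/ q ^ i, wmem st' a_pow 0 = a ^ i %% q &
       wmem st' a_acc 0 = (\sum_(k < i) digit q k x * a ^ k) %% q])
    _ _ _ _ _) _ _.
  - wk. - wk.
  - by upd; rewrite big_ord0 divn1 mod0n modn_small.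
  - move=> i st' _ fr vi Ii.
    have [fw _] := fr.
    have k' : wmem st' a_K 0 = K by rewrite fw //; apply: env_K E.
    split; wk.
  - move=> i st' lti fr vi [y' p' acc'].
    have [fw _] := fr.
    have q' : wmem st' a_q 0 = q by rewrite fw //; apply: env_q E.
    have al' : wmem st' a_al 0 = a by rewrite fw.
    have lty : x %/ q ^ i < D by apply: leq_ltn_trans (leq_div _ _) xD.
    have ltM z : z %% q < q by rewrite ltn_mod.
    have MW z : z %% q < W by apply: ltn_trans (ltM z) qW.
    have Mq b c : b %% q * (c %% q) < D.
      by apply: leq_ltn_trans qqD; apply: leq_mul; apply: ltnW.
    have Ma b : b %% q * a < D.
      by apply: leq_ltn_trans qqD; apply: leq_mul; apply: ltnW.
    move: (ltM (x %/ q ^ i)) (ltM (a ^ i)) (ltM (\sum_(k < i) digit q k x * a ^ k)) => l1 l2 l3.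
    move: (Mq (x %/ q ^ i) (a ^ i)) (Ma (a ^ i)) => l4 l5.
    eapply hoare_seq; apply: hoare_setw; [wk| |].
      upd; rewrite acc' y' p' q' {vi lti fr fw}; have := DW => ?.
      by repeat split; first [done|exact: MW|lia].
    eapply hoare_seq; apply: hoare_setw; [wk| |].
      upd; rewrite p' q' al' {vi lti fr fw}; have := DW => ?.
      by repeat split; first [done|exact: MW|lia].
    apply: hoare_setw; [wk| |].
      upd; rewrite y' q' {vi lti fr fw}; have := DW => ?.
      have := leq_div (x %/ q ^ i) q => ?.
      by repeat split; first [done|lia].
    upd; rewrite ?q' ?y' ?p' ?acc' ?al'; split=> //; split.
    + by rewrite expnSr divnMA.
    + by rewrite expnSr modnMml.
    + by rewrite big_ord_recr /= /digit modnDml -[in LHS]modnDmr modnMmr modnDmr.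
  - exact: leqnn.
  - by move=> st' [].
by rewrite /=; lia.
Qed.

Notation hs a b x := (hash q K Q a b x).
Notation lb a x := (label q Q B (poly_hash q K a x) x).

Lemma lb_lt a x : x < n -> lb a x < S.
Proof. by move=> ltx; apply: label_lt => //; [exact: p_K0 ok|have := p_q2 ok; lia|exact: p_Q0 ok]. Qed.

Lemma hash_edge_ok st src dh dl e a b x :
  env st -> wmem st a_al 0 = a -> a < q -> wmem st a_be 0 = b -> b < L ->
  wmem st a_e 0 = e -> e < m -> wmem st src e = x -> x < n ->
  src <= 2 -> 25 < dh -> 25 < dl -> dh != dl ->
  hoare W (hash_edge src dh dl) st (60 * K.+1 + 60) (fun st' =>
    [/\ wmem st' dh e = hs a b x, wmem st' dl e = lb a x,
     forall j, j != e -> wmem st' dh j = wmem st dh j &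
     forall j, j != e -> wmem st' dl j = wmem st dl j]).
Proof.
move=> E aE aq bE bL eE em xE xn srcle dhlt dllt neq.
have DW := DW; have [D16 q2 Q0] := And3 (p_D16 ok) (p_q2 ok) (p_Q0 ok).
have [nD mD qD] := And3 (p_n ok) (p_m ok) (p_q ok).
have [LQ QD QQD] := And3 (p_LQ ok) (p_Q ok) (p_QQ ok).
have [S2 n'D] := conj (p_S ok) (p_n' ok).
eapply hoare_le.
  eapply hoare_seq; apply: hoare_setw; [wk| |].
    rewrite /= eE xE; repeat split; lia.
  rewrite /= eE xE.
  set st1 := setw _ _ _ _.
  have E1 : env st1.
    apply: (@env_frame (a_y ::= #0) st) => //; split=> c nc i //.
    by rewrite /= inE in nc; rewrite /st1 /= /update (negbTE nc).
  eapply hoare_seq.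
  have al1 : wmem st1 a_al 0 = a by rewrite /st1; upd.
  have y1 : wmem st1 a_y 0 = x by rewrite /st1; upd.
  have H := hoare_frame (hash_core_ok E1 al1 aq y1 (ltn_trans xn nD)).
  apply: hoare_conseq H _ _; first exact: leqnn.
  move=> st2 [acc2 fr2].
  have E2 : env st2 by apply: env_frame fr2 _ _ E1.
  have [fw2 _] := fr2.
  have w2 c i : c \notin [:: a_acc; a_pow; a_k; a_y] -> wmem st2 c i = wmem st c i.
    move=> nc; rewrite fw2; last by apply: contra nc; rewrite /= !inE; lia.
    by rewrite /st1 /= /update ifF //; move: nc; rewrite !inE; lia.
  have e2 : wmem st2 a_e 0 = e by rewrite w2.
  have b2 : wmem st2 a_be 0 = b by rewrite w2.
  have Q2 := env_Q E2; have B2 := env_B E2; have q2' := env_q E2.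
  have lt_lb := lb_lt a xn.
  have hq : poly_hash q K a x < q by rewrite ltn_mod; lia.
  move: acc2 lt_lb hq; rewrite /hash /line_hash /label.
  move: (poly_hash q K a x) => h acc2 lt_lb hq.
  have lt1 : b * (h %/ Q) < D.
    apply: leq_ltn_trans (ltn_trans hq qD).
    by apply: leq_trans (leq_divM h Q); rewrite mulnC leq_mul2l; lia.
  have lt2 : h %% Q < Q by rewrite ltn_mod.
  have lt3 : h %/ Q <= h := leq_div h Q.
  have SD : S < D by lia.
  have lt4 : h %/ Q * B < D by apply: leq_ltn_trans (leq_addr (x %/ q) _) (ltn_trans lt_lb SD).
  have lt5 : x %/ q <= x := leq_div x q.
  have lt6 : (h %% Q + b * (h %/ Q)) %% Q < Q by rewrite ltn_mod.
  have BD : B < D.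
    have : B <= S.
      by rewrite /S /label_range leq_pmulr // /ceil_div divn_gt0 //; clear -xn q2 Q0; lia.
    by clear -SD; lia.
  eapply hoare_seq; apply: hoare_setw.
  - by rewrite /= e2; repeat split; lia.
  - by rewrite /= acc2 Q2 b2; repeat split; lia.
  set st3 := setw _ _ _ _.
  have w3 c i : (c != dh) || (i != e) -> wmem st3 c i = wmem st2 c i.
    by rewrite /st3 /= /update e2; case: (c == dh) => //= /negbTE ->.
  have dhe : wmem st3 dh e = (h %% Q + b * (h %/ Q)) %% Q.
    by rewrite /st3 /= /update e2 acc2 Q2 b2 !eqxx.
  clearbody st3.
  have dh3 c : c <= 25 -> (c != dh) || (0 != e) by move=> cle; apply/orP; left; lia.
  have x3 : wmem st3 src e = x.
    rewrite w3 ?w2 //; last by apply/orP; left; lia.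
    by rewrite !inE; lia.
  have e3 : wmem st3 a_e 0 = e by rewrite w3 ?dh3.
  have acc3 : wmem st3 a_acc 0 = h by rewrite w3 ?dh3.
  have Q3 : wmem st3 a_Q 0 = Q by rewrite w3 ?dh3.
  have B3 : wmem st3 a_B 0 = B by rewrite w3 ?dh3.
  have q3 : wmem st3 a_q 0 = q by rewrite w3 ?dh3.
  apply: hoare_setw.
  - by rewrite /= e3; repeat split; lia.
  - by rewrite /= acc3 Q3 B3 e3 x3 q3; repeat split; lia.
  rewrite /= acc3 Q3 B3 e3 x3 q3 /update; split.
  - by rewrite (negbTE neq).
  - by rewrite !eqxx.
  - move=> j je; rewrite (negbTE je) andbF w3 ?je ?orbT // w2 //.
    by rewrite !inE; lia.
  - move=> j je; rewrite (negbTE je) andbF w3 ?je ?orbT // w2 //.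
    by rewrite !inE; lia.
by rewrite /=; lia.
Qed.

Lemma hash_all_ok st a b :
  env st -> wmem st a_al 0 = a -> a < q -> wmem st a_be 0 = b -> b < L ->
  hoare W hash_all st (300 * m.+1 * K.+1) (fun st' => forall e, e < m ->
    [/\ wmem st' a_hu e = hs a b (us e), wmem st' a_lu e = lb a (us e),
        wmem st' a_hv e = hs a b (vs e) & wmem st' a_lv e = lb a (vs e)]).
Proof.
move=> E aE aq bE bL.
have DW := DW; have mD := p_m ok; have D16 := p_D16 ok.
eapply hoare_le.
  apply: hoare_conseq (hoare_for (N := m) (k := 120 * K.+1 + 120)
    (I := fun i st' => forall e, e < i ->
    [/\ wmem st' a_hu e = hs a b (us e), wmem st' a_lu e = lb a (us e),
        wmem st' a_hv e = hs a b (vs e) & wmem st' a_lv e = lb a (vs e)])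
    _ _ _ _ _) _ _.
  - lia. - lia. - by [].
  - move=> i st' _ fr vi Ii.
    have /env_m m' : env st' by apply: env_frame fr _ _ E.
    by split=> //=; repeat split; lia.
  - move=> i st' lti fr vi Ii; have E' : env st' by apply: env_frame fr _ _ E.
    have [fw _] := fr.
    have al' : wmem st' a_al 0 = a by rewrite fw.
    have be' : wmem st' a_be 0 = b by rewrite fw.
    have usE := env_u E' lti; have vsE := env_v E' lti.
    have ul := p_us ok lti; have vl := p_vs ok lti.
    apply: (@hoare_le _ _ (60 * K.+1 + 60 + (60 * K.+1 + 60))); last by lia.
    apply: hoare_seq.
    apply: hoare_conseq (hoare_frame (hash_edge_ok E' al' aq be' bL vi lti usE ul _ _ _ _)) _ _ => //.
    move=> st1 [[h1 l1 h1' l1'] fr1].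
    have E1 : env st1 by apply: env_frame fr1 _ _ E'.
    have [fw1 _] := fr1.
    have al1 : wmem st1 a_al 0 = a by rewrite fw1.
    have be1 : wmem st1 a_be 0 = b by rewrite fw1.
    have e1 : wmem st1 a_e 0 = i by rewrite fw1.
    have vsE1 := env_v E1 lti.
    apply: hoare_conseq (hoare_frame (hash_edge_ok E1 al1 aq be1 bL e1 lti vsE1 vl _ _ _ _)) _ _ => //.
    move=> st2 [[h2 l2 h2' l2'] [fw2 _]]; split; first by rewrite fw2.
    move=> e; rewrite ltnS leq_eqVlt => /orP[/eqP ->|lte]; upd.
      by split=> //; rewrite fw2.
    have ne : e != i by rewrite ltn_eqF.
    have [H1 H2 H3 H4] := Ii e lte.
    by split; [rewrite fw2 // h1'|rewrite fw2 // l1'|rewrite h2' // fw1|rewrite l2' // fw1].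
  - exact: leqnn.
  - by [].
have h1 : 120 * K.+1 + 120 + wcost vM + 10 <= 260 * K.+1 by rewrite /=; lia.
have /= := leq_mul (leqnn m) h1; clear; lia.
Qed.
End Main.

(** * Writing the input of one run *)

Definition in_class h :=
  BNot (BAnd (BNot (BEqW (WGet h $a_e) $a_i)) (BNot (BEqW (WGet h $a_e) $a_j))).

(** The two truncated differences add up to the distance of the hash value from [i]; clamped to 1,
    it tells whether the vertex lies outside class [i]. Labels of the second class are thereby moved
    up by [S], away from those of the first. *)
Definition final_label h l :=
  WGet l $a_e +w $a_S *w
    (#1 -w (#1 -w ((WGet h $a_e -w $a_i) +w ($a_i -w WGet h $a_e)))).

(** Seen through the shift by 36, word arrays 37 and 38 and real array 36 are the endpoint arrays 1
    and 2 and the length array 0 of the given algorithm. [a_idx] remembers which input edge an entry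
    comes from. *)
Definition select_edge :=
  CIf (BAnd (in_class a_hu) (in_class a_hv))
    (CSetW 37 ($a_base +w $a_cnt) (final_label a_hu a_lu) ;;
     CSetW 38 ($a_base +w $a_cnt) (final_label a_hv a_lv) ;;
     CSetR 36 ($a_base +w $a_cnt) (RGet 0 $a_e) ;;
     CSetW a_idx $a_cnt $a_e ;;
     a_cnt ::= $a_cnt +w #1)
    CSkip.

Definition prepare :=
  a_cnt ::= #0 ;;
  for_loop a_e vM select_edge ;;
  CSetW 36 $a_base $a_n' ;;
  CSetW 36 ($a_base +w #1) $a_cnt ;;
  CSetR 37 $a_base (RGet 1 #0).

Definition sel_upto (p : pred nat) k := [seq e <- iota 0 k | p e].
Arguments sel_upto : simpl never.

Lemma sel_uptoS p k :
  sel_upto p k.+1 = if p k then rcons (sel_upto p k) k else sel_upto p k.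
Proof.
rewrite /sel_upto -addn1 iotaD filter_cat /=.
by case: (p k); rewrite ?cats1 ?cats0.
Qed.

Lemma size_sel_upto p k : size (sel_upto p k) <= k.
Proof. by rewrite size_filter (leq_trans (count_size _ _)) // size_iota. Qed.

(** The layout of [input] with plain lists in place of a graph, so that the program can be verified
    before any induced subgraph is formed. *)
Definition seq_state (R : realType) (ps s1 s2 : seq nat) (r0 r1 : seq R) : state R :=
  State (fun a i => nth 0 (nth [::] [:: ps; s1; s2] a) i)
        (fun a i => nth 0%R (nth [::] [:: r0; r1] a) i).

Lemma nth_rcons_upd (T : Type) (x0 : T) s x i :
  nth x0 (rcons s x) i = if i == size s then x else nth x0 s i.
Proof.
rewrite nth_rcons; case: ltngtP => // lt; by rewrite nth_default // ltnW.
Qed.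

Section Prepare.
Variables (R : realType) (n m f q K L Q n' stride : nat).
Variables (us vs : nat -> nat) (ls : nat -> R) (t : R) (D W : nat).
Implicit Types st : state R.
Variables (S : nat).
Hypotheses (SE : S = label_range n q Q).
Notation env := (env n m f q K L Q n' stride us vs ls t).
Hypotheses (DW : 16 * D <= W) (D16 : 16 <= D) (SD : 2 * S <= n') (mD : m < D) (n'D : n' < D).

Ltac wk := upd; rewrite -?/(vget _);
  repeat match goal with H : wmem _ _ _ = _ |- _ => rewrite ?H; clear H end;
  repeat split; first [done | lia].

Lemma in_class_ok st h e g i j :
  wmem st a_e 0 = e -> wmem st h e = g -> wmem st a_i 0 = i -> wmem st a_j 0 = j ->
  e < W -> g < W -> i < W -> j < W ->
  beval W st (in_class h) = Some ((g == i) || (g == j)).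
Proof.
move=> eE gE iE jE eW gW iW jW; have W0 : 0 < W by lia.
rewrite /= /fits W0 /= eE iE jE eW /= iW jW gE gW /=.
by rewrite -[eqn g i]/(g == i) -[eqn g j]/(g == j); case: (g == i); case: (g == j).
Qed.

Lemma final_label_ok st h l e g x i :
  wmem st a_e 0 = e -> wmem st h e = g -> wmem st l e = x -> wmem st a_i 0 = i ->
  wmem st a_S 0 = S -> e < D -> g < D -> i < D -> x < S ->
  wok W st (final_label h l) /\ wden st (final_label h l) = x + S * (g != i).
Proof.
move=> eE gE xE iE SE' eD gD iD xS; rewrite /= eE gE xE iE SE'; split.
  have zle : 1 - (1 - (g - i + (i - g))) <= 1 by rewrite leq_subr.
  have Sz := leq_mul (leqnn S) zle; rewrite muln1 in Sz.
  move: Sz; move: (S * (1 - _)) => Sz' Sz.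
  by clear eE gE xE iE SE'; repeat split; lia.
congr (_ + _ * _); case: eqP => [->|ne]; first by rewrite subnn.
by clear -ne; lia.
Qed.

Variables (gu gv lu lv : nat -> nat) (i j base : nat).
Notation p := (fun e => ((gu e == i) || (gu e == j)) && ((gv e == i) || (gv e == j))).
Notation fu := (fun e => lu e + S * (gu e != i)).
Notation fv := (fun e => lv e + S * (gv e != i)).
Hypotheses (iD : i < D) (jD : j < D) (baseD : base < D).
Hypotheses (guD : forall e, e < m -> gu e < D) (gvD : forall e, e < m -> gv e < D).
Hypotheses (luS : forall e, e < m -> lu e < S) (lvS : forall e, e < m -> lv e < S).

Lemma prepare_ok st :
  env st ->
  (forall e, e < m -> [/\ wmem st a_hu e = gu e, wmem st a_lu e = lu e,
                          wmem st a_hv e = gv e & wmem st a_lv e = lv e]) ->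
  wmem st a_i 0 = i -> wmem st a_j 0 = j -> wmem st a_base 0 = base ->
  (forall a r, base <= r -> wmem st (36 + a) r = 0 /\ rmem st (36 + a) r = 0%R) ->
  hoare W prepare st (200 * m.+1) (fun st' => let s := sel_upto p m in
    [/\ wmem st' a_cnt 0 = size s,
        forall r, r < size s -> wmem st' a_idx r = nth 0 s r &
        forall a r,
          wmem st' (36 + a) (base + r) = wmem (seq_state [:: n'; size s]
            (map fu s) (map fv s) (map ls s) [:: t]) a r /\
          rmem st' (36 + a) (base + r) = rmem (seq_state [:: n'; size s]
            (map fu s) (map fv s) (map ls s) [:: t]) a r]).
Proof.
move=> E H iE jE bE clean.
eapply hoare_le.
  eapply hoare_seq; apply: hoare_setw; [wk|wk|].
  set st0 := setw _ _ _ _.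
  eapply hoare_seq.
  apply: hoare_conseq (hoare_frame (hoare_for (N := m) (k := 150)
    (I := fun k st' => let s := sel_upto p k in
    [/\ wmem st' a_cnt 0 = size s,
        forall r, r < size s -> wmem st' a_idx r = nth 0 s r &
        forall a r,
          wmem st' (36 + a) (base + r) = wmem (seq_state [::]
            (map fu s) (map fv s) (map ls s) [::]) a r /\
          rmem st' (36 + a) (base + r) = rmem (seq_state [::]
            (map fu s) (map fv s) (map ls s) [::]) a r])
    _ _ _ _ _)) _ _.
  - lia.
  - lia.
  (* Clean memory already encodes empty lists, because [nth] returns 0 past the end; each selected
     edge then appends one entry. *)
  - split=> // a r; have [w0 r0] := clean a (base + r) (leq_addr _ _).
    have -> : wmem (setw st0 a_e 0 0) (36 + a) (base + r) = 0 by rewrite -[RHS]w0.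
    have -> : rmem (setw st0 a_e 0 0) (36 + a) (base + r) = 0%R by rewrite -[RHS]r0.
    by case: a {w0 r0} => [|[|[|a]]]; rewrite /= ?nth_nil.
  - move=> k st' _ [fw _] vi _.
    have m' : wmem st' 0 1 = m by rewrite fw //; exact: env_m E.
    by split=> //=; rewrite m'; repeat split; lia.
  - move=> k st' ltk [fw fr] vi [cE idxE memE].
    have i' : wmem st' a_i 0 = i by rewrite fw.
    have j' : wmem st' a_j 0 = j by rewrite fw.
    have b' : wmem st' a_base 0 = base by rewrite fw.
    have S' : wmem st' a_S 0 = S by rewrite fw // SE; exact: env_S E.
    have [hu' lu' hv' lv'] : [/\ wmem st' a_hu k = gu k, wmem st' a_lu k = lu k,
        wmem st' a_hv k = gv k & wmem st' a_lv k = lv k].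
      by have [? ? ? ?] := H k ltk; split; rewrite fw.
    have ls' : rmem st' 0 k = ls k by rewrite fr //; exact: (env_l E).
    have := guD ltk; have := gvD ltk; have := luS ltk; have := lvS ltk => l1 l2 l3 l4.
    have les := size_sel_upto p k.
    have b1 : beval W st' (BAnd (in_class a_hu) (in_class a_hv)) = Some (p k).
      rewrite -[LHS]/(lift2 andb (beval W st' (in_class a_hu)) (beval W st' (in_class a_hv))).
      rewrite (in_class_ok vi hu' i' j') ?(in_class_ok vi hv' i' j') //; lia.
    apply: (@hoare_le _ _ (bcost (BAnd (in_class a_hu) (in_class a_hv)) + 100)) => //.
    apply: hoare_if b1 _.
    rewrite sel_uptoS; case: (p k); last first.
      apply: (@hoare_le _ _ 1) => //; apply: hoare_skip; split=> //.
    eapply hoare_le.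
      have [okl dl] := final_label_ok vi hu' lu' i' S' (ltn_trans ltk mD) l4 iD l2.
      eapply hoare_seq; apply: hoare_setw => //.
        by clear -b' cE les ltk mD baseD DW; wk.
      rewrite dl /= b' cE; abs_state st1 st1E.
      have r1 c x : c <= 35 -> wmem st1 c x = wmem st' c x.
        by rewrite st1E /= /update => le; rewrite ifF //; apply/negbTE/nandP; left; lia.
      have [okl2 dl2] := final_label_ok (st := st1) (etrans (r1 a_e 0 isT) vi)
        (etrans (r1 a_hv k isT) hv') (etrans (r1 a_lv k isT) lv') (etrans (r1 a_i 0 isT) i')
        (etrans (r1 a_S 0 isT) S') (ltn_trans ltk mD) l3 iD l1.
      have b1' := etrans (r1 a_base 0 isT) b'; have c1' := etrans (r1 a_cnt 0 isT) cE.
      eapply hoare_seq; apply: hoare_setw => //.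
        by rewrite /= b1' c1'; repeat split; lia.
      rewrite dl2 /= b1' c1'; abs_state st2 st2E.
      have r2 c x : c <= 35 -> wmem st2 c x = wmem st' c x.
        by rewrite st2E /= /update => le; rewrite ifF ?r1 //; apply/negbTE/nandP; left; lia.
      have b2' := etrans (r2 a_base 0 isT) b'; have c2' := etrans (r2 a_cnt 0 isT) cE.
      have W0 : 0 < W by clear -D16 DW; lia.
      have kW : k < W by clear -ltk mD DW; lia.
      have e2' := etrans (r2 a_e 0 isT) vi.
      eapply hoare_seq; apply: (@hoare_setr _ _ _ _ _ _ (ls k)).
        by rewrite /= b2' c2'; repeat split; lia.
        by rewrite /= /fits W0 /= e2' kW /= st2E st1E /= ls'.
      rewrite /= b2' c2'; abs_state st3 st3E.
      have r3 c x : c <= 35 -> wmem st3 c x = wmem st' c x by rewrite st3E; exact: r2.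
      have b3' := etrans (r3 a_base 0 isT) b'; have c3' := etrans (r3 a_cnt 0 isT) cE.
      have e3' := etrans (r3 a_e 0 isT) vi.
      eapply hoare_seq; apply: hoare_setw.
        by rewrite /= c3'; repeat split; lia.
        by rewrite /= e3'; repeat split; lia.
      rewrite /= c3' e3'; abs_state st4 st4E.
      have c4' : wmem st4 a_cnt 0 = size (sel_upto p k) by rewrite -[RHS]c3' st4E.
      apply: hoare_setw.
        by rewrite /=; repeat split; lia.
        by rewrite /= c4'; repeat split; lia.
      rewrite /= c4' addn1; split; first by rewrite -[RHS]e3' st4E.
      rewrite {}st4E.
      have w36 a : (36 + a == 37) = (a == 1) by rewrite -[37]/(36 + 1) eqn_add2l.
      have w36' a : (36 + a == 38) = (a == 2) by rewrite -[38]/(36 + 2) eqn_add2l.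
      have w36'' a : (36 + a == 36) = (a == 0) by rewrite -{2}[36]/(36 + 0) eqn_add2l.
      split.
      + by rewrite size_rcons.
      + move=> r; rewrite size_rcons nth_rcons_upd => ltr.
        rewrite /= /update /=; case: eqP => // ner; rewrite r3 // idxE //; lia.
      + move=> a r; have [wE rE] := memE a r; split.
          rewrite st3E st2E st1E /= /update /= w36 w36' !eqn_add2l wE {wE rE}.
          case: a => [|[|[|a]]] //=; rewrite ?map_rcons ?nth_rcons_upd ?size_map //.
        rewrite st3E st2E st1E /= /update /= w36'' !eqn_add2l rE {wE rE}.
        case: a => [|[|a]] //=; rewrite ?map_rcons ?nth_rcons_upd ?size_map //.
    by [].
  - exact: leqnn.
  - move=> st' [[cE idxE memE] [fw fr]].
    have b' : wmem st' a_base 0 = base by rewrite fw.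
    have n'E : wmem st' a_n' 0 = n' by rewrite fw //; exact: env_n' E.
    have tE : rmem st' 1 0 = t by rewrite fr //; exact: env_t E.
    have les := size_sel_upto p m.
    eapply hoare_seq; apply: hoare_setw.
      by clear -b' baseD DW; wk.
      by clear -n'E n'D DW; wk.
    rewrite /= b' n'E; eapply hoare_seq; apply: hoare_setw.
      rewrite /= /update /= b'; repeat split; lia.
      rewrite /= /update /= cE; repeat split; lia.
    rewrite /= /update /= b' cE.
    apply: (@hoare_setr _ _ _ _ _ _ t).
      rewrite /= /update /= b'; repeat split; lia.
      have W0 : 0 < W by clear -D16 DW; lia.
      by rewrite /= /fits W0 /= tE.
    rewrite /= /update /= b'; split=> // a r; have [wE rE] := memE a r.
    have w36'' c : (36 + c == 36) = (c == 0) by rewrite -{2}[36]/(36 + 0) eqn_add2l.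
    have w36 c : (36 + c == 37) = (c == 1) by rewrite -[37]/(36 + 1) eqn_add2l.
    have wb : (base + r == base) = (r == 0) by rewrite -{2}[base]addn0 eqn_add2l.
    rewrite /= /update /= w36'' w36 wb eqn_add2l wE rE {wE rE}; split.
      by case: a => [|[|[|a]]] //=; case: r {wb} => [|[|r]] //=; rewrite ?nth_nil.
    by case: a => [|[|a]] //=; case: r {wb} => [|r] //=; rewrite ?nth_nil.
by rewrite /=; lia.
Qed.

End Prepare.

(** * The main loops *)

(** Array 39 is output array 3 of the given algorithm under the shift. Its marks are joined to those
    of the earlier runs, clamped to 0 or 1. *)
Definition collect :=
  for_loop a_o $a_cnt
    (CSetW 3 (WGet a_idx $a_o)
       (#1 -w (#1 -w (WGet 3 (WGet a_idx $a_o) +w WGet 39 ($a_base +w $a_o))))).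

Definition run A := prepare ;; shiftc 36 a_base A ;; collect ;; a_base ::= $a_base +w $a_stride.

(** All ordered pairs of hash values; the pairs with [i = j] serve endpoints that share their hash
    value. *)
Definition pairs A :=
  for_loop a_d ($a_Q *w $a_Q) (a_i ::= $a_d /w $a_Q ;; a_j ::= $a_d modw $a_Q ;; run A).

Definition main A :=
  for_loop a_c ($a_q *w $a_L)
    (a_al ::= $a_c /w $a_L ;; a_be ::= $a_c modw $a_L ;; hash_all ;; pairs A).

Lemma collect_ok (R : realType) W D (st : state R) s base (mk : nat -> bool) out :
  16 * D <= W -> 16 <= D -> size s < D -> base < D ->
  (forall r, r < size s -> nth 0 s r < D) -> uniq s ->
  wmem st a_cnt 0 = size s -> wmem st a_base 0 = base ->
  (forall r, r < size s -> wmem st a_idx r = nth 0 s r) ->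
  (forall e, wmem st 3 e = mk e) ->
  (forall r, r < size s -> wmem st 39 (base + r) = out r /\ out r < D) ->
  hoare W collect st (60 * (size s).+1) (fun st' =>
    forall e, wmem st' 3 e = mk e || (e \in s) && (out (index e s) != 0)).
Proof.
move=> DW D16 sD bD sltD us cE bE idxE mkE outE.
eapply hoare_le.
  apply: hoare_conseq (hoare_for (N := size s) (k := 20)
    (I := fun k st' => forall e,
       wmem st' 3 e = mk e || (e \in take k s) && (out (index e s) != 0)) _ _ _ _ _) _ _.
  - by clear -DW D16; lia.
  - by clear -sD DW; lia.
  - by move=> e; rewrite take0 orbF /= /update /= mkE.
  - move=> k st' _ [fw _] vi _.
    have c' : wmem st' a_cnt 0 = size s by rewrite fw.
    by split; rewrite /= c' //; repeat split; clear -sD DW; lia.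
  - move=> k st' ltk [fw _] vi Ik.
    have b' : wmem st' a_base 0 = base by rewrite fw.
    have [oE oD] := outE k ltk; have o' : wmem st' 39 (base + k) = out k by rewrite fw.
    have i' : wmem st' a_idx k = nth 0 s k by rewrite fw // idxE.
    have nD := sltD k ltk.
    have w3 := Ik (nth 0 s k).
    have ntk : (nth 0 s k \in take k s) = false.
      apply/negbTE/negP => /(nthP 0)[l]; rewrite size_take ltk => ltl.
      rewrite nth_take // => /eqP; rewrite nth_uniq ?(ltn_trans ltl ltk) //.
      by rewrite ltn_eqF.
    rewrite ntk orbF in w3.
    have w31 : mk (nth 0 s k) <= 1 by case: (mk _).
    apply: (@hoare_le _ _ 19) => //; apply: hoare_setw.
    + by rewrite /= vi i'; repeat split; clear -nD DW ltk sD; lia.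
    + by rewrite /= vi i' w3 b' o'; repeat split; clear -nD DW ltk sD bD oD w31; lia.
    rewrite /= vi i' w3 b' o' /update /=; split=> // e.
    rewrite (take_nth 0) // mem_rcons inE; case: eqP => [->|ne] /=; last exact: Ik.
    by rewrite index_uniq //; clear; case: (mk _) => /=; lia.
  - exact: leqnn.
  - by move=> st' H e; rewrite H take_oversize.
by rewrite /=; lia.
Qed.

Lemma wmods_shift o vb c a : a < o -> a \notin wmods (shiftc o vb c).
Proof.
move=> lt; elim: c => [|b i e|b i e|c1 H1 c2 H2|b c1 H1 c2 H2|b c H] //=.
- by rewrite inE; lia.
- by rewrite mem_cat negb_or H1.
- by rewrite mem_cat negb_or H1.
Qed.

Lemma rmods_shift o vb c a : a < o -> a \notin rmods (shiftc o vb c).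
Proof.
move=> lt; elim: c => [|b i e|b i e|c1 H1 c2 H2|b c1 H1 c2 H2|b c H] //=.
- by rewrite inE; lia.
- by rewrite mem_cat negb_or H1.
- by rewrite mem_cat negb_or H1.
Qed.

Definition kept := [:: a_c; a_al; a_be; a_hu; a_lu; a_hv; a_lv; a_d] ++ env_arrays.

Lemma wmods_run A a : a \in [:: a_i; a_j] ++ kept -> a \notin wmods (run A).
Proof.
have sh := @wmods_shift 36 a_base A a.
rewrite /kept /env_arrays /run /prepare /collect /select_edge /for_loop /vset.
rewrite /= !(inE, mem_cat) => H.
by rewrite !negb_or sh /=; lia.
Qed.

Lemma rmods_run A a : a \in [:: 0; 1] -> a \notin rmods (run A).
Proof.
have sh := @rmods_shift 36 a_base A a.
rewrite /run /prepare /collect /select_edge /for_loop /vset.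
rewrite /= !(inE, mem_cat) => H.
by rewrite !negb_or sh /=; lia.
Qed.

Section Main.
Variables (R : realType) (n m f q K L Q n' stride : nat).
Variables (us vs : nat -> nat) (ls : nat -> R) (t : R) (D W : nat).
Implicit Types st : state R.
Hypothesis ok : params n m f q K L Q n' stride us vs D W.
Notation env := (env n m f q K L Q n' stride us vs ls t).
Let S := label_range n q Q.
Let N := q * L * (Q * Q).
Notation hs a b x := (hash q K Q a b x).
Notation lb a x := (label q Q (ceil_div n q) (poly_hash q K a x) x).

Definition clean (base : nat) st := forall a r, base <= r ->
  wmem st (36 + a) r = 0 /\ rmem st (36 + a) r = 0%R.

Variable A : cmd.
Hypotheses (m_stride : m <= stride) (stride2 : 2 <= stride).

Definition chosen a b i j e :=
  ((hs a b (us e) == i) || (hs a b (us e) == j)) &&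
  ((hs a b (vs e) == i) || (hs a b (vs e) == j)).

Definition run_label a b i x := lb a x + S * (hs a b x != i).

Definition run_list a b i j := sel_upto (chosen a b i j) m.

Definition run_input a b i j : state R := let s := run_list a b i j in
  seq_state [:: n'; size s] [seq run_label a b i (us e) | e <- s]
    [seq run_label a b i (vs e) | e <- s] [seq ls e | e <- s] [:: t].

Definition marked (s : seq nat) (out : state R) e :=
  (e \in s) && (wmem out 3 (index e s) != 0).

Lemma env_keep st st' :
  (forall a, a \in env_arrays -> forall i, wmem st' a i = wmem st a i) ->
  (forall a, a \in [:: 0; 1] -> forall i, rmem st' a i = rmem st a i) ->
  env st -> env st'.
Proof.
move=> w r [*]; split; [..|move=> e le|move=> e le|move=> e le|]; rewrite ?w ?r //; auto.
Qed.

(** The next window is clean because the simulated program cannot leave its [stride] cells and the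
    prepared input is no longer than that. *)
Lemma run_ok st a b i j base (mk : nat -> bool) WA TA out :
  env st -> a < q -> b < L -> i < Q -> j < Q -> base < D ->
  (forall e, e < m ->
    [/\ wmem st a_hu e = hs a b (us e), wmem st a_lu e = lb a (us e),
        wmem st a_hv e = hs a b (vs e) & wmem st a_lv e = lb a (vs e)]) ->
  wmem st a_i 0 = i -> wmem st a_j 0 = j -> wmem st a_base 0 = base ->
  clean base st -> (forall e, wmem st 3 e = mk e) ->
  WA <= stride -> exec WA A (run_input a b i j) TA out ->
  hoare W (run A) st (300 * m.+1 + 4 * TA) (fun st' =>
    [/\ wmem st' a_base 0 = base + stride, clean (base + stride) st' &
        forall e, wmem st' 3 e = mk e || marked (run_list a b i j) out e]).
Proof.
move=> E aq bL iQ jQ bD H iE jE bE cl mkE leWA exA.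
have DW := DW ok; have [D16 q2 Q0] := And3 (p_D16 ok) (p_q2 ok) (p_Q0 ok).
have [nD mD QD] := And3 (p_n ok) (p_m ok) (p_Q ok).
have [S2 n'D strD] := And3 (p_S ok) (p_n' ok) (p_stride ok).
have hD x : hs a b x < D by apply: ltn_trans QD; rewrite ltn_mod.
have iD : i < D := ltn_trans iQ QD; have jD : j < D := ltn_trans jQ QD.
have prep := @prepare_ok R n m f q K L Q n' stride us vs ls t D W S erefl DW D16 S2 mD n'D
  (fun e => hs a b (us e)) (fun e => hs a b (vs e)) (fun e => lb a (us e)) (fun e => lb a (vs e))
  i j base iD jD bD (fun e _ => hD _) (fun e _ => hD _)
  (fun e lt => lb_lt ok a (p_us ok lt)) (fun e lt => lb_lt ok a (p_vs ok lt)) st E H iE jE bE cl.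
set s := run_list a b i j.
have lts : size s <= m := size_sel_upto _ _.
eapply hoare_le.
  eapply hoare_seq; apply: hoare_conseq (hoare_frame prep) _ _; first exact: leqnn.
  move=> st1 [[cE1 idx1 mem1] [fw1 fr1]].
  have E1 : env st1 by apply: env_frame (conj fw1 fr1) _ _ E.
  have b1 : wmem st1 a_base 0 = base by rewrite fw1.
  have rel1 : simrel 36 a_base base stride st1 (run_input a b i j).
    by split=> // c r _; exact: mem1.
  have leW : base + stride <= W by clear -bD strD DW; lia.
  have sim := exec_shift (isT : a_base < 36) leWA leW exA rel1.
  eapply hoare_seq; apply: hoare_conseq sim _ _; first exact: leqnn.
  move=> st2 [[b2 rel2] lc2].
  have low2 c x : c < 36 -> wmem st2 c x = wmem st1 c x /\ rmem st2 c x = rmem st1 c x.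
    by move=> lt; apply: lc2; rewrite lt.
  have outD r : r < size s -> wmem st2 39 (base + r) = wmem out 3 r /\ wmem out 3 r < D.
    move=> lt; have [-> _] := rel2 3 r (leq_trans lt (leq_trans lts m_stride)); split=> //.
    have [ltW|->] := exec_word_bounded exA 3 r; first by clear -ltW leWA strD; lia.
    by rewrite /= ?nth_nil; clear -D16; lia.
  have s_lt r : r < size s -> nth 0 s r < D.
    move=> lt; have := mem_nth 0 lt; rewrite mem_filter mem_iota => /andP[_ /andP[_ lm]].
    by apply: ltn_trans mD.
  have col := @collect_ok R W D st2 s base mk (wmem out 3) DW D16 (leq_ltn_trans lts mD) bD s_lt
    (filter_uniq _ (iota_uniq _ _)).
  eapply hoare_seq; apply: hoare_conseq (hoare_frame (col _ b2 _ _ outD)) _ _.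
  - by rewrite (low2 _ _ _).1 // cE1.
  - by move=> r lt; rewrite (low2 _ _ _).1 // idx1.
  - by move=> e; rewrite (low2 _ _ _).1 // fw1.
  - exact: leqnn.
  move=> st3 [mk3 [fw3 fr3]].
  have b3 : wmem st3 a_base 0 = base by rewrite fw3.
  have str3 : wmem st3 a_stride 0 = stride.
    by rewrite fw3 // (low2 _ _ _).1 //; exact: env_stride E1.
  apply: hoare_setw.
  - by rewrite /=; clear -DW D16; lia.
  - by rewrite /= b3 str3; repeat split; clear -DW D16 bD strD; lia.
  rewrite /= b3 str3; split.
  - by [].
  - move=> c r ler.
    have -> : wmem (setw st3 a_base 0 (base + stride)) (36 + c) r = wmem st2 (36 + c) r.
      by rewrite -fw3 //; rewrite /collect /for_loop /= !inE; lia.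
    have -> : rmem (setw st3 a_base 0 (base + stride)) (36 + c) r = rmem st2 (36 + c) r.
      by rewrite -fr3.
    have [-> ->] := lc2 (36 + c) r ltac:(by rewrite ler orbT).
    have -> : r = base + (r - base) by lia.
    have [-> ->] := mem1 c (r - base).
    have ge : stride <= r - base by lia.
    have ge2 : 2 <= r - base := leq_trans stride2 ge.
    have gem : size s <= r - base := leq_trans lts (leq_trans m_stride ge).
    split.
      by case: c {ler ge} => [|[|[|c]]] /=; rewrite ?nth_nil // nth_default ?size_map.
    by case: c {ler ge} => [|[|c]] /=; rewrite ?nth_nil // nth_default ?size_map //=; apply: ltnW.
  - by move=> e; rewrite /= /update /= mk3.
by rewrite /=; clear -lts; lia.
Qed.

Variables (WA : nat -> nat -> nat -> nat -> nat) (TA : nat -> nat -> nat -> nat -> nat) (out : nat -> nat -> nat -> nat -> state R) (TT : nat).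
Hypothesis exA : forall a b i j, a < q -> b < L -> i < Q -> j < Q ->
  [/\ WA a b i j <= stride, TA a b i j <= TT &
   exec (WA a b i j) A (run_input a b i j) (TA a b i j) (out a b i j)].

(** Runs are numbered by [r = (a * L + b) * (Q * Q) + (i * Q + j)], the order of the nested
    loops. *)
Definition mark_run r e := let c := r %/ (Q * Q) in let d := r %% (Q * Q) in
  marked (run_list (c %/ L) (c %% L) (d %/ Q) (d %% Q))
    (out (c %/ L) (c %% L) (d %/ Q) (d %% Q)) e.

Definition marks r e := has (fun r' => mark_run r' e) (iota 0 r).
Arguments marks : simpl never.

Lemma marksS r e : marks r.+1 e = marks r e || mark_run r e.
Proof. by rewrite /marks -[r.+1 in LHS]addn1 iotaD has_cat /= orbF. Qed.

Definition progress r st := [/\ wmem st a_base 0 = r * stride, clean (r * stride) st &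
  forall e, wmem st 3 e = marks r e].

Lemma progress_eq r st st' :
  (forall a, a \in [:: 3; a_base] -> forall i, wmem st' a i = wmem st a i) ->
  (forall a i, wmem st' (36 + a) i = wmem st (36 + a) i /\ rmem st' (36 + a) i = rmem st (36 + a) i) ->
  progress r st -> progress r st'.
Proof.
move=> w h [bE cl mk]; split; first by rewrite w.
  by move=> a i le; have [-> ->] := h a i; apply: cl.
by move=> e; rewrite w.
Qed.

Lemma progress_setw r st a x : a < 36 -> a \notin [:: 3; a_base] ->
  progress r st -> progress r (setw st a 0 x).
Proof.
move=> lt na; apply: progress_eq => [b bK i|b i]; rewrite /= /update ifF //.
  by apply/negbTE/nandP; left; apply: contraNneq na => <-.
by apply/negbTE/nandP; left; lia.
Qed.

Lemma env_setw st a x : a \notin env_arrays -> env st -> env (setw st a 0 x).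
Proof.
move=> na; apply: env_keep => // b bK i; rewrite /= /update ifF //.
by apply/negbTE/nandP; left; apply: contraNneq na => <-.
Qed.

Lemma wmods_pairs a :
  a \in [:: a_c; a_al; a_be; a_hu; a_lu; a_hv; a_lv] ++ env_arrays -> a \notin wmods (pairs A).
Proof.
move=> aK; have nr : a \notin wmods (run A).
  apply: wmods_run; move: aK; rewrite /kept !mem_cat !inE.
  by case: (a \in env_arrays); rewrite ?orbT //; lia.
rewrite -[wmods _]/([:: a_d; a_i; a_j] ++ wmods (run A) ++ [:: a_d]).
by rewrite mem_cat (mem_cat _ (wmods (run A))) (negbTE nr); move: aK; rewrite /env_arrays !(inE, mem_cat); lia.
Qed.

Lemma rmods_pairs a : a \in [:: 0; 1] -> a \notin rmods (pairs A).
Proof.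
move=> aK; rewrite -[rmods _]/(rmods (run A) ++ [::]) cats0; exact: rmods_run.
Qed.

Lemma run_lt c d : c < q * L -> d < Q * Q -> (c * (Q * Q) + d) * stride < D.
Proof.
move=> cl dl; apply: leq_ltn_trans (p_N ok); rewrite leq_mul2r; apply/orP; right.
by apply: leq_trans (_ : c.+1 * (Q * Q) <= _); [rewrite mulSn; lia|rewrite leq_mul2r cl orbT].
Qed.

Lemma pairs_ok st c : env st -> c < q * L ->
  (forall e, e < m ->
    [/\ wmem st a_hu e = hs (c %/ L) (c %% L) (us e), wmem st a_lu e = lb (c %/ L) (us e),
        wmem st a_hv e = hs (c %/ L) (c %% L) (vs e) & wmem st a_lv e = lb (c %/ L) (vs e)]) ->
  progress (c * (Q * Q)) st ->
  hoare W (pairs A) st (Q * Q * (400 * m.+1 + 4 * TT) + 50) (progress (c.+1 * (Q * Q))).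
Proof.
move=> E cqL H pr.
have DW := DW ok; have D16 := p_D16 ok; have QQD := p_QQ ok; have Q0 := p_Q0 ok.
have QD := p_Q ok; have L0 := p_L0 ok.
have a_lt : c %/ L < q by rewrite ltn_divLR.
have b_lt : c %% L < L by rewrite ltn_mod.
eapply hoare_le.
  apply: hoare_conseq (hoare_for (N := Q * Q) (k := 300 * m.+1 + 4 * TT + 20)
    (I := fun d st' => progress (c * (Q * Q) + d) st') _ _ _ _ _) _ _.
  - by clear -DW D16; lia.
  - by clear -DW QQD; lia.
  - by rewrite addn0; apply: progress_setw.
  - move=> d st' _ [fw _] vi _.
    have Q' : wmem st' a_Q 0 = Q by rewrite fw ?wmods_pairs //; exact: env_Q E.
    by rewrite /= Q'; split=> //; repeat split; clear -DW D16 QD QQD; lia.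
  - move=> d st' ltd [fw fr] vi pr'.
    have keep a x : a \in [:: a_c; a_al; a_be; a_hu; a_lu; a_hv; a_lv] ++ env_arrays ->
      wmem st' a x = wmem st a x by move=> aK; rewrite fw // wmods_pairs.
    have E' : env st'.
      apply: env_keep E => a aK i; first by rewrite keep // mem_cat aK orbT.
      by rewrite fr // rmods_pairs.
    have Q' := env_Q E'.
    have i_lt : d %/ Q < Q by rewrite ltn_divLR.
    have j_lt : d %% Q < Q by rewrite ltn_mod.
    have dD : d < D := ltn_trans ltd QQD.
    eapply hoare_le.
      eapply hoare_seq; apply: hoare_setw.
      - by rewrite /=; clear -DW D16; lia.
      - by rewrite /= vi Q'; repeat split; clear -DW D16 dD QD i_lt; lia.
      rewrite /= vi Q'; eapply hoare_seq; apply: hoare_setw.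
      - by rewrite /=; clear -DW D16; lia.
      - by upd; rewrite vi Q'; repeat split; clear -DW D16 dD QD j_lt; lia.
      upd; rewrite vi Q'; set st1 := setw _ _ _ _.
      have E1 : env st1 by do 2!apply: env_setw => //.
      have [b1 cl1 mk1] : progress (c * (Q * Q) + d) st1.
        by do 2!apply: progress_setw => //.
      have H1 e : e < m -> [/\ wmem st1 a_hu e = hs (c %/ L) (c %% L) (us e),
           wmem st1 a_lu e = lb (c %/ L) (us e), wmem st1 a_hv e = hs (c %/ L) (c %% L) (vs e) &
           wmem st1 a_lv e = lb (c %/ L) (vs e)].
        by move=> lte; have [h1 h2 h3 h4] := H e lte; split; rewrite /st1; upd; rewrite keep.
      have [leW leT ex] := exA a_lt b_lt i_lt j_lt.
      have i1 : wmem st1 a_i 0 = d %/ Q by rewrite /st1; upd.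
      have j1 : wmem st1 a_j 0 = d %% Q by rewrite /st1; upd.
      have R1 := run_ok E1 a_lt b_lt i_lt j_lt (run_lt cqL ltd) H1 i1 j1 b1 cl1 mk1 leW ex.
      have d1 : wmem st1 a_d 0 = d by rewrite /st1; upd.
      apply: (@hoare_conseq _ _ _ _ _ (300 * m.+1 + 4 * TT) _ _ (hoare_frame R1)).
        by clear -leT; lia.
      move=> st2 [[b2 cl2 mk2] [fw2 fr2]].
      have d2 : wmem st2 a_d 0 = d by rewrite fw2 ?wmods_run.
      split=> //; apply: progress_setw => //.
      have stepE : (c * (Q * Q) + d).+1 * stride = (c * (Q * Q) + d) * stride + stride.
        by rewrite mulSn addnC.
      rewrite addnS; split.
      - by rewrite stepE.
      - by move=> a r; rewrite stepE => le; apply: cl2.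
      - move=> e; rewrite marksS mk2 /mark_run.
        by rewrite divnMDl ?muln_gt0 ?Q0 // (divn_small ltd) addn0 modnMDl (modn_small ltd).
    by rewrite /=; clear; lia.
  - exact: leqnn.
  - by rewrite mulSn addnC.
by rewrite [wcost _]/=; clear; lia.
Qed.

Lemma wmods_main a : a \in env_arrays -> a \notin wmods (main A).
Proof.
move=> aK; have np : a \notin wmods (pairs A) by apply: wmods_pairs; rewrite mem_cat aK orbT.
rewrite -[wmods _]/([:: a_c; a_al; a_be] ++ wmods hash_all ++ wmods (pairs A) ++ [:: a_c]).
by rewrite mem_cat (mem_cat _ (wmods hash_all)) (mem_cat _ (wmods (pairs A))) (negbTE np); move: aK; rewrite /env_arrays !inE; lia.
Qed.

Lemma rmods_main a : a \in [:: 0; 1] -> a \notin rmods (main A).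
Proof.
move=> aK; rewrite -[rmods _]/(rmods (pairs A) ++ [::]) cats0; exact: rmods_pairs.
Qed.

Lemma main_ok st : env st -> progress 0 st ->
  hoare W (main A) st
    (q * L * (Q * Q * (400 * m.+1 + 4 * TT) + 300 * m.+1 * K.+1 + 100) + 50)
    (fun st' => forall e, wmem st' 3 e = marks N e).
Proof.
move=> E pr.
have DW := DW ok; have D16 := p_D16 ok; have qLD := p_qL ok; have L0 := p_L0 ok.
have LQ := p_LQ ok; have QD := p_Q ok; have qD := p_q ok.
eapply hoare_le.
  apply: hoare_conseq (hoare_for (N := q * L)
    (k := Q * Q * (400 * m.+1 + 4 * TT) + 300 * m.+1 * K.+1 + 80)
    (I := fun c st' => progress (c * (Q * Q)) st') _ _ _ _ _) _ _.
  - by clear -DW D16; lia.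
  - by clear -DW qLD; lia.
  - by rewrite mul0n; apply: progress_setw.
  - move=> c st' _ [fw _] vi _.
    have q' : wmem st' a_q 0 = q by rewrite fw ?wmods_main //; exact: env_q E.
    have L' : wmem st' a_L 0 = L by rewrite fw ?wmods_main //; exact: env_L E.
    by rewrite /= q' L'; split=> //; repeat split; clear -DW D16 qD QD qLD LQ; lia.
  - move=> c st' ltc [fw fr] vi pr'.
    have E' : env st'.
      apply: env_keep E => a aK i; first by rewrite fw // wmods_main.
      by rewrite fr // rmods_main.
    have L' := env_L E'.
    have a_lt : c %/ L < q by rewrite ltn_divLR.
    have b_lt : c %% L < L by rewrite ltn_mod.
    have cD : c < D := ltn_trans ltc qLD.
    eapply hoare_le.
      eapply hoare_seq; apply: hoare_setw.
      - by rewrite /=; clear -DW D16; lia.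
      - by rewrite /= vi L'; repeat split; clear -DW D16 cD LQ QD a_lt qD; lia.
      rewrite /= vi L'; eapply hoare_seq; apply: hoare_setw.
      - by rewrite /=; clear -DW D16; lia.
      - by upd; rewrite vi L'; repeat split; clear -DW D16 cD LQ QD b_lt; lia.
      upd; rewrite vi L'; set st1 := setw _ _ _ _.
      have E1 : env st1 by do 2!apply: env_setw => //.
      have pr1 : progress (c * (Q * Q)) st1.
        by do 2!apply: progress_setw => //.
      have a1 : wmem st1 a_al 0 = c %/ L by rewrite /st1; upd.
      have be1 : wmem st1 a_be 0 = c %% L by rewrite /st1; upd.
      have c1 : wmem st1 a_c 0 = c by rewrite /st1; upd.
      eapply hoare_seq.
      apply: hoare_conseq (hoare_frame (hash_all_ok ok E1 a1 a_lt be1 b_lt)) _ _; first exact: leqnn.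
      move=> st2 [H2 [fw2 fr2]].
      have E2 : env st2 by apply: env_frame (conj fw2 fr2) _ _ E1.
      have pr2 : progress (c * (Q * Q)) st2.
        apply: progress_eq pr1 => a; first by rewrite !inE => aK i; rewrite fw2 //= !inE; lia.
        by move=> i; rewrite fw2 ?fr2 //= !inE; lia.
      have c2 : wmem st2 a_c 0 = c by rewrite fw2.
      apply: hoare_conseq (hoare_frame (pairs_ok E2 ltc H2 pr2)) _ _; first exact: leqnn.
      move=> st3 [pr3 [fw3 fr3]].
      have c3 : wmem st3 a_c 0 = c by rewrite fw3 ?wmods_pairs.
      by split=> //; apply: progress_setw.
    by rewrite /=; clear; lia.
  - exact: leqnn.
  - by move=> st' [].
by rewrite [wcost _]/=; clear; lia.
Qed.

End Main.

(** * Choice of the hash parameters *)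

(** The exponent will depend on the given algorithm alone, so the power can be unrolled into one
    expression of constant cost. *)
Fixpoint wpow e k := if k is k'.+1 then e *w wpow e k' else #1.

Lemma wcost_wpow e k : wcost (wpow e k) = 1 + k * (wcost e).+1.
Proof. by elim: k => [|k IH] //=; rewrite IH; lia. Qed.

Lemma wpow_ok (R : realType) W (st : state R) e k : 1 < W -> wok W st e ->
  0 < wden st e -> wden st e ^ k < W ->
  wok W st (wpow e k) /\ wden st (wpow e k) = wden st e ^ k.
Proof.
move=> W1 oke X0; elim: k => [|k IH] lt; first by [].
have [|okk dk] := IH.
  by apply: leq_ltn_trans lt; rewrite leq_pexp2l.
by rewrite /= dk -expnS; split.
Qed.

(** The branch compares the sizes of the two families, q^3 for plain hashing and q times the cube of
    the second prime for two levels, after cancelling the common factor q. As before, the double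
    subtraction from [vN] is a minimum. *)
Definition setup k :=
  search degree_test ;;
  a_q ::= $a_cand ;;
  a_K ::= $a_cand /w (#4 *w vF) ;;
  search square_test ;;
  CIf (BLeW ($a_q *w $a_q) ($a_cand *w $a_cand *w $a_cand))
    (a_L ::= #1 ;; a_Q ::= $a_q)
    (a_L ::= $a_cand ;; a_Q ::= $a_cand) ;;
  a_B ::= (vN +w $a_q -w #1) /w $a_q ;;
  a_S ::= $a_B *w ((vN -w (vN -w $a_q) +w $a_Q -w #1) /w $a_Q) ;;
  a_n' ::= (vN +w vF -w #1) /w vF ;;
  a_stride ::= wpow (vN +w vM +w #2) k.

Definition first_prime lo (P : pred nat) p := [/\ lo <= p, prime p, P p &
  forall q, lo <= q < p -> ~~ (prime q && P q)].

Definition choose_L q1 q2 := if q1 * q1 <= q2 * q2 * q2 then 1 else q2.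
Definition choose_Q q1 q2 := if q1 * q1 <= q2 * q2 * q2 then q1 else q2.

Lemma setup_ok (R : realType) (st : state R) n m f k q1 q2 D W :
  16 <= D -> W = D * D -> 0 < f -> 0 < n -> n < D -> m < D -> q1 < D -> q2 < D ->
  8 * f < D -> q1 * q1 < D -> q2 * q2 < D ->
  label_range n q1 (choose_Q q1 q2) < D -> (n + m + 2) ^ k < D ->
  first_prime (8 * f) (fun q => n <= q ^ (q %/ (4 * f))) q1 ->
  first_prime (8 * f) (fun q => q1 <= q * q) q2 ->
  wmem st 0 0 = n -> wmem st 0 1 = m -> wmem st 0 2 = f ->
  hoare W (setup k) st (160 * q1.+1 * q1.+1 + 120 * q2.+1 * q2.+1 + 200 + 12 * k)
   (fun st' =>
     [/\ wmem st' a_q 0 = q1, wmem st' a_K 0 = q1 %/ (4 * f),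
         wmem st' a_L 0 = choose_L q1 q2 & wmem st' a_Q 0 = choose_Q q1 q2] /\
     [/\ wmem st' a_B 0 = ceil_div n q1,
         wmem st' a_S 0 = label_range n q1 (choose_Q q1 q2),
         wmem st' a_n' 0 = ceil_div n f & wmem st' a_stride 0 = (n + m + 2) ^ k]).
Proof.
move=> D16 WD f0 n0 nD mD q1D q2D fD qq1 qq2 SD powD fp1 fp2 nE mE fE.
have DW : 16 * D <= W by apply: (D_ltW D16 WD).
have [le1 pr1 P1 min1] := fp1; have [le2 pr2 P2 min2] := fp2.
have q0 : 0 < q1 := prime_gt0 pr1; have q20 : 0 < q2 := prime_gt0 pr2.
eapply hoare_le.
  have S1 := search_ok D16 WD n0 nD f0 fD (P := fun q => n <= q ^ (q %/ (4 * f)))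
    (X := degree_test) (kX := 60) fE _ pr1 P1 min1 isT isT _.
  eapply hoare_seq; apply: hoare_conseq (hoare_frame (S1 _ _)) _ _.
  - by rewrite le1.
  - move=> st' q b fw qE bE /andP[lq uq]; apply: (degree_test_ok D16 WD n0 nD f0 fD) => //.
    + by rewrite fw.
    + by rewrite fw.
    + by apply/andP; split; [clear -lq f0; lia|clear -uq q1D; lia].
  - exact: leqnn.
  move=> st1 [c1 [fw1 _]].
  have n1 : wmem st1 0 0 = n by rewrite fw1.
  have m1 : wmem st1 0 1 = m by rewrite fw1.
  have f1 : wmem st1 0 2 = f by rewrite fw1.
  clear fw1; eapply hoare_seq; apply: hoare_setw.
  - by rewrite /=; clear -DW D16; lia.
  - by rewrite /= c1; clear -DW D16 q1D; lia.
  rewrite /= c1; abs_state st2 st2E.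
  have c2 : wmem st2 a_cand 0 = q1 by rewrite st2E.
  have n2 : wmem st2 0 0 = n by rewrite st2E.
  have m2 : wmem st2 0 1 = m by rewrite st2E.
  have f2 : wmem st2 0 2 = f by rewrite st2E.
  have q_2 : wmem st2 a_q 0 = q1 by rewrite st2E.
  clear st2E c1 n1 m1 f1; eapply hoare_seq; apply: hoare_setw.
  - by rewrite /=; clear -DW D16; lia.
  - rewrite /= c2 f2; have := leq_div q1 (4 * f); clear -DW D16 q1D fD => ?.
    by repeat split; lia.
  rewrite /= c2 f2; abs_state st3 st3E.
  have n3 : wmem st3 0 0 = n by rewrite st3E.
  have m3 : wmem st3 0 1 = m by rewrite st3E.
  have f3 : wmem st3 0 2 = f by rewrite st3E.
  have q3 : wmem st3 a_q 0 = q1 by rewrite st3E.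
  have K3 : wmem st3 a_K 0 = q1 %/ (4 * f) by rewrite st3E.
  clear st3E c2 n2 m2 f2 q_2.
  have S2 := search_ok D16 WD n0 nD f0 fD (P := fun q => q1 <= q * q)
    (X := square_test) (kX := 20) f3 _ pr2 P2 min2 isT isT _.
  eapply hoare_seq; apply: hoare_conseq (hoare_frame (S2 _ _)) _ _.
  - by rewrite le2.
  - move=> st' q b fw qE bE /andP[lq uq]; have q' : wmem st' a_q 0 = q1 by rewrite fw.
    have sq := square_test_ok D16 WD n0 nD f0 fD q' q1D qE bE (leq_ltn_trans uq q2D).
    apply: hoare_le sq _.
    by clear; lia.
  - exact: leqnn.
  move=> st4 [c4 [fw4 _]].
  have n4 : wmem st4 0 0 = n by rewrite fw4.
  have m4 : wmem st4 0 1 = m by rewrite fw4.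
  have f4 : wmem st4 0 2 = f by rewrite fw4.
  have q4 : wmem st4 a_q 0 = q1 by rewrite fw4.
  have K4 : wmem st4 a_K 0 = q1 %/ (4 * f) by rewrite fw4.
  clear fw4 n3 m3 f3 q3 K3.
  have q23 : q2 * q2 * q2 < W by apply: (ltW_mul D16 WD).
  have W0 : 0 < W by clear -DW D16; lia.
  have okl : wok W st4 ($a_q *w $a_q).
    by rewrite /= q4; repeat split; clear -DW D16 q1D qq1; lia.
  have okr : wok W st4 ($a_cand *w $a_cand *w $a_cand).
    by rewrite /= c4; repeat split=> //; clear -DW D16 q2D qq2; lia.
  have bE : beval W st4 (BLeW ($a_q *w $a_q) ($a_cand *w $a_cand *w $a_cand)) =
      Some (q1 * q1 <= q2 * q2 * q2).
    rewrite -[LHS]/(lift2 leq (weval W st4 ($a_q *w $a_q)) (weval W st4 ($a_cand *w $a_cand *w $a_cand))).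
    by rewrite (weval_ok okl) (weval_ok okr) /= q4 c4.
  have branch : hoare W (CIf (BLeW ($a_q *w $a_q) ($a_cand *w $a_cand *w $a_cand))
      (a_L ::= #1 ;; a_Q ::= $a_q) (a_L ::= $a_cand ;; a_Q ::= $a_cand)) st4 40
      (fun st' => wmem st' a_L 0 = choose_L q1 q2 /\ wmem st' a_Q 0 = choose_Q q1 q2).
    eapply hoare_le; first apply: (hoare_if (k := 20) bE).
      rewrite /choose_L /choose_Q; case: ifP => _.
        apply: (@hoare_le _ _ (3 + 4)) => //.
        apply: hoare_seq; apply: hoare_setw; try by rewrite /=; clear -DW D16; lia.
        apply: hoare_setw; [exact: W0|by upd; rewrite q4; split=> //; clear -DW D16 q1D; lia|].
        by upd; rewrite q4.
      apply: (@hoare_le _ _ (4 + 4)) => //.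
      apply: hoare_seq; apply: hoare_setw; first by rewrite /=; clear -DW D16; lia.
        by rewrite /= c4; split=> //; clear -DW D16 q2D; lia.
      apply: hoare_setw; [exact: W0|by upd; rewrite c4; split=> //; clear -DW D16 q2D; lia|].
      by upd; rewrite c4.
    by [].
  eapply hoare_seq; apply: hoare_conseq (hoare_frame branch) _ _; first exact: leqnn.
  move=> st5 [[L5 Q5] [fw5 _]].
  have n5 : wmem st5 0 0 = n by rewrite fw5.
  have m5 : wmem st5 0 1 = m by rewrite fw5.
  have f5 : wmem st5 0 2 = f by rewrite fw5.
  have q5 : wmem st5 a_q 0 = q1 by rewrite fw5.
  have K5 : wmem st5 a_K 0 = q1 %/ (4 * f) by rewrite fw5.
  clear fw5 n4 m4 f4 q4 K4 c4 bE okl okr branch.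
  move: SD L5 Q5; rewrite /label_range.
  have Q0 : 0 < choose_Q q1 q2 by rewrite /choose_Q; case: ifP.
  have QD : choose_Q q1 q2 < D by rewrite /choose_Q; case: ifP.
  move: (choose_Q q1 q2) Q0 QD (choose_L q1 q2) => Q Q0 QD L SD L5 Q5.
  have cq : (n + q1 - 1) %/ q1 = ceil_div n q1 by rewrite subn1.
  have cf : (n + f - 1) %/ f = ceil_div n f by rewrite subn1.
  have cQ : (n - (n - q1) + Q - 1) %/ Q = ceil_div (minn n q1) Q.
    by rewrite subn1 (_ : n - (n - q1) = minn n q1) //; clear; lia.
  have leq_ceil x y : 0 < y -> (x + y - 1) %/ y <= x + y.
    by move=> _; apply: leq_trans (leq_div _ _) _; clear; lia.
  have l1 := leq_ceil n q1 q0; have l2 := leq_ceil n f f0.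
  have l3 := leq_ceil (n - (n - q1)) Q Q0.
  have fD' : f < D by clear -fD; lia.
  eapply hoare_seq; apply: hoare_setw.
  - by rewrite /=; clear -DW D16; lia.
  - by rewrite /= n5 q5; repeat split; clear -DW D16 nD q1D l1; lia.
  rewrite /= n5 q5 cq; abs_state st6 st6E.
  have n6 : wmem st6 0 0 = n by rewrite st6E.
  have q6 : wmem st6 a_q 0 = q1 by rewrite st6E.
  have B6 : wmem st6 a_B 0 = ceil_div n q1 by rewrite st6E.
  have Q6 : wmem st6 a_Q 0 = Q by rewrite st6E.
  have BW : ceil_div n q1 < W by rewrite -cq; clear -DW D16 nD q1D l1; lia.
  eapply hoare_seq; apply: hoare_setw.
  - by rewrite /=; clear -DW D16; lia.
  - rewrite /= n6 q6 B6 Q6; repeat split=> //; try by clear -DW D16 nD q1D QD l3; lia.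
    by rewrite cQ; clear -DW D16 SD; lia.
  rewrite /= n6 q6 B6 Q6 cQ; abs_state st7 st7E.
  have n7 : wmem st7 0 0 = n by rewrite st7E.
  have f7 : wmem st7 0 2 = f by rewrite st7E st6E.
  eapply hoare_seq; apply: hoare_setw.
  - by rewrite /=; clear -DW D16; lia.
  - by rewrite /= n7 f7; repeat split; clear -DW D16 nD fD' l2; lia.
  rewrite /= n7 f7 cf; abs_state st8 st8E.
  have n8 : wmem st8 0 0 = n by rewrite st8E.
  have m8 : wmem st8 0 1 = m by rewrite st8E st7E st6E.
  have W1 : 1 < W by clear -DW D16; lia.
  have okX : wok W st8 (vN +w vM +w #2).
    by rewrite /= n8 m8; repeat split; clear -DW D16 nD mD; lia.
  have dX : wden st8 (vN +w vM +w #2) = n + m + 2 by rewrite /= n8 m8.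
  have [|| okp dp] := @wpow_ok R W st8 _ k W1 okX.
  - by rewrite dX; clear; lia.
  - by rewrite dX; clear -DW D16 powD; lia.
  apply: hoare_setw; [exact: W0|exact: okp|].
  by rewrite dp dX; upd; rewrite st8E; upd; rewrite st7E; upd; rewrite st6E; upd; split.
rewrite wcost_wpow.
by rewrite /=; clear; lia.
Qed.

Lemma first_primeP lo (P : pred nat) p : lo <= p -> prime p -> P p ->
  exists2 p0, first_prime lo P p0 & p0 <= p.
Proof.
move=> lop p_pr Pp.
have ex : exists p, [&& lo <= p, prime p & P p] by exists p; rewrite lop p_pr.
case: (ex_minnP ex) => p0 /and3P[le0 pr0 P0] min0; exists p0; last by apply: min0; rewrite lop p_pr.
split=> // q /andP[leq ltq]; apply: contraL ltq => /andP[q_pr Pq].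
by rewrite -leqNgt min0 // leq q_pr.
Qed.

Lemma first_prime_le lo P p q : first_prime lo P p -> lo <= q -> prime q -> P q -> p <= q.
Proof.
move=> [_ _ _ H] loq q_pr Pq; rewrite leqNgt; apply/negP => ltq.
by have := H q; rewrite loq ltq q_pr Pq => /(_ isT).
Qed.

(** From [8 * f * c <= q] the exponent is at least [c]. This is applied with [b = f] when [f ^ c]
    reaches [n], with [b = 2] and a logarithm for [c], and with [b = q], [c = 1] for the mere
    existence of the prime. *)
Lemma degree_suffices n f b c q : 0 < f -> 0 < q -> n <= b ^ c -> 8 * f * c <= q -> b <= q ->
  n <= q ^ (q %/ (4 * f)).
Proof.
move=> f0 q0 nb fq leq; apply: leq_trans nb _.
apply: leq_trans (_ : q ^ c <= _).
  by case: c {fq} => // c; rewrite leq_exp2r.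
by rewrite leq_pexp2l // leq_divRL; lia.
Qed.

From mathcomp Require Import all_classical all_analysis.
From mathcomp Require Import lra.
Import Order.TTheory Num.Theory.
Import numFieldNormedType.Exports.

(** * The union of spanners of induced subgraphs *)

Local Open Scope ring_scope.

Section ShortWalks.
Variables (R : realType) (n : nat) (w : {set 'I_n} -> R) (E : {set {set 'I_n}}).
Implicit Types u v x : 'I_n.

(** A bound on [dist] phrased by walks, without asking whether the infimum is attained; in this form
    bounds add up under concatenation. *)
Definition short_walks u v (c : R) := forall eps : R, 0 < eps ->
  exists p, [/\ path (adj E) u p, last u p = v & walk_len w u p <= c + eps].

Lemma walk_len_cons u x p : walk_len w u (x :: p) = w [set u; x] + walk_len w x p.
Proof. by rewrite /walk_len /= big_cons. Qed.

Lemma walk_len_cat u p q :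
  walk_len w u (p ++ q) = walk_len w u p + walk_len w (last u p) q.
Proof.
elim: p u => [|x p IH] u /=; first by rewrite /walk_len big_nil add0r.
by rewrite !walk_len_cons IH addrA.
Qed.

Lemma short_walks_refl u : short_walks u u 0.
Proof.
by move=> eps eps0; exists [::]; rewrite /walk_len big_nil add0r; split=> //; exact: ltW.
Qed.

Lemma short_walks_trans u x v c d :
  short_walks u x c -> short_walks x v d -> short_walks u v (c + d).
Proof.
move=> H1 H2 eps eps0; have eps2 : 0 < eps / 2 by rewrite divr_gt0.
have [p [pp lp wp]] := H1 _ eps2; have [q [pq lq wq]] := H2 _ eps2.
exists (p ++ q); split; first by rewrite cat_path pp lp.
  by rewrite last_cat lp.
by rewrite walk_len_cat lp; lra.
Qed.

Lemma dist_le_short_walks u v c : (dist w E u v <= c%:E)%E <-> short_walks u v c.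
Proof.
split=> [le eps eps0|H].
  have : (dist w E u v < (c + eps)%:E)%E.
    by apply: le_lt_trans le _; rewrite lte_fin ltrDl.
  move=> /ereal_inf_lt[_ [p [pp lp] <-]]; rewrite lte_fin => lt.
  by exists p; split=> //; exact: ltW.
apply/lee_addgt0Pr => eps eps0; have [p [pp lp le]] := H _ eps0.
apply: le_trans (_ : ((walk_len w u p)%:E <= _)%E); last by rewrite -EFinD lee_fin.
by apply: ereal_inf_lbound; exists p.
Qed.

End ShortWalks.

(** Replace every edge of a walk by a short walk in [H] and concatenate. Dividing by [t] first turns
    the claim into a lower bound for an infimum, to be checked walk by walk; infinite distances need
    no separate case. *)
Lemma dist_le_of_edges (R : realType) n (w : {set 'I_n} -> R) (t : R)
    (E H : {set {set 'I_n}}) :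
  0 < t ->
  (forall a b, adj E a b -> short_walks w H a b (t * w [set a; b])) ->
  forall u v, (dist w H u v <= t%:E * dist w E u v)%E.
Proof.
move=> t0 edge u v; rewrite -lee_pdivrMl //.
apply: le_ereal_inf_tmp => _ [p [pp lp] <-].
rewrite lee_pdivrMl // -EFinM; apply/dist_le_short_walks.
elim: p u pp lp => [|x p IH] u /=.
  by move=> _ ->; rewrite /walk_len big_nil mulr0; exact: short_walks_refl.
move=> /andP[ux pp] lp; rewrite walk_len_cons mulrDr.
by apply: short_walks_trans (edge _ _ ux) (IH _ pp lp).
Qed.

Section Induced.
Variables (R : realType) (n n' : nat) (G : wgraph R n).
Variables (V : {set 'I_n}) (lab : 'I_n -> 'I_n').
Hypothesis lab_inj : {in V &, injective lab}.

Definition pullback (e' : {set 'I_n'}) := [set x in V | lab x \in e'].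

Lemma pullback_imset (e : {set 'I_n}) : e \subset V -> pullback (lab @: e) = e.
Proof.
move=> /fintype.subsetP eV; apply/setP => x; rewrite inE; apply/andP/idP => [[xV]|xe].
  by move=> /imsetP[y ye /lab_inj ->] //; exact: eV.
by rewrite eV // imset_f.
Qed.

Definition induced_edges := [set lab @: (e : {set 'I_n}) |
  e in [set e : {set 'I_n} in edges G | e \subset V]].

Lemma induced_card2 e' : e' \in induced_edges -> #|e'| = 2%N.
Proof.
move=> /imsetP[e]; rewrite inE => /andP[eG /fintype.subsetP eV] ->.
rewrite card_in_imset ?(edges_card2 eG) // => x y xe ye.
by apply: lab_inj; exact: eV.
Qed.

Lemma induced_len_gt0 e' : e' \in induced_edges -> 0 < len G (pullback e').
Proof.
move=> /imsetP[e]; rewrite inE => /andP[eG eV] ->.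
by rewrite pullback_imset // len_gt0.
Qed.

(* The induced_graph subgraph on [V], relabelled by [lab]; vertices outside the
   image of [lab] are isolated padding. *)
Definition induced_graph : wgraph R n' := WGraph induced_card2 induced_len_gt0.

Definition induced_list (es : seq ('I_n * 'I_n)) :=
  [seq (lab e.1, lab e.2) | e <- es & (e.1 \in V) && (e.2 \in V)].

Lemma edge_of_subset (e : 'I_n * 'I_n) :
  (edge_of e \subset V) = (e.1 \in V) && (e.2 \in V).
Proof. by rewrite /edge_of finset.subUset !finset.sub1set. Qed.

Lemma edge_of_lab (e : 'I_n * 'I_n) : edge_of (lab e.1, lab e.2) = lab @: edge_of e.
Proof. by rewrite /edge_of imsetU !imset_set1. Qed.

Lemma induced_edge_list es : edge_list G es -> edge_list induced_graph (induced_list es).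
Proof.
rewrite /edge_list /induced_list => Hes.
have memE e : (e \in [seq edge_of e | e <- es]) = (e \in edges G).
  by rewrite (perm_mem Hes) mem_enum.
have uniqE : uniq [seq edge_of e | e <- es] by rewrite (perm_uniq Hes) enum_uniq.
rewrite -map_comp; set s := [seq _ | _ <- _].
have -> : s = [seq lab @: e | e : {set 'I_n} <- [seq edge_of e | e <- es] & e \subset V].
  rewrite filter_map -map_comp /s; congr map; last first.
    by apply: eq_filter => e /=; rewrite edge_of_subset.
  by apply: funext => e /=; rewrite edge_of_lab.
apply: uniq_perm.
- rewrite map_inj_in_uniq ?filter_uniq // => e1 e2; rewrite !mem_filter.
  by move=> /andP[e1V _] /andP[e2V _] /(congr1 pullback); rewrite !pullback_imset.
- exact: enum_uniq.
move=> e'; rewrite mem_enum; apply/mapP/imsetP => -[e].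
  by rewrite mem_filter memE => /andP[eV eG] ->; exists e => //; rewrite inE eG.
by rewrite inE => /andP[eG eV] ->; exists e => //; rewrite mem_filter memE eV.
Qed.

(** A walk over [H'] that starts at the label of a vertex of [V] lifts step by step: its edges are
    images of edges inside [V], and injectivity of [lab] on [V] identifies the endpoints. Lengths
    agree because relabelled edges inherit theirs through [pullback]. *)
Lemma pullback_walk (H : {set {set 'I_n}}) (H' : {set {set 'I_n'}}) :
  H' \subset induced_edges ->
  (forall e, e \in edges G -> e \subset V -> lab @: e \in H' -> e \in H) ->
  forall p' a, a \in V -> path (adj H') (lab a) p' ->
  exists p, [/\ path (adj H) a p, map lab p = p', last a p \in V &
    walk_len (len G) a p = walk_len (len induced_graph) (lab a) p'].
Proof.
move=> /fintype.subsetP subH' H'H; elim=> [|y' p' IH] a aV /=.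
  by exists [::]; rewrite /walk_len !big_nil.
move=> /andP[ay' pp']; have /imsetP[e] := subH' _ ay'.
rewrite inE => /andP[eG eV] eqe.
have ae : a \in e.
  by rewrite -(pullback_imset eV) -eqe inE aV !inE eqxx.
have [y ya ye] : exists2 y, y != a & e = [set a; y].
  have := edges_card2 eG; rewrite (cardsD1 a) ae add1n => -[/eqP/cards1P[y ey]].
  exists y; last by rewrite -[LHS](finset.setD1K ae) ey.
  by have := set11 y; rewrite -ey !inE => /andP[].
have yV : y \in V by apply: (fintype.subsetP eV); rewrite ye !inE eqxx orbT.
have laby : lab y = y'.
  have : lab y \in lab @: e by rewrite imset_f // ye !inE eqxx orbT.
  rewrite -eqe !inE => /orP[/eqP/lab_inj e1|/eqP //].
  by move: ya; rewrite e1 // eqxx.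
subst y'; have [p [pp mp lp wp]] := IH y yV pp'.
exists (y :: p); rewrite /= mp; split=> //.
  rewrite pp andbT /adj /= -ye; apply: H'H => //; rewrite -eqe; exact: ay'.
by rewrite !walk_len_cons wp; congr (_ + _); rewrite /= eqe pullback_imset // ye.
Qed.

End Induced.

Section Cover.
Variables (R : realType) (n n' N f : nat) (t : R) (G : wgraph R n).
Variables (V : 'I_N -> {set 'I_n}) (lab : 'I_N -> 'I_n -> 'I_n').
Hypothesis lab_inj : forall r, {in V r &, injective (lab r)}.
Variable (H' : 'I_N -> {set {set 'I_n'}}).

Definition union_spanner :=
  [set e in edges G | [exists r, (e \subset V r) && (lab r @: (e : {set 'I_n}) \in H' r)]].

Lemma card_union_spanner : (#|union_spanner| <= \sum_r #|H' r|)%N.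
Proof.
apply: leq_trans (_ : #|\bigcup_(r in [set: 'I_N]) (pullback (V r) (lab r) @: H' r)| <= _)%N.
  apply: subset_leq_card; apply/fintype.subsetP => e.
  rewrite inE => /andP[eG /existsP[r /andP[eV eH]]].
  apply/finset.bigcupP; exists r; rewrite ?inE //.
  by rewrite -(pullback_imset (@lab_inj r) eV) imset_f.
apply: leq_trans (card_bigcup_leq _ _) _.
rewrite [X in (_ <= X)%N](eq_bigl (fun r => r \in [set: 'I_N])) => [|r]; last by rewrite inE.
by apply: leq_sum => r _; apply: leq_imset_card.
Qed.

Hypothesis t1 : 1 <= t.
Hypothesis spanner : forall r, is_spanner t (induced_graph G (@lab_inj r)) (H' r).
Hypothesis cover : forall (F : {set 'I_n}) (u v : 'I_n),
  (#|F| <= f)%N -> u \notin F -> v \notin F ->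
  exists r, [/\ u \in V r, v \in V r & [disjoint V r & F]].

Lemma union_spanner_ft : is_ft_spanner f t G union_spanner.
Proof.
split; first by apply/fintype.subsetP => e; rewrite inE => /andP[].
move=> F leF; apply: dist_le_of_edges; first exact: lt_le_trans ltr01 t1.
move=> a b; rewrite /adj /= inE => /andP[eG dF].
have aF : a \notin F by apply/negbT/(disjointFr dF); rewrite !inE eqxx.
have bF : b \notin F by apply/negbT/(disjointFr dF); rewrite !inE eqxx orbT.
have [r [aV bV dV]] := cover leF aF bF.
have eV : [set a; b] \subset V r by rewrite finset.subUset !finset.sub1set aV.
have [sub sp] := spanner r.
have walk : short_walks (len (induced_graph G (@lab_inj r))) (H' r) (lab r a) (lab r b) (t * len G [set a; b]).
  apply/dist_le_short_walks; apply: le_trans (sp _ _) _.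
  rewrite EFinM lee_pmul2l // ?lte_fin ?(lt_le_trans ltr01) //.
  apply: ereal_inf_lbound; exists [:: lab r b].
    rewrite /= andbT; split=> //; apply/imsetP; exists [set a; b]; rewrite ?inE ?eG //.
    by rewrite imsetU !imset_set1.
  rewrite /walk_len /= big_seq1; congr (len G _)%:E.
  by rewrite -(pullback_imset (@lab_inj r) eV) imsetU !imset_set1.
move=> eps eps0; have [p' [pp' lp' wp']] := walk _ eps0.
have [|p [pp mp lp wp]] :=
  @pullback_walk _ _ _ G (V r) (lab r) (@lab_inj r) (delete_vertices union_spanner F) _ sub _ _ _ aV pp'.
  (* Here the faults are avoided: an edge inside [V r] survives the deletion because [V r] is
     disjoint from [F]. *)
  move=> e eG' eV' eH; rewrite !inE eG' /=; apply/andP; split.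
    by apply/existsP; exists r; rewrite eV'.
  exact: disjointWl eV' dV.
exists p; split=> //; last by rewrite wp.
by apply: (@lab_inj r) => //; rewrite -last_map mp.
Qed.

End Cover.

Local Close Scope ring_scope.

(** * Runs as spanner computations on induced subgraphs *)

Lemma filter_nth (T : Type) (x0 : T) (p : pred T) s :
  [seq x <- s | p x] = [seq nth x0 s k | k <- sel_upto (fun k => p (nth x0 s k)) (size s)].
Proof.
rewrite /sel_upto -(filter_map (nth x0 s) p (iota 0 (size s))).
by rewrite -[map _ (iota _ _)]/(mkseq (nth x0 s) (size s)) mkseq_nth.
Qed.

Section Runs.
Variables (R : realType) (n f q K Q : nat) (G : wgraph R n) (es : seq ('I_n * 'I_n)) (t : R).
Let n' := ceil_div n f.
Let m := size es.
Hypotheses (fn : 0 < f < n) (q0 : 0 < q) (Q0 : 0 < Q) (K0 : 0 < K) (nqK : n <= q ^ K).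
Hypothesis (S2 : 2 * label_range n q Q <= n').
Hypothesis esG : edge_list G es.

Definition end0 : 'I_n * 'I_n :=
  let z := Ordinal (leq_ltn_trans (leq0n f) (proj2 (andP fn))) in (z, z).
Notation e0 := end0.

Definition end1 k : nat := (nth e0 es k).1.
Definition end2 k : nat := (nth e0 es k).2.
Definition edge_len k : R := len G (edge_of (nth e0 es k)).

Definition run_vertices a b i j : {set 'I_n} :=
  [set x : 'I_n | (hash q K Q a b x == i) || (hash q K Q a b x == j)].

Lemma run_label_lt a b i (x : 'I_n) : run_label n q K Q a b i x < n'.
Proof.
have lt := label_lt a K0 q0 Q0 (ltn_ord x).
rewrite /run_label; apply: leq_trans S2; rewrite mul2n -addnn.
by case: (_ != i); rewrite ?muln1 ?muln0 ?addn0 ?ltn_add2r // (leq_trans lt) // leq_addr.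
Qed.

Definition relabel a b i (x : 'I_n) : 'I_n' := Ordinal (run_label_lt a b i x).

(** Vertices of class [i] get labels below [label_range], those of the other class get labels from
    there on. Equal labels therefore mean equal hash values, and [label_inj] applies. *)
Lemma relabel_inj a b i j : {in run_vertices a b i j &, injective (relabel a b i)}.
Proof.
move=> x y; rewrite !inE => xV yV /(congr1 val) /=; rewrite /run_label => eql.
have ltx := label_lt a K0 q0 Q0 (ltn_ord x); have lty := label_lt a K0 q0 Q0 (ltn_ord y).
have cases (hx hy : nat) : (hx == i) || (hx == j) -> (hy == i) || (hy == j) ->
    label q Q (ceil_div n q) (poly_hash q K a x) x + label_range n q Q * (hx != i) =
    label q Q (ceil_div n q) (poly_hash q K a y) y + label_range n q Q * (hy != i) ->
    hx = hy /\ label q Q (ceil_div n q) (poly_hash q K a x) x =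
                label q Q (ceil_div n q) (poly_hash q K a y) y.
  case: (eqVneq hx i) => [-> _|nx /= /eqP ->];
    case: (eqVneq hy i) => [-> _|ny /= /eqP ->]; rewrite ?muln0 ?muln1 ?addn0 // => eq'.
  - by move: ltx; rewrite eq' ltnNge leq_addl.
  - by move: lty; rewrite -eq' ltnNge leq_addl.
  - by split=> //; move/addIn: eq'.
have [eqh {}eql] := cases _ _ xV yV eql.
by apply: val_inj; apply: (label_inj q0 Q0 _ _ nqK eqh eql).
Qed.

Definition run_graph a b i j : wgraph R n' := induced_graph G (@relabel_inj a b i j).

Definition run_edges a b i j := induced_list (run_vertices a b i j) (relabel a b i) es.

Notation rlist a b i j := (run_list m q K Q end1 end2 a b i j).

Lemma run_edgesE a b i j : run_edges a b i j =
  [seq (relabel a b i (nth e0 es k).1, relabel a b i (nth e0 es k).2) | k <- rlist a b i j].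
Proof.
rewrite /run_edges /induced_list (filter_nth e0) -map_comp /run_list /chosen /sel_upto.
by congr map; apply: eq_filter => k; rewrite !inE.
Qed.

Lemma size_run_edges a b i j : size (run_edges a b i j) = size (rlist a b i j).
Proof. by rewrite run_edgesE size_map. Qed.

Lemma edge_of_run_edges d a b i j k : k < size (rlist a b i j) ->
  edge_of (nth d (run_edges a b i j) k) =
  relabel a b i @: edge_of (nth e0 es (nth 0 (rlist a b i j) k)).
Proof. by move=> ltk; rewrite run_edgesE (nth_map 0) // edge_of_lab. Qed.

Lemma card_run_edges a b i j : #|edges (run_graph a b i j)| = size (rlist a b i j).
Proof.
have := perm_size (induced_edge_list (@relabel_inj a b i j) esG).
by rewrite size_map -cardE -[size _]/(size (run_edges a b i j)) size_run_edges.
Qed.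

(** What the program writes into a window is literally a legal input of the given algorithm for
    [run_graph]; this makes the hypothesis on that algorithm applicable. *)
Lemma run_inputE a b i j :
  input [:: n'; #|edges (run_graph a b i j)|] t (run_graph a b i j) (run_edges a b i j) =
  run_input n m q K Q n' end1 end2 edge_len t a b i j.
Proof.
rewrite /input /run_input card_run_edges run_edgesE /seq_state.
have -> : [seq len (run_graph a b i j) (edge_of e) | e <-
    [seq (relabel a b i (nth e0 es k).1, relabel a b i (nth e0 es k).2) | k <- rlist a b i j]] =
    [seq edge_len e | e <- rlist a b i j].
  rewrite -map_comp; apply/eq_in_map => k; rewrite mem_filter => /andP[/andP[h1 h2] _] /=.
  rewrite edge_of_lab (pullback_imset (@relabel_inj a b i j)) //.
  by rewrite edge_of_subset !inE h1 h2.
by rewrite -!map_comp.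
Qed.

Variables (L N : nat) (out : nat -> nat -> nat -> nat -> state R).
Notation al r := (r %/ (Q * Q) %/ L).
Notation be r := (r %/ (Q * Q) %% L).
Notation ci r := (r %% (Q * Q) %/ Q).
Notation cj r := (r %% (Q * Q) %% Q).

Definition run_out a b i j := output (run_edges a b i j) (out a b i j).

Lemma output_union (st : state R) :
  (forall e, wmem st 3 e = marks m q K L Q end1 end2 out N e) ->
  output es st = union_spanner G
    (fun r : 'I_N => run_vertices (al r) (be r) (ci r) (cj r))
    (fun r => relabel (al r) (be r) (ci r))
    (fun r => run_out (al r) (be r) (ci r) (cj r)).
Proof.
move=> stE; apply/setP => e.
have nthE (k : 'I_(size es)) : tnth (in_tuple es) k = nth e0 es k by rewrite (tnth_nth e0).
apply/imsetP/idP => [[k]|]; rewrite inE.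
  rewrite stE nthE => mk ->; rewrite inE.
  have -> : edge_of (nth e0 es k) \in edges G.
    by rewrite -mem_enum -(perm_mem esG) map_f // mem_nth.
  move: mk; rewrite eqb0 negbK => /hasP[r]; rewrite mem_iota add0n => /andP[_ rN].
  rewrite /mark_run /marked => /andP[ks ok]; apply/existsP; exists (Ordinal rN) => /=.
  move: (al r) (be r) (ci r) (cj r) ks ok => a b i j ks ok.
  have := ks; rewrite mem_filter => /andP[/andP[h1 h2] _].
  rewrite edge_of_subset !inE h1 h2 /=.
  have lti : index (k : nat) (rlist a b i j) < size (run_edges a b i j).
    by rewrite size_run_edges index_mem.
  apply/imsetP; exists (Ordinal lti); rewrite ?inE //=.
  rewrite (tnth_nth (relabel a b i e0.1, relabel a b i e0.2)) /=.
  by rewrite edge_of_run_edges ?index_mem // nth_index.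
move=> /andP[eG /existsP[r /andP[eV]]].
set a := al r; set b := be r; set i := ci r; set j := cj r.
move=> /imsetP[k']; rewrite inE => ok.
rewrite (tnth_nth (relabel a b i e0.1, relabel a b i e0.2)) /=.
have ltk : k' < size (rlist a b i j) by rewrite -size_run_edges.
rewrite edge_of_run_edges //.
set k := nth 0 (rlist a b i j) k'.
have ks : k \in rlist a b i j by rewrite mem_nth.
have := ks; rewrite mem_filter mem_iota add0n => /andP[/andP[h1 h2] /andP[_ km]].
have kV : edge_of (nth e0 es k) \subset run_vertices a b i j by rewrite edge_of_subset !inE h1.
move=> /(congr1 (pullback (run_vertices a b i j) (relabel a b i))).
rewrite !(pullback_imset (@relabel_inj a b i j)) // => ->.
exists (Ordinal km); last by rewrite nthE.
rewrite inE stE /= eqb0 negbK; apply/hasP; exists (r : nat).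
  by rewrite mem_iota /= add0n ltn_ord.
apply/andP; split; first exact: ks.
rewrite -[X in wmem X]/(out a b i j) -[X in index _ X]/(rlist a b i j) /k index_uniq //.
by rewrite filter_uniq ?iota_uniq.
Qed.

End Runs.

(** * Size and running time *)

Section Counting.
Variables (q1 q2 : nat).
Let L := choose_L q1 q2.
Let Q := choose_Q q1 q2.
Let N := q1 * L * (Q * Q).
Hypothesis q12 : q1 <= q2 * q2.

Lemma runs_le_cube : N <= q1 * q1 * q1.
Proof.
rewrite /N /L /Q /choose_L /choose_Q; case: ifPn => [_|]; first by rewrite muln1 mulnA.
rewrite -ltnNge => lt; apply: leq_trans (_ : q1 * (q2 * q2 * q2) <= _); first by lia.
by rewrite -(mulnA q1) leq_mul2l (ltnW lt) orbT.
Qed.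

Lemma runs_le_mixed : N <= q1 * (q2 * q2 * q2).
Proof.
rewrite /N /L /Q /choose_L /choose_Q; case: ifPn => [le|_]; last by lia.
by rewrite muln1 leq_mul2l le orbT.
Qed.

(** Pays for the prime searches, whose cost is quadratic in [q1]. *)
Lemma runs_ge_square : 0 < q2 -> q1 * q1 <= N.
Proof.
move=> q20; rewrite /N -mulnA leq_mul2l; apply/orP; right.
rewrite /L /Q /choose_L /choose_Q; case: ifPn => _.
  by rewrite mul1n; case: (q1) => // q; rewrite leq_pmulr.
by apply: leq_trans q12 _; rewrite leq_pmull.
Qed.

(** Pays for the hashing: since [K <= q1], the [K] steps per endpoint are covered by the [Q * Q]
    runs made with the same hash function. *)
Lemma q_le_QQ : q1 <= Q * Q.
Proof. by rewrite /Q /choose_Q; case: ifP => // _; case: (q1) => // q; rewrite leq_pmulr. Qed.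

End Counting.

Lemma ceil_div_le n f : 0 < f -> 0 < n -> ceil_div n f <= n.
Proof. by move=> f0 n0; rewrite /ceil_div -ltnS ltn_divLR // mulSn; nia. Qed.

Section Log.
Variable R : realType.
Local Open Scope ring_scope.

Lemma ln2_gt0 : 0 < ln 2%:R :> R.
Proof. by rewrite ln_gt0 // ltr1n. Qed.

Lemma log2_le (n k : nat) : (0 < n)%N -> (n <= 2 ^ k)%N -> log2 R n <= k%:R.
Proof.
move=> n0 le; rewrite /log2 ler_pdivrMr ?ln2_gt0 // mulr_natl -lnXn ?ltr0n //.
by rewrite ler_ln ?posrE ?ltr0n ?exprn_gt0 ?ltr0n // -natrX ler_nat.
Qed.

Lemma log2_ge (n k : nat) : (2 ^ k <= n)%N -> k%:R <= log2 R n.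
Proof.
move=> le; have n0 : (0 < n)%N by apply: leq_trans le; rewrite expn_gt0.
rewrite /log2 ler_pdivlMr ?ln2_gt0 // mulr_natl -lnXn ?ltr0n //.
by rewrite ler_ln ?posrE ?ltr0n ?exprn_gt0 ?ltr0n // -natrX ler_nat.
Qed.

(** Rounding the logarithm up adds at most 1, which at most doubles it since [log2 R n] is at least
    1. *)
Lemma exists_uplog (n : nat) : (1 < n)%N ->
  exists k, [/\ (0 < k)%N, (n <= 2 ^ k)%N, log2 R n <= k%:R & k%:R <= 2 * log2 R n].
Proof.
move=> n1; exists (up_log 2 n); have le := up_logP n (isT : 1 < 2)%N.
have k0 : (0 < up_log 2 n)%N by rewrite up_log_gt0.
split=> //; first by apply: log2_le => //; apply: ltnW.
have /log2_ge h1 : (2 ^ (up_log 2 n).-1 <= n)%N by apply/ltnW/up_log_gtn.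
have h2 : 1 <= log2 R n by apply: (@log2_ge n 1).
have -> : (up_log 2 n)%:R = (up_log 2 n).-1%:R + 1 :> R by rewrite natr1 prednK.
lra.
Qed.

Lemma root_le (n f c : nat) : (0 < c)%N -> n%:R `^ (c%:R)^-1 <= f%:R :> R -> (n <= f ^ c)%N.
Proof.
move=> c0 le; rewrite -(ler_nat R) natrX.
have c0' : c%:R != 0 :> R by rewrite pnatr_eq0 -lt0n.
have -> : n%:R = (n%:R `^ c%:R^-1) ^+ c :> R.
  by rewrite -powR_mulrn ?powR_ge0 // -powRrM mulVf // powRr1 // ler0n.
by apply: lerXn2r; rewrite ?nnegrE ?powR_ge0 ?ler0n.
Qed.

End Log.

Local Open Scope ring_scope.

Lemma leq_exp_base x y k : (x <= y)%N -> (x ^ k <= y ^ k)%N.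
Proof. by case: k => // k le; rewrite leq_exp2r. Qed.

(** * The combined algorithm and its analysis *)

Section Spanner.
Variables (R : realType) (A : algorithm) (C : nat).
Hypotheses (C0 : (0 < C)%N)
  (primeC : forall x, (0 < x)%N -> exists2 p, prime p & (x <= p <= C * x)%N).

Definition kappa := (8 * C)%N.
(** With [X = n + m + 2]: the number of runs is at most [q1 ^ 3] and [q1 <= X ^ (kappa + 2)]; the
    stride is [X ^ (word_exp A).+1]; one more factor [X] makes the inequality strict. The doubled
    exponent in [ft_algorithm] gives [W = D * D]. *)
Definition exponent := (3 * (kappa + 2) + word_exp A + 2)%N.

Definition ft_algorithm :=
  Algorithm (setup (word_exp A).+1 ;; main (Defs.code A)) (exponent + exponent).

Definition time_factor := (12 * word_exp A + 4000)%N.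

Section Instance.
Variables (n f : nat) (G : wgraph R n) (es : seq ('I_n * 'I_n)).
Hypotheses (fn : (0 < f < n)%N) (esG : edge_list G es).
Let m := size es.
Let n' := ceil_div n f.
Let X := (n + m + 2)%N.
Let D := (X ^ exponent)%N.
Variables (q1 q2 : nat).
Hypotheses (fp1 : first_prime (8 * f) (fun q => n <= q ^ (q %/ (4 * f)))%N q1)
  (fp2 : first_prime (8 * f) (fun q => q1 <= q * q)%N q2).
Let L := choose_L q1 q2.
Let Q := choose_Q q1 q2.
Let K := (q1 %/ (4 * f))%N.
Let N := (q1 * L * (Q * Q))%N.
Let stride := (X ^ (word_exp A).+1)%N.

Lemma size_es : size es = #|edges G|.
Proof. by have := perm_size esG; rewrite size_map -cardE. Qed.

Lemma q1_le x : (0 < x)%N -> (8 * f <= x)%N ->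
  (forall q, (x <= q)%N -> (n <= q ^ (q %/ (4 * f)))%N) -> (q1 <= C * x)%N.
Proof.
move=> x0 fx H; have [p p_pr /andP[xp pC]] := primeC x0.
by apply: leq_trans pC; apply: (first_prime_le fp1) => //; [exact: leq_trans xp|exact: H].
Qed.

Lemma q2_le x : (0 < x)%N -> (8 * f <= x)%N -> (q1 <= x * x)%N -> (q2 <= C * x)%N.
Proof.
move=> x0 fx H; have [p p_pr /andP[xp pC]] := primeC x0.
apply: leq_trans pC; apply: (first_prime_le fp2) => //; first exact: leq_trans xp.
by apply: leq_trans H _; apply: leq_mul.
Qed.

Lemma q1_le_degree b c : (0 < c)%N -> (n <= b ^ c)%N -> (b <= 8 * f * c)%N ->
  (q1 <= C * (8 * f * c))%N.
Proof.
move=> c0 nb bf; have [f0 _] := andP fn.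
have x0 : (0 < 8 * f * c)%N by rewrite !muln_gt0 f0.
apply: q1_le => // [|q le]; first by rewrite leq_pmulr.
apply: (degree_suffices f0 (leq_trans x0 le) nb le).
exact: leq_trans bf le.
Qed.

Lemma first_primes_facts :
  [/\ (0 < f)%N, (8 * f <= q1)%N, (8 * f <= q2)%N, (q2 <= q1)%N & (q1 <= q2 * q2)%N] /\
  [/\ prime q1, prime q2, (0 < q1)%N, (0 < q2)%N & (q1 <= X ^ (kappa + 2))%N].
Proof.
have [f0 ltfn] := andP fn; have [le1 pr1 P1 _] := fp1; have [le2 pr2 P2 _] := fp2.
have q10 := prime_gt0 pr1; have q20 := prime_gt0 pr2.
do 2!split=> //; first by apply: (first_prime_le fp2) => //; rewrite leq_pmulr.
(* A crude bound for the word length only: [q1] is polynomial in [X], with the constant [8 * C]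
   absorbed by [kappa < 2 ^ kappa <= X ^ kappa]. *)
have le : (q1 <= C * (8 * f * n))%N.
  have n0 : (0 < n)%N := ltn_trans f0 ltfn.
  apply: q1_le => [| |q le]; [by rewrite !muln_gt0 f0|by rewrite leq_pmulr|].
  have nq : (n <= q ^ 1)%N by apply: leq_trans le; rewrite leq_pmull // muln_gt0.
  have fq : (8 * f * 1 <= q)%N by rewrite muln1; apply: leq_trans le; rewrite leq_pmulr.
  exact: degree_suffices f0 (leq_trans n0 nq) nq fq (leqnn q).
apply: leq_trans le _; rewrite expnD.
have XX : (X ^ 2 = X * X)%N by [].
apply: leq_trans (_ : kappa * (X * X) <= _)%N.
  have h : (f * n <= X * X)%N by apply: leq_mul; rewrite /X; lia.
  have -> : (C * (8 * f * n) = kappa * (f * n))%N by rewrite /kappa; lia.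
  by rewrite leq_mul2l h orbT.
rewrite XX leq_mul2r; apply/orP; right; apply: ltnW; apply: leq_trans (ltn_expl kappa (isT : 1 < 2)%N) _.
by rewrite leq_exp2r ?/kappa; rewrite /X; lia.
Qed.

Lemma powers_lt_D :
  [/\ (16 <= D)%N, (stride < D)%N, (X <= stride)%N, (X ^ word_exp A <= stride)%N &
      forall z, (z <= q1 * q1 * q1)%N -> (z < D)%N /\ (z * stride < D)%N].
Proof.
have [_ [_ _ q10 q20 leY]] := first_primes_facts.
have X2 : (4 <= X)%N by have [_ ?] := andP fn; rewrite /X; lia.
have X1 : (1 < X)%N by lia.
have X0 : (0 < X)%N by lia.
split.
- apply: leq_trans (_ : X ^ 2 <= _)%N; first by rewrite (@leq_exp2r 4 X 2).
  by rewrite leq_exp2l // /exponent; lia.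
- by rewrite ltn_exp2l // /exponent; lia.
- by rewrite /stride expnS leq_pmulr // expn_gt0 X0.
- by rewrite leq_exp2l.
move=> z le.
have leY3 : (z <= X ^ (3 * (kappa + 2)))%N.
  apply: leq_trans le _; set Y := (X ^ (kappa + 2))%N.
  have -> : (X ^ (3 * (kappa + 2)) = Y * Y * Y)%N.
    by rewrite [(3 * _)%N]mulnC expnM -/Y !expnS expn0 muln1 mulnA.
  by apply: leq_mul => //; apply: leq_mul.
have lt : (z * stride < D)%N.
  apply: leq_ltn_trans (_ : X ^ (3 * (kappa + 2)) * stride < _)%N.
    by rewrite leq_mul2r leY3 orbT.
  by rewrite -expnD ltn_exp2l // /exponent; lia.
split=> //; apply: leq_ltn_trans lt; rewrite leq_pmulr // expn_gt0 X0 //.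
Qed.

Let W := word_bound ft_algorithm n m.

Lemma W_square : W = (D * D)%N.
Proof. by rewrite /W /word_bound /= expnD. Qed.

Lemma choices : [/\ (0 < Q)%N, (0 < L)%N, (L <= Q)%N, (Q <= q1)%N & (8 * f <= Q)%N].
Proof.
have [[f0 le1 le2 le21 sq] [pr1 pr2 q10 q20 _]] := first_primes_facts.
by rewrite /L /Q /choose_L /choose_Q; case: ifP => _; split.
Qed.

Lemma hash_mode_choice : hash_mode f q1 L Q.
Proof.
have [[f0 le1 le2 le21 sq] [pr1 pr2 q10 q20 _]] := first_primes_facts.
by rewrite /hash_mode /L /Q /choose_L /choose_Q; case: ifP => _; [left|right].
Qed.

Lemma degree_facts : [/\ (0 < K)%N, (K <= q1)%N, (4 * f * K <= q1)%N & (n <= q1 ^ K)%N].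
Proof.
have [[f0 le1 _ _ _] _] := first_primes_facts; have [_ _ P1 _] := fp1.
split=> //; first by rewrite divn_gt0 //; lia.
  exact: leq_div.
by rewrite mulnC; apply: leq_divM.
Qed.

Lemma params_hold (us vs : nat -> nat) :
  (forall e, (e < m)%N -> (us e < n)%N) -> (forall e, (e < m)%N -> (vs e < n)%N) ->
  params n m f q1 K L Q n' stride us vs D W.
Proof.
move=> usn vsn.
have [[f0 le1 le2 le21 sq] [pr1 pr2 q10 q20 _]] := first_primes_facts.
have [Q0 L0 LQ Qq fQ] := choices; have [K0 Kq _ _] := degree_facts.
have [D16 strD Xstr _ small] := powers_lt_D.
have XD : (X < D)%N := leq_ltn_trans Xstr strD.
have ltn0 : (0 < n)%N by have [_] := andP fn; lia.
have le_n' := ceil_div_le f0 ltn0.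
have lt1 z : (z <= q1)%N -> (z < D)%N.
  by move=> le; apply: (proj1 (small z _)); apply: leq_trans le _; rewrite -mulnA leq_pmulr // muln_gt0 q10.
have lt2 x y : (x <= q1)%N -> (y <= q1)%N -> (x * y < D)%N.
  move=> lx ly; apply: (proj1 (small _ _)); apply: leq_trans (leq_mul lx ly) _.
  by rewrite leq_pmulr.
have XE : X = (n + m + 2)%N by [].
have nD : (n < D)%N by apply: leq_ltn_trans XD; rewrite XE; lia.
split => //; try exact: lt1; try exact: lt2.
- exact: W_square.
- exact: prime_gt1.
- by apply: leq_ltn_trans XD; rewrite XE; lia.
- by apply: lt1; apply: leq_trans le1; lia.
- by apply: lt2 => //; apply: leq_trans LQ Qq.
- exact: leq_ltn_trans le_n' nD.
- exact: label_range_le.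
- by apply: (proj2 (small _ _)); exact: runs_le_cube.
Qed.

Lemma cover_runs (F : {set 'I_n}) (u v : 'I_n) :
  (#|F| <= f)%N -> u \notin F -> v \notin F ->
  exists r : 'I_N, let V := run_vertices n q1 K Q
      (r %/ (Q * Q) %/ L)%N (r %/ (Q * Q) %% L)%N (r %% (Q * Q) %/ Q)%N (r %% (Q * Q) %% Q)%N in
    [/\ u \in V, v \in V & [disjoint V & F]].
Proof.
move=> leF uF vF; have [Q0 L0 LQ Qq fQ] := choices.
have [[f0 _ _ _ _] [pr1 _ q10 _ _]] := first_primes_facts.
have [K0 Kq fK nK] := degree_facts.
have [a [b [lta ltb sep]]] := hash_separates f0 pr1 nK fK hash_mode_choice leF uF vF.
(* The pair of classes of [u] and [v] under the separating function; the number of its run is a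
   mixed-radix code, decoded by the equations below. *)
set i := hash q1 K Q a b u; set j := hash q1 K Q a b v.
have iQ : (i < Q)%N by rewrite ltn_mod.
have jQ : (j < Q)%N by rewrite ltn_mod.
have lt_d : (i * Q + j < Q * Q)%N.
  by apply: leq_trans (_ : i.+1 * Q <= _)%N; [rewrite mulSn; lia|rewrite leq_mul2r iQ orbT].
have lt_c : (a * L + b < q1 * L)%N.
  by apply: leq_trans (_ : a.+1 * L <= _)%N; [rewrite mulSn; lia|rewrite leq_mul2r lta orbT].
have lt_r : ((a * L + b) * (Q * Q) + (i * Q + j) < N)%N.
  by apply: leq_trans (_ : (a * L + b).+1 * (Q * Q) <= _)%N; [rewrite mulSn; lia|rewrite leq_mul2r lt_c orbT].
have QQ0 : (0 < Q * Q)%N by rewrite muln_gt0 Q0.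
have cE : (((a * L + b) * (Q * Q) + (i * Q + j)) %/ (Q * Q) = a * L + b)%N.
  by rewrite divnMDl // divn_small // addn0.
have dE : (((a * L + b) * (Q * Q) + (i * Q + j)) %% (Q * Q) = i * Q + j)%N.
  by rewrite modnMDl modn_small.
exists (Ordinal lt_r); rewrite [nat_of_ord _]/= cE dE.
have -> : ((a * L + b) %/ L = a)%N by rewrite divnMDl // divn_small // addn0.
have -> : ((a * L + b) %% L = b)%N by rewrite modnMDl modn_small.
have -> : ((i * Q + j) %/ Q = i)%N by rewrite divnMDl // divn_small // addn0.
have -> : ((i * Q + j) %% Q = j)%N by rewrite modnMDl modn_small.
split; rewrite ?inE ?eqxx ?orbT //.
apply/pred0P => x /=; rewrite inE; apply/negbTE/negP => /andP[xV xF].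
have [/negbTE n1 /negbTE n2] := sep x xF.
by move: xV; rewrite /i /j n1 n2.
Qed.

Lemma wmods_setup k a : (a < 4)%N || (17 < a)%N -> a \notin wmods (setup k).
Proof.
by rewrite /setup /search /prime_test /degree_test /square_test /for_loop /vset /= !inE; lia.
Qed.

Lemma time_bound TT : (0 < TT)%N ->
  (160 * q1.+1 * q1.+1 + 120 * q2.+1 * q2.+1 + 200 + 12 * (word_exp A).+1 +
     (q1 * L * (Q * Q * (400 * m.+1 + 4 * TT) + 300 * m.+1 * K.+1 + 100) + 50) <=
   time_factor * (N * (TT + m)))%N.
Proof.
move=> TT0; have [[f0 _ _ le21 sq] [_ _ q10 q20 _]] := first_primes_facts.
have [Q0 L0 _ _ _] := choices; have [_ Kq _ _] := degree_facts.
have qN : (q1 * q1 <= N)%N by apply: runs_ge_square.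
have KQ : (K.+1 <= 2 * (Q * Q))%N.
  have QQ0 : (0 < Q * Q)%N by rewrite muln_gt0 Q0.
  by move: QQ0 (leq_trans Kq (q_le_QQ sq)); rewrite -/Q -/K; clear; lia.
have h1 : (q1.+1 * q1.+1 <= 4 * N)%N by clear -qN q10; nia.
have h2 : (q2.+1 * q2.+1 <= 4 * N)%N by apply: leq_trans (leq_mul _ _) h1; rewrite ltnS.
rewrite /time_factor; move: (word_exp A) => w.
have NE : N = (q1 * L * (Q * Q))%N by [].
move: NE KQ qN h1 h2; move: N (q1 * L)%N (Q * Q)%N K m => N' M QQ K' m' NE KQ qN h1 h2.
have MQ0 : (0 < QQ)%N by clear -KQ; lia.
have h3 : (M * (300 * m'.+1 * K'.+1) <= 600 * (N' * m'.+1))%N.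
  have := leq_mul (leqnn (M * (300 * m'.+1))) KQ; rewrite NE; clear; lia.
have h4 : (M <= N')%N by rewrite NE leq_pmulr.
have N0 : (0 < N')%N by clear -qN q10; nia.
have h5 : (N' <= N' * TT)%N by rewrite leq_pmulr.
have h6 : (w <= w * (N' * TT))%N by rewrite leq_pmulr // muln_gt0 N0.
have h7 := leq0n (w * (N' * m')).
have -> : (M * (QQ * (400 * m'.+1 + 4 * TT) + 300 * m'.+1 * K'.+1 + 100) =
    N' * (400 * m'.+1 + 4 * TT) + M * (300 * m'.+1 * K'.+1) + M * 100)%N.
  by rewrite !(mulnDr M) NE mulnA.
have h8 : (160 * q1.+1 * q1.+1 + 120 * q2.+1 * q2.+1 <= 1120 * N')%N.
  by move: h1 h2; rewrite -!mulnA; clear; lia.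
apply: leq_trans (_ : 1120 * N' + 200 + 12 * w.+1 + (N' * (400 * m'.+1 + 4 * TT) +
  600 * (N' * m'.+1) + N' * 100 + 50) <= _)%N; first by move: h3 h4 h8; clear; lia.
by move: h5 h6 h7 N0; clear; lia.
Qed.

Lemma state0_ok (t : R) (st : state R) :
  (forall a i, (a < 4)%N || (17 < a)%N -> wmem st a i = wmem (input [:: n; m; f] t G es) a i) ->
  (forall a i, rmem st a i = rmem (input [:: n; m; f] t G es) a i) ->
  [/\ wmem st a_q 0 = q1, wmem st a_K 0 = K, wmem st a_L 0 = L & wmem st a_Q 0 = Q] ->
  [/\ wmem st a_B 0 = ceil_div n q1, wmem st a_S 0 = label_range n q1 Q,
      wmem st a_n' 0 = n' & wmem st a_stride 0 = stride] ->
  forall out, env n m f q1 K L Q n' stride (end1 es fn) (end2 es fn) (edge_len G es fn) t st /\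
    progress m q1 K L Q stride (end1 es fn) (end2 es fn) out 0 st.
Proof.
move=> w r [hq hK hL hQ] [hB hS hn hs] out; split.
  split=> //; try by rewrite w.
  - by move=> e lt; rewrite w // /input /= (nth_map (end0 fn)).
  - by move=> e lt; rewrite w // /input /= (nth_map (end0 fn)).
  - by move=> e lt; rewrite r /input /= (nth_map (end0 fn)).
split; first by rewrite w.
  by move=> a i _; rewrite w ?r; [split; rewrite /input /= nth_nil|apply/orP; right; lia].
by move=> e; rewrite w // /input /= nth_nil.
Qed.

Lemma ft_run (t : R) (s : nat -> R) (tau : nat -> nat -> R -> R) :
  1 <= t -> (forall n m m' : nat, (m <= m')%N -> tau n m t <= tau n m' t) ->
  builds_spanners A t s tau ->
  exists T H, [/\ runs ft_algorithm [:: n; m; f] t G es T H,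
    is_ft_spanner f t G H, #|H|%:R <= N%:R * s n',
    T%:R <= time_factor%:R * (N%:R * (tau n' m t + m%:R)) & 0 <= s n' /\ 0 <= tau n' m t].
Proof.
move=> t1 tau_mono Aok.
have [[f0 le1 le2 le21 sq] [pr1 pr2 q10 q20 _]] := first_primes_facts.
have [Q0 L0 LQ Qq fQ] := choices; have [K0 Kq fK nK] := degree_facts.
have [D16 strD Xstr powstr small] := powers_lt_D.
have S2 := label_range_le fn le1 fQ.
pose us := end1 es fn; pose vs := end2 es fn; pose ls := edge_len G es fn.
pose Gr a b i j := run_graph G q10 Q0 K0 nK S2 a b i j.
pose esr a b i j := run_edges es q10 Q0 K0 S2 a b i j.
pose inp a b i j := run_input n m q1 K Q n' us vs ls t a b i j.
pose P (x : nat * nat * nat * nat) (y : nat * state R) := let: (a, b, i, j) := x in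
  [/\ exec (word_bound A n' (size (esr a b i j))) (Defs.code A) (inp a b i j) y.1 y.2,
      is_spanner t (Gr a b i j) (output (esr a b i j) y.2),
      #|output (esr a b i j) y.2|%:R <= s n' & y.1%:R <= tau n' m t].
have [g gP] : {g : nat * nat * nat * nat -> nat * state R & forall x, P x (g x)}.
  apply: choice => -[[[a b] i] j].
  have esrG : edge_list (Gr a b i j) (esr a b i j) by apply: induced_edge_list.
  have [T [H [[st [ex ->]] sp sH sT]]] := Aok n' (Gr a b i j) (esr a b i j) esrG.
  exists (T, st); split=> //=.
    by rewrite /inp -(run_inputE t fn q10 Q0 K0 nK S2 esG a b i j).
  (* An induced subgraph has at most [m] edges; this is where the monotonicity of [tau] enters. *)
  apply: le_trans sT _; apply: tau_mono.
  by rewrite (card_run_edges fn q10 Q0 K0 nK S2 esG); apply: size_sel_upto.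
pose out a b i j := (g (a, b, i, j)).2; pose TA a b i j := (g (a, b, i, j)).1.
(* The signs of [s] and [tau] are read off an actual run: a cardinality is nonnegative, and every
   execution takes at least one time unit. *)
have s0 : 0 <= s n' by have [_ _ h _] := gP (0, 0, 0, 0)%N; apply: le_trans h.
have tau1 : 1 <= tau n' m t.
  have [ex _ _ h] := gP (0, 0, 0, 0)%N; apply: le_trans h.
  by rewrite ler1n; apply: exec_cost_gt0 ex.
(* Running times are natural numbers, so they stay below the truncation of the real bound. *)
pose TT := Num.truncn (tau n' m t).
have TT_le : TT%:R <= tau n' m t by rewrite truncn_le; apply: le_trans tau1.
have TT1 : (1 <= TT)%N by rewrite truncn_ge_nat //; apply: le_trans tau1.
have m_le : (m <= X)%N by rewrite /X; lia.
have exA a b i j : (a < q1)%N -> (b < L)%N -> (i < Q)%N -> (j < Q)%N ->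
    [/\ (word_bound A n' (size (esr a b i j)) <= stride)%N, (TA a b i j <= TT)%N &
     exec (word_bound A n' (size (esr a b i j))) (Defs.code A) (inp a b i j) (TA a b i j) (out a b i j)].
  move=> _ _ _ _; have [ex _ _ h] := gP (a, b, i, j); split=> //.
    (* A run uses the word bound of its own subgraph, which has at most [n] vertices and [m] edges;
       hence it is at most [X ^ word_exp A] and fits into the stride. *)
    apply: leq_trans powstr; rewrite /word_bound leq_exp_base //.
    rewrite /esr (size_run_edges es fn) leq_add2r; apply: leq_add; last exact: size_sel_upto.
    exact: ceil_div_le f0 (ltn_trans f0 (proj2 (andP fn))).
  by rewrite truncn_ge_nat //; apply: le_trans tau1.
have us_lt e : (e < m)%N -> (us e < n)%N by move=> _; apply: ltn_ord.
have vs_lt e : (e < m)%N -> (vs e < n)%N by move=> _; apply: ltn_ord.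
have ok := params_hold us_lt vs_lt.
have small' z : (z <= q1 * q1)%N -> (z < D)%N.
  by move=> le; apply: (proj1 (small z _)); apply: leq_trans le _; rewrite leq_pmulr.
have lt1 z : (z <= q1)%N -> (z < D)%N.
  by move=> le; apply: small'; apply: leq_trans le _; rewrite leq_pmulr.
pose st0 := input [:: n; m; f] t G es.
have n0 : (0 < n)%N := ltn_trans f0 (proj2 (andP fn)).
have SD : (label_range n q1 Q < D)%N.
  by have := p_n' ok; have := S2; rewrite -/n'; lia.
have run1 := @setup_ok R st0 n m f (word_exp A).+1 q1 q2 D W D16 W_square f0 n0 (p_n ok) (p_m ok)
  (lt1 _ (leqnn _)) (lt1 _ le21) (lt1 _ le1) (small' _ (leqnn _)) (small' _ (leq_mul le21 le21))
  SD strD fp1 fp2 erefl erefl erefl.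
have run2 : hoare W (Defs.code ft_algorithm) st0
    (160 * q1.+1 * q1.+1 + 120 * q2.+1 * q2.+1 + 200 + 12 * (word_exp A).+1 +
     (q1 * L * (Q * Q * (400 * m.+1 + 4 * TT) + 300 * m.+1 * K.+1 + 100) + 50))
    (fun st' => forall e, wmem st' 3 e = marks m q1 K L Q us vs out N e).
  apply: hoare_seq; apply: hoare_conseq (hoare_frame run1) _ _; first exact: leqnn.
  move=> st1 [[h1 h2] [fw fr]].
  have [E pr] := @state0_ok t st1 (fun a i h => fw a (wmods_setup _ h) i) (fun a i => fr a isT i) h1 h2 out.
  have str2 : (2 <= stride)%N by apply: leq_trans Xstr; rewrite /X; lia.
  exact: (@main_ok R n m f q1 K L Q n' stride us vs ls t D W ok (Defs.code A)
    (leq_trans m_le Xstr) str2 (fun a b i j => word_bound A n' (size (esr a b i j))) TA out TT exA st1 E pr).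
have [T [st [ex leT mk]]] := run2.
have outE := output_union (fn := fn) q10 Q0 K0 nK S2 esG mk.
exists T, (output es st).
have N_pos : (0 < N)%N by rewrite !muln_gt0 q10 L0 Q0.
split.
- by exists st.
- pose inj (r : 'I_N) := @relabel_inj n f q1 K Q q10 Q0 K0 nK S2
    (r %/ (Q * Q) %/ L)%N (r %/ (Q * Q) %% L)%N (r %% (Q * Q) %/ Q)%N (r %% (Q * Q) %% Q)%N.
  rewrite outE; apply: (union_spanner_ft (lab_inj := inj) t1) => [r|F u v leF uF vF].
    by have [_ sp _ _] := gP (r %/ (Q * Q) %/ L, r %/ (Q * Q) %% L, r %% (Q * Q) %/ Q, r %% (Q * Q) %% Q)%N.
  exact: cover_runs.
- rewrite outE; apply: le_trans (_ : (\sum_(r < N) #|run_out es q10 Q0 K0 S2 out (r %/ (Q * Q) %/ L)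
    (r %/ (Q * Q) %% L) (r %% (Q * Q) %/ Q) (r %% (Q * Q) %% Q)|)%N%:R <= _).
    by rewrite ler_nat; apply: card_union_spanner => r; apply: relabel_inj.
  rewrite natr_sum; apply: le_trans (_ : \sum_(r < N) s n' <= _).
    apply: ler_sum => r _.
    by have [_ _ h _] := gP (r %/ (Q * Q) %/ L, r %/ (Q * Q) %% L, r %% (Q * Q) %/ Q, r %% (Q * Q) %% Q)%N.
  by rewrite sumr_const card_ord mulr_natl.
- apply: le_trans (_ : (time_factor * (N * (TT + m)))%N%:R <= _); last first.
    by rewrite !natrM natrD ler_wpM2l // ler_wpM2l // lerD2r.
  rewrite ler_nat; apply: leq_trans leT _.
  exact: time_bound.
- by split=> //; apply: le_trans tau1.
Qed.

End Instance.
End Spanner.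

Local Open Scope classical_set_scope.

Theorem theorem7p2 (R : realType) (A : algorithm) :
  exists (B : algorithm) (C1 : nat -> R) (C2 : R) (C3 : (nat -> R) -> R),
  forall (t : R) (s : nat -> R) (tau : nat -> nat -> R -> R),
    1 <= t ->
    (forall n m m' : nat, (m <= m')%N -> tau n m t <= tau n m' t) ->
    builds_spanners A t s tau ->
  forall (n f : nat) (G : wgraph R n) (es : seq ('I_n * 'I_n)),
    (0 < f < n)%N ->
    edge_list G es ->
  exists (T : nat) (H : {set {set 'I_n}}),
    let m := #|edges G| in
    let size_bound := s (ceil_div n f) in
    let time_bound := tau (ceil_div n f) m t + m%:R in
    [/\ runs B [:: n; m; f] t G es T H,
        is_ft_spanner f t G H,
        (forall c : nat, (0 < c)%N -> n%:R `^ (c%:R)^-1 <= f%:R :> R ->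
           #|H|%:R <= C1 c * (f%:R ^+ 3 * size_bound) /\
           T%:R <= C1 c * (f%:R ^+ 3 * time_bound)),
        (f%:R <= log2 R n ->
           #|H|%:R <= C2 * (log2 R n ^+ 5 * size_bound) /\
           T%:R <= C2 * (log2 R n ^+ 5 * time_bound))
      & forall phi : nat -> R, phi @ \oo --> (0 : R) ->
          log2 R n <= f%:R -> f%:R <= n%:R `^ phi n ->
          #|H|%:R <= C3 phi * ((f%:R * log2 R n) ^+ 3 * size_bound) /\
          T%:R <= C3 phi * ((f%:R * log2 R n) ^+ 3 * time_bound)].
Proof.
have [C C0 primeC] := exists_prime_within.
(* The first and third constants come from [N <= q1 ^ 3] with [q1 <= 8 * C * c * f] and
   [q1 <= 8 * C * f * k], where [k] is at most twice the logarithm. The second comes from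
   [N <= q1 * q2 ^ 3] with [q1 <= 8 * C * k ^ 2] and [q2 <= 8 * C * C * k]; the factor [2 ^ 5] again
   replaces [k] by the logarithm. *)
exists (ft_algorithm A C), (fun c => (time_factor A)%:R * (8 * C * c)%N%:R ^+ 3),
  ((time_factor A)%:R * (8 * C * (8 * C * C) ^ 3 * 2 ^ 5)%N%:R),
  (fun _ => (time_factor A)%:R * (16 * C)%N%:R ^+ 3).
move=> t s tau t1 tau_mono Aok n f G es fn esG.
have [f0 ltfn] := andP fn; have n0 : (0 < n)%N := ltn_trans f0 ltfn.
have [q1 fp1] : exists q1, first_prime (8 * f) (fun q => n <= q ^ (q %/ (4 * f)))%N q1.
  have [|p p_pr /andP[lp _]] := primeC (8 * f * n)%N; first by rewrite !muln_gt0 f0.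
  have fp : (8 * f <= p)%N by apply: leq_trans lp; rewrite leq_pmulr.
  have np : (n <= p ^ 1)%N by apply: leq_trans lp; rewrite leq_pmull // muln_gt0.
  have Pp : (n <= p ^ (p %/ (4 * f)))%N.
    by apply: (degree_suffices f0 (prime_gt0 p_pr) np); rewrite ?muln1.
  have [q fpq _] := @first_primeP _ (fun q => n <= q ^ (q %/ (4 * f)))%N _ fp p_pr Pp.
  by exists q.
have [q2 fp2 _] : exists2 q2, first_prime (8 * f) (fun q => q1 <= q * q)%N q2 & (q2 <= q1)%N.
  have [le1 pr1 _ _] := fp1; apply: first_primeP => //.
  by rewrite leq_pmulr // prime_gt0.
have [T [H [runsB ft sizeH timeT [s0 tau0]]]] :=
  ft_run C0 primeC fn esG fp1 fp2 t1 tau_mono Aok.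
rewrite (size_es esG) in runsB timeT tau0.
exists T, H; move=> m size_bound time_bound.
set N := (_ * _ * _)%N in sizeH timeT.
have [[_ _ _ le21 sq] [_ _ q10 q20 _]] := first_primes_facts A C0 primeC es fn fp1 fp2.
(* All six bounds follow from a bound on the number [N] of runs alone. *)
have fin (g r : R) : N%:R <= g * r ->
    #|H|%:R <= (time_factor A)%:R * g * (r * size_bound) /\
    T%:R <= (time_factor A)%:R * g * (r * time_bound).
  move=> le; have tm0 : 0 <= time_bound by rewrite addr_ge0.
  have gr0 : 0 <= g * r by apply: le_trans le.
  have -> : (time_factor A)%:R * g * (r * size_bound) = (time_factor A)%:R * (g * r * size_bound).
    by rewrite !mulrA.
  have -> : (time_factor A)%:R * g * (r * time_bound) = (time_factor A)%:R * (g * r * time_bound).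
    by rewrite !mulrA.
  split.
    apply: le_trans sizeH _; apply: le_trans (_ : g * r * size_bound <= _).
      by rewrite ler_wpM2r.
    apply: ler_peMl; first exact: mulr_ge0 gr0 s0.
    by rewrite ler1n /time_factor addn_gt0 orbT.
  by apply: le_trans timeT _; rewrite ler_wpM2l // ler_wpM2r.
have n1 : (1 < n)%N by lia.
have [k [k0 nk lk kl]] := exists_uplog R n1.
have l0 : 0 <= log2 R n by have : 0 <= k%:R :> R by []; lra.
have q1k : (q1 <= C * (8 * f * k))%N.
  apply: (q1_le_degree primeC fn fp1 k0 nk).
  by apply: leq_trans (_ : 8 * f <= _)%N; [clear -f0; lia|rewrite leq_pmulr].
have N3 : (N <= q1 ^ 3)%N by rewrite !expnS expn0 muln1 mulnA; apply: runs_le_cube.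
split=> //.
- move=> c c0 fc; apply: fin.
  have q1c : (q1 <= 8 * C * c * f)%N.
    have -> : (8 * C * c * f = C * (8 * f * c))%N by clear; lia.
    apply: (q1_le_degree primeC fn fp1 c0 (root_le c0 fc)).
    by rewrite -mulnA mulnCA leq_pmulr // muln_gt0.
  rewrite -exprMn -natrM -natrX ler_nat; apply: leq_trans N3 _.
  by rewrite leq_exp2r.
- move=> fl; apply: fin.
  have fk : (f <= k)%N by rewrite -(ler_nat R); apply: le_trans fl lk.
  have q1kk : (q1 <= 8 * C * (k * k))%N.
    apply: leq_trans q1k _; rewrite -!mulnA mulnCA leq_mul2l leq_mul2l leq_mul2r fk.
    by rewrite !orbT.
  (* The square of [8 * C * k] is at least [8 * C * k ^ 2], hence at least [q1]. *)
  have q2k : (q2 <= C * (8 * C * k))%N.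
    apply: (q2_le primeC fp2); first by rewrite !muln_gt0 C0.
      by rewrite -mulnA leq_mul2l; apply: leq_trans fk _; rewrite leq_pmull.
    apply: leq_trans q1kk _.
    have -> : (8 * C * k * (8 * C * k) = 8 * C * (k * k) * (8 * C))%N by clear; lia.
    by rewrite leq_pmulr // muln_gt0.
  apply: le_trans (_ : (8 * C * (8 * C * C) ^ 3 * k ^ 5)%N%:R <= _); last first.
    move: (8 * C * (8 * C * C) ^ 3)%N => a.
    rewrite (natrM _ a (k ^ 5)) (natrM _ a (2 ^ 5)) -mulrA; apply: ler_wpM2l => //.
    by rewrite !natrX -exprMn; apply: lerXn2r; rewrite ?nnegrE // mulr_ge0.
  have Nm : (N <= q1 * (q2 * q2 * q2))%N by apply: runs_le_mixed.
  rewrite ler_nat; apply: leq_trans Nm _.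
  apply: leq_trans (leq_mul q1kk (leq_mul (leq_mul q2k q2k) q2k)) _.
  by rewrite !expnS !expn0; apply: eq_leq; lia.
- move=> phi _ _ _; apply: fin.
  apply: le_trans (_ : (8 * C * (f * k))%N%:R ^+ 3 <= _).
    rewrite -natrX ler_nat; apply: leq_trans N3 _; rewrite leq_exp2r //.
    by apply: leq_trans q1k _; lia.
  have fl0 : 0 <= f%:R * log2 R n by rewrite mulr_ge0.
  rewrite -exprMn; apply: lerXn2r; rewrite ?nnegrE //; first exact: mulr_ge0.
  rewrite (_ : 16 * C = 8 * C * 2)%N; last by lia.
  rewrite !natrM -!mulrA !ler_wpM2l // mulrCA.
  by rewrite ler_wpM2l.
Qed.
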